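(* Let $\mathbb D=\{|z|<1\}$ and let $f:\overline{\mathbb D}\to\overline{\mathbb D}$ be a homeomorphism onto $\overline{\mathbb D}$ which is harmonic in $\mathbb D$ and $\mathscr C^1$-smooth on $\overline{\mathbb D}$. Then $$\int_{\partial\mathbb D}|\det Df|\,|dz|\;\geqslant\;\iint_{\mathbb D}|Df|^2\;\geqslant\;2\iint_{\mathbb D}|\det Df|=2\pi .$$ The first inequality is strict unless $f$ is an isometry.
   Context: $|Df|^2$ denotes the squared Hilbert–Schmidt norm of the differential, $|Df|^2=2(|f_z|^2+|f_{\bar z}|^2)$, and $\det Df=|f_z|^2-|f_{\bar z}|^2$ is the Jacobian determinant; integrals over $\mathbb D$ are with respect to area measure. *)

(* Defs.v *)
From Stdlib Require Import Reals Lra.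
Open Scope R_scope.

(* The plane is R x R; a map f : closed disk -> closed disk is given by its
   two real components u, v : R -> R -> R  (f(x+iy) = u(x,y) + i v(x,y)). *)

Definition open_disk (x y : R) : Prop := x ^ 2 + y ^ 2 < 1.
Definition closed_disk (x y : R) : Prop := x ^ 2 + y ^ 2 <= 1.

Definition cont_on (S : R -> R -> Prop) (F : R -> R -> R) : Prop :=
  forall x y, S x y -> forall eps, 0 < eps ->
    exists del, 0 < del /\
      forall x' y', S x' y' -> (x' - x) ^ 2 + (y' - y) ^ 2 < del ^ 2 ->
        Rabs (F x' y' - F x y) < eps.

Definition partial_x (F G : R -> R -> R) (x y : R) : Prop :=
  derivable_pt_lim (fun t => F t y) x (G x y).
Definition partial_y (F G : R -> R -> R) (x y : R) : Prop :=
  derivable_pt_lim (fun t => F x t) y (G x y).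

Definition homeo_closed_disk (u v : R -> R -> R) : Prop :=
  cont_on closed_disk u /\ cont_on closed_disk v /\
  exists g1 g2 : R -> R -> R,
    cont_on closed_disk g1 /\ cont_on closed_disk g2 /\
    (forall x y, closed_disk x y -> closed_disk (u x y) (v x y)) /\
    (forall x y, closed_disk x y -> closed_disk (g1 x y) (g2 x y)) /\
    (forall x y, closed_disk x y ->
        g1 (u x y) (v x y) = x /\ g2 (u x y) (v x y) = y) /\
    (forall x y, closed_disk x y ->
        u (g1 x y) (g2 x y) = x /\ v (g1 x y) (g2 x y) = y).

Definition harmonic_in_disk (F : R -> R -> R) : Prop :=
  exists Fx Fy Fxx Fxy Fyx Fyy : R -> R -> R,
    (forall x y, open_disk x y ->
       partial_x F Fx x y /\ partial_y F Fy x y /\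
       partial_x Fx Fxx x y /\ partial_y Fx Fxy x y /\
       partial_x Fy Fyx x y /\ partial_y Fy Fyy x y /\
       Fxx x y + Fyy x y = 0) /\
    cont_on open_disk Fx /\ cont_on open_disk Fy /\
    cont_on open_disk Fxx /\ cont_on open_disk Fxy /\
    cont_on open_disk Fyx /\ cont_on open_disk Fyy.

Definition C1_closed_disk (F Fx Fy : R -> R -> R) : Prop :=
  (forall x y, open_disk x y -> partial_x F Fx x y /\ partial_y F Fy x y) /\
  cont_on closed_disk Fx /\ cont_on closed_disk Fy.

Definition Rint (g : R -> R) (a b I : R) : Prop :=
  exists pr : Riemann_integrable g a b, RiemannInt pr = I.

Definition disk_integral (g : R -> R -> R) (I : R) : Prop :=
  exists Fr : R -> R,
    (forall r, 0 <= r <= 1 ->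
       Rint (fun t => g (r * cos t) (r * sin t) * r) 0 (2 * PI) (Fr r)) /\
    Rint Fr 0 1 I.

Definition circle_integral (g : R -> R -> R) (I : R) : Prop :=
  Rint (fun t => g (cos t) (sin t)) 0 (2 * PI) I.

(* |Df|^2 (squared Hilbert-Schmidt norm = 2(|f_z|^2+|f_zbar|^2)) and det Df. *)
Definition HS2 (ux uy vx vy : R -> R -> R) (x y : R) : R :=
  ux x y ^ 2 + uy x y ^ 2 + vx x y ^ 2 + vy x y ^ 2.
Definition jac (ux uy vx vy : R -> R -> R) (x y : R) : R :=
  ux x y * vy x y - uy x y * vx x y.

Definition isometry_closed_disk (u v : R -> R -> R) : Prop :=
  forall x y x' y', closed_disk x y -> closed_disk x' y' ->
    (u x y - u x' y') ^ 2 + (v x y - v x' y') ^ 2 = (x - x') ^ 2 + (y - y') ^ 2.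

(* Main.v *)
Require Import Defs.
From Stdlib Require Import Reals Lra Classical FunctionalExtensionality.
From Coquelicot Require Import Coquelicot.
Open Scope R_scope.

(* Let [F = exp (i phi)] be the boundary map; after a reflection, [phi] increases.

   Sign of the Jacobian.  If a combination [U] of [u] and [v] had a critical point at [z], then, by the
   Poisson formula, [U - U z] on the circle would be orthogonal to all trigonometric polynomials of
   degree one divided by [|exp (i s) - z|^4].  But [U - U z] changes sign exactly twice on the circle,
   so one of these has the same sign: contradiction.  Hence [det Df <> 0] in the disk, and
   [int int det Df = 1/2 int F x dF = PI] gives both its sign and the last equality.

   First inequality.  On the circle [det Df = F_r x F_t = phi' (F . F_r)], and
   [int int |Df|^2 = int F . F_r], so that the gap is the derivative at [r = 1] of
   [K r = int (phi' t - 1) (F t . f (r exp (i t))) dt], and [K 1 = 0].  With the Poisson formula,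
   Fubini and an integration by parts, [- 2 PI K r / (1 - r)] becomes the integral of a positive
   kernel against [lift_defect], up to an error that tends to zero; [lift_defect a >= 0] follows by
   averaging over [t] the fact that the sine lies below its tangent at [a / 2] at the point
   [phi (t + a) - phi t - a / 2], because [phi (t + a) - phi t] has mean [a].  Equality forces
   [phi (t + a) - phi t = a], that is, a rotation. *)

(** * Calculus of integrals of continuous functions *)

(** That the homeomorphism maps the circle to itself must be proved; this comes from harmonicity,
    not from invariance of domain. By the strong maximum principle interior points go to interior
    points, so the inverse sends the circle into the circle, and a continuous injective circle map
    is onto.

    [f] is only [C^1] up to the boundary: second derivatives are available for [0 < r < 1] alone,
    and the polar form is singular at [r = 0]. Hence each identity of Green type says that an
    integral over the circle of radius [r] has a known derivative for [0 < r < 1] and is continuous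
    on [[0, 1]]. For the same reason the normal derivative on the circle is never written as a
    singular integral; the gap is reached through difference quotients of [K] from inside.

    The factor [phi' - 1] in [K] is forced by [det Df - F . F_r = (phi' - 1) (F . F_r)]. The tangent
    is taken at [a / 2] because the denominator of the Poisson kernel is
    [(1 - r)^2 + 4 r sin^2 (a / 2)]: half-angle sines and cosines appear and combine into
    [sin (phi (t + a) - phi t - a / 2)]. *)

Lemma continuity_2d_pt_comp (f a b : R -> R -> R) (x y : R) :
  continuity_2d_pt f (a x y) (b x y) ->
  continuity_2d_pt a x y -> continuity_2d_pt b x y ->
  continuity_2d_pt (fun x y => f (a x y) (b x y)) x y.
Proof.
  intros Hf Ha Hb eps.
  destruct (Hf eps) as [d Hd].
  destruct (Ha d) as [d1 H1]. destruct (Hb d) as [d2 H2].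
  exists (mkposreal _ (Rmin_stable_in_posreal d1 d2)); simpl.
  intros u v Hu Hv. apply Hd.
  - apply H1; eapply Rlt_le_trans; eauto using Rmin_l.
  - apply H2; eapply Rlt_le_trans; eauto using Rmin_r.
Qed.

Lemma continuous_comp_2d (f : R -> R -> R) (a b : R -> R) (x : R) :
  continuity_2d_pt f (a x) (b x) -> continuous a x -> continuous b x ->
  continuous (fun x => f (a x) (b x)) x.
Proof.
  intros Hf Ha Hb. apply continuity_pt_filterlim in Ha, Hb.
  apply continuity_pt_filterlim.
  assert (H : continuity_2d_pt (fun u v : R => f (a u) (b u)) x 0).
  { apply (continuity_2d_pt_comp f (fun u _ => a u) (fun u _ => b u)); auto.
    - apply (continuity_1d_2d_pt_comp a (fun u _ => u)); auto. apply continuity_2d_pt_id1.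
    - apply (continuity_1d_2d_pt_comp b (fun u _ => u)); auto. apply continuity_2d_pt_id1. }
  intros eps Heps. destruct (H (mkposreal _ Heps)) as [d Hd].
  exists d; split; [apply cond_pos|]. intros y [_ Hy]. simpl in *.
  apply (Hd y 0); [exact Hy|]. rewrite Rminus_diag, Rabs_R0. apply cond_pos.
Qed.

Lemma continuous_slice_r (f : R -> R -> R) (x y : R) :
  continuity_2d_pt f x y -> continuous (f x) y.
Proof.
  intros H. apply (continuous_comp_2d f (fun _ => x) (fun y => y)); auto.
  apply continuous_const. apply continuous_id.
Qed.

Lemma continuous_slice_l (f : R -> R -> R) (x y : R) :
  continuity_2d_pt f x y -> continuous (fun x => f x y) x.
Proof.
  intros H. apply (continuous_comp_2d f (fun x => x) (fun _ => y)); auto.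
  apply continuous_id. apply continuous_const.
Qed.

Lemma continuity_2d_pt_snd (g : R -> R) (x y : R) :
  continuous g y -> continuity_2d_pt (fun _ y => g y) x y.
Proof.
  intros H. apply (continuity_1d_2d_pt_comp g (fun _ v => v)).
  now apply continuity_pt_filterlim. apply continuity_2d_pt_id2.
Qed.

Lemma continuity_2d_pt_fst (g : R -> R) (x y : R) :
  continuous g x -> continuity_2d_pt (fun x _ => g x) x y.
Proof.
  intros H. apply (continuity_1d_2d_pt_comp g (fun v _ => v)).
  now apply continuity_pt_filterlim. apply continuity_2d_pt_id1.
Qed.

Lemma continuous_is_derive (f : R -> R) (x l : R) : is_derive f x l -> continuous f x.
Proof. intros H. apply (ex_derive_continuous f). now exists l. Qed.

Lemma ex_RInt_cont (f : R -> R) (a b : R) :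
  (forall t, continuous f t) -> ex_RInt f a b.
Proof. intros H. apply (ex_RInt_continuous (V := R_CompleteNormedModule)). intros z _. apply H. Qed.

Lemma is_derive_upper (f : R -> R) (a b : R) :
  (forall t, continuous f t) -> is_derive (fun b => RInt f a b) b (f b).
Proof.
  intros H. apply (is_derive_RInt f (fun b => RInt f a b) a b); auto.
  exists (mkposreal 1 Rlt_0_1). intros y _. apply (RInt_correct (V := R_CompleteNormedModule)). now apply ex_RInt_cont.
Qed.

Lemma RInt_cont_ext (f g : R -> R) (a b : R) :
  (forall t, f t = g t) -> RInt f a b = RInt g a b.
Proof. intros H. apply RInt_ext. intros; apply H. Qed.

Lemma RInt_le_cont (f g : R -> R) (a b : R) :
  a <= b -> (forall t, continuous f t) -> (forall t, continuous g t) ->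
  (forall t, a < t < b -> f t <= g t) -> RInt f a b <= RInt g a b.
Proof. intros Hab Hf Hg H. apply RInt_le; auto using ex_RInt_cont. Qed.

Lemma RInt_plus_cont (f g : R -> R) (a b : R) :
  (forall t, continuous f t) -> (forall t, continuous g t) ->
  RInt (fun t => f t + g t) a b = RInt f a b + RInt g a b.
Proof. intros Hf Hg. apply (RInt_plus f g a b); auto using ex_RInt_cont. Qed.

Lemma RInt_minus_cont (f g : R -> R) (a b : R) :
  (forall t, continuous f t) -> (forall t, continuous g t) ->
  RInt (fun t => f t - g t) a b = RInt f a b - RInt g a b.
Proof. intros Hf Hg. apply (RInt_minus f g a b); auto using ex_RInt_cont. Qed.

Lemma RInt_scal_cont (k : R) (f : R -> R) (a b : R) :
  (forall t, continuous f t) -> RInt (fun t => k * f t) a b = k * RInt f a b.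
Proof. intros Hf. apply (RInt_scal f a b k); auto using ex_RInt_cont. Qed.

Lemma RInt_const_R (k a b : R) : RInt (fun _ => k) a b = k * (b - a).
Proof. rewrite RInt_const. unfold scal; simpl; unfold mult; simpl. ring. Qed.

Lemma eq_of_zero_derive (f : R -> R) (a b : R) :
  a <= b -> (forall x, a <= x <= b -> continuous f x) ->
  (forall x, a < x < b -> is_derive f x 0) -> f b = f a.
Proof.
  intros Hab Hc Hd.
  destruct (MVT_gen f a b (fun _ => 0)) as [c [_ H]].
  - rewrite Rmin_left, Rmax_right by lra. exact Hd.
  - rewrite Rmin_left, Rmax_right by lra. intros x Hx.
    apply continuity_pt_filterlim. now apply Hc.
  - lra.
Qed.

(** The derivative is required only inside the interval: polar harmonic functions are differentiable
    in [r] for [0 < r < 1] and merely continuous at [r = 0] and [r = 1]. *)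
Lemma RInt_derive_open (f df : R -> R) (a b : R) :
  a <= b -> (forall x, continuous f x) -> (forall x, continuous df x) ->
  (forall x, a < x < b -> is_derive f x (df x)) -> RInt df a b = f b - f a.
Proof.
  intros Hab Hf Hdf Hd.
  assert (H : f b - RInt df a b = f a - RInt df a a).
  { apply (eq_of_zero_derive (fun x => f x - RInt df a x)); auto.
    - intros x _. apply (continuous_minus f (RInt df a)); auto.
      eapply continuous_is_derive. now apply is_derive_upper.
    - intros x Hx. replace 0 with (df x - df x) by ring.
      apply (is_derive_minus f (RInt df a)); auto. now apply is_derive_upper. }
  rewrite RInt_point in H. unfold zero in H; simpl in H. lra.
Qed.

Lemma is_derive_RInt_param_strip (f df : R -> R -> R) (lo hi a b x : R) :
  lo < x < hi ->
  (forall y t, lo < y < hi -> is_derive (fun z => f z t) y (df y t)) ->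
  (forall y t, lo < y < hi -> continuity_2d_pt df y t) ->
  (forall y t, lo < y < hi -> continuous (f y) t) ->
  is_derive (fun y => RInt (f y) a b) x (RInt (df x) a b).
Proof.
  intros Hx Hd Hdf Hf.
  assert (Hnear : forall Q : R -> Prop, (forall y, lo < y < hi -> Q y) -> locally x Q).
  { intros Q HQ. apply (filter_imp (fun y => lo < y /\ y < hi)); [intros y; apply HQ|].
    apply filter_and; [apply open_gt | apply open_lt]; lra. }
  replace (RInt (df x) a b) with (RInt (fun t => Derive (fun u => f u t) x) a b).
  - apply (is_derive_RInt_param f a b x).
    + apply Hnear. intros y Hy t _. exists (df y t). now apply Hd.
    + intros t _. apply continuity_2d_pt_ext_loc with (f := df); [|now apply Hdf].
      assert (Hd0 : 0 < Rmin (x - lo) (hi - x)) by (apply Rmin_pos; lra).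
      exists (mkposreal _ Hd0). simpl. intros u v Hu _.
      symmetry. apply is_derive_unique, Hd.
      apply Rabs_lt_between in Hu.
      generalize (Rmin_l (x - lo) (hi - x)) (Rmin_r (x - lo) (hi - x)). lra.
    + apply Hnear. intros y Hy. apply ex_RInt_cont. intros t. now apply Hf.
  - apply RInt_cont_ext. intros t. now apply is_derive_unique, Hd.
Qed.

Lemma continuous_RInt_param (f : R -> R -> R) (lo hi a b x : R) :
  lo < x < hi -> a <= b ->
  (forall y t, lo < y < hi -> continuity_2d_pt f y t) ->
  continuous (fun y => RInt (f y) a b) x.
Proof.
  intros Hx Hab Hf. apply continuity_pt_filterlim.
  intros eps Heps.
  assert (He : 0 < eps / (b - a + 1)) by (apply Rdiv_lt_0_compat; lra).
  destruct (uniform_continuity_2d_1d' f a b x (fun t _ => Hf x t Hx) (mkposreal _ He))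
    as [d Hd]. simpl in Hd.
  assert (Hm : 0 < Rmin d (Rmin (x - lo) (hi - x))).
  { repeat apply Rmin_pos; try lra. apply cond_pos. }
  exists (Rmin d (Rmin (x - lo) (hi - x))). split; [exact Hm|].
  intros y [_ Hy]. unfold dist in *; simpl in *. unfold R_dist in *.
  assert (Hyd : Rabs (y - x) < d) by (eapply Rlt_le_trans; [exact Hy|apply Rmin_l]).
  assert (Hyl : lo < y < hi).
  { assert (Rabs (y - x) < Rmin (x - lo) (hi - x)) as H
      by (eapply Rlt_le_trans; [exact Hy|apply Rmin_r]).
    apply Rabs_lt_between in H.
    generalize (Rmin_l (x - lo) (hi - x)) (Rmin_r (x - lo) (hi - x)). lra. }
  assert (Hc : forall z, lo < z < hi -> forall t, continuous (f z) t)
    by (intros; apply continuous_slice_r; auto).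
  rewrite <- RInt_minus_cont by auto.
  apply Rle_lt_trans with (RInt (fun _ => eps / (b - a + 1)) a b).
  - apply Rle_trans with (RInt (fun t => Rabs (f y t - f x t)) a b).
    + apply abs_RInt_le; auto. apply ex_RInt_cont. intros t.
      apply (continuous_minus (f y) (f x)); auto.
    + apply RInt_le_cont; auto.
      * intros t. apply (continuous_comp (fun t => f y t - f x t) Rabs).
        apply (continuous_minus (f y) (f x)); auto. apply continuous_Rabs.
      * intros t. apply continuous_const.
      * intros t Ht. apply Rlt_le. apply Hd; try lra.
        -- generalize (cond_pos d); lra.
        -- apply Rabs_lt_between in Hyd. lra.
        -- rewrite Rminus_diag, Rabs_R0. apply cond_pos.
  - rewrite RInt_const_R. apply Rmult_lt_reg_r with (b - a + 1); [lra|].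
    replace (eps / (b - a + 1) * (b - a) * (b - a + 1)) with (eps * (b - a)) by (field; lra).
    nra.
Qed.

(** Fubini by differentiation in the upper limit [b]: both iterated integrals have the derivative
    [RInt (fun y => f b y) c d] and vanish at [b = a]. *)
Lemma RInt_swap (f : R -> R -> R) (a b c d : R) :
  a <= b -> c <= d -> (forall x y, continuity_2d_pt f x y) ->
  RInt (fun x => RInt (fun y => f x y) c d) a b =
  RInt (fun y => RInt (fun x => f x y) a b) c d.
Proof.
  intros Hab Hcd Hf.
  assert (Hf' : forall x y, continuity_2d_pt (fun y x => f x y) y x).
  { intros x y eps. destruct (Hf x y eps) as [e He]. exists e. auto. }
  assert (Hin : forall x, continuous (fun x => RInt (fun y => f x y) c d) x).
  { intros x. apply (continuous_RInt_param f (x - 1) (x + 1)); auto; lra. }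
  set (L := fun b => RInt (fun x => RInt (fun y => f x y) c d) a b).
  set (M := fun b => RInt (fun y => RInt (fun x => f x y) a b) c d).
  assert (HL : forall x, is_derive L x (RInt (fun y => f x y) c d)).
  { intros x. apply (is_derive_upper (fun x => RInt (fun y => f x y) c d)); auto. }
  assert (HM : forall x, is_derive M x (RInt (fun y => f x y) c d)).
  { intros x.
    apply (is_derive_RInt_param_strip (fun b y => RInt (fun x => f x y) a b) f (x - 1) (x + 1));
      auto; try lra.
    - intros y t _. apply (is_derive_upper (fun x => f x t)).
      intros z. now apply continuous_slice_l.
    - intros y t Hy. destruct (Rle_lt_dec a y).
      + apply (continuous_RInt_param (fun t x => f x t) (t - 1) (t + 1)); auto; lra.
      + apply continuous_ext with (fun t => - RInt (fun x => f x t) y a).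
        { intros z. apply (opp_RInt_swap (V := R_CompleteNormedModule) (fun x => f x z)).
          apply ex_RInt_cont. intros w. now apply continuous_slice_l. }
        apply (continuous_opp (fun t => RInt (fun x => f x t) y a)).
        apply (continuous_RInt_param (fun t x => f x t) (t - 1) (t + 1)); auto; lra. }
  assert (H : L b - M b = L a - M a).
  { apply (eq_of_zero_derive (fun x => L x - M x)); auto.
    - intros x _. apply (continuous_minus L M); eapply continuous_is_derive; eauto.
    - intros x _. replace 0 with (RInt (fun y => f x y) c d - RInt (fun y => f x y) c d) by ring.
      apply (is_derive_minus L M); auto. }
  assert (L a = 0) by (unfold L; now rewrite RInt_point).
  assert (M a = 0).
  { unfold M. erewrite RInt_cont_ext; [|intros t; now rewrite RInt_point].
    unfold zero; simpl. rewrite RInt_const_R. ring. }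
  unfold L, M in *. lra.
Qed.

Lemma RInt_shift (g : R -> R) (a b h : R) :
  (forall t, continuous g t) -> RInt (fun t => g (t + h)) a b = RInt g (a + h) (b + h).
Proof.
  intros Hg. generalize (RInt_comp_lin g 1 h a b). rewrite !Rmult_1_l.
  intros H. rewrite <- H by now apply ex_RInt_cont.
  apply RInt_cont_ext. intros t. unfold scal; simpl; unfold mult; simpl. now rewrite !Rmult_1_l.
Qed.

Lemma RInt_period (g : R -> R) (a b : R) :
  (forall t, continuous g t) -> (forall t, g (t + 2 * PI) = g t) ->
  RInt g a (a + 2 * PI) = RInt g b (b + 2 * PI).
Proof.
  intros Hg Hp.
  rewrite <- (RInt_Chasles g a b (a + 2 * PI)) by now apply ex_RInt_cont.
  rewrite <- (RInt_Chasles g b (a + 2 * PI) (b + 2 * PI)) by now apply ex_RInt_cont.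
  rewrite <- (RInt_shift g a b (2 * PI)) by auto.
  rewrite (RInt_cont_ext _ g a b Hp).
  unfold plus; simpl. ring.
Qed.

Lemma RInt_period_shift (g : R -> R) (a b h : R) :
  (forall t, continuous g t) -> (forall t, g (t + 2 * PI) = g t) ->
  RInt (fun t => g (t + h)) a (a + 2 * PI) = RInt g b (b + 2 * PI).
Proof.
  intros Hg Hp. rewrite RInt_shift by auto.
  replace (a + 2 * PI + h) with (a + h + 2 * PI) by ring. now apply RInt_period.
Qed.

(** The primitive from [a] increases from zero to a value that is at most zero, so it vanishes
    identically, and [g] is its derivative. *)
Lemma RInt_zero_nonneg (g : R -> R) (a b : R) :
  a < b -> (forall t, continuous g t) -> (forall t, a < t < b -> 0 <= g t) ->
  RInt g a b <= 0 -> forall t, a < t < b -> g t = 0.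
Proof.
  intros Hab Hc Hp H0 t Ht.
  assert (Hn : forall x y, a <= x <= y -> y <= b -> 0 <= RInt g x y).
  { intros x y Hx Hy. apply RInt_ge_0; try lra. now apply ex_RInt_cont.
    intros z Hz. apply Hp; lra. }
  assert (HG : forall x, a <= x <= b -> RInt g a x = 0).
  { intros x Hx. generalize (Hn a x) (Hn x b).
    generalize (RInt_Chasles g a x b). unfold plus; simpl. intros HC.
    rewrite <- HC in H0 by now apply ex_RInt_cont. intros. lra. }
  rewrite <- (is_derive_unique (RInt g a) t (g t)) by now apply is_derive_upper.
  apply is_derive_unique. apply is_derive_ext_loc with (fun _ => 0).
  - apply (filter_imp (fun y => a < y /\ y < b)).
    + intros y Hy. symmetry. apply HG. lra.
    + apply filter_and; [apply open_gt | apply open_lt]; lra.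
  - apply (is_derive_const 0).
Qed.

Lemma RInt_by_parts_period (f g df dg : R -> R) (a : R) :
  (forall t, is_derive f t (df t)) -> (forall t, is_derive g t (dg t)) ->
  (forall t, continuous df t) -> (forall t, continuous dg t) ->
  (forall t, f (t + 2 * PI) = f t) -> (forall t, g (t + 2 * PI) = g t) ->
  RInt (fun t => f t * dg t) a (a + 2 * PI) = - RInt (fun t => df t * g t) a (a + 2 * PI).
Proof.
  intros Hf Hg Hdf Hdg Pf Pg.
  assert (Cf : forall t, continuous f t) by (intros; eapply continuous_is_derive; eauto).
  assert (Cg : forall t, continuous g t) by (intros; eapply continuous_is_derive; eauto).
  assert (C1 : forall t, continuous (fun t => df t * g t) t)
    by (intros; apply (continuous_mult df g); auto).
  assert (C2 : forall t, continuous (fun t => f t * dg t) t)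
    by (intros; apply (continuous_mult f dg); auto).
  assert (H : RInt (fun t => df t * g t + f t * dg t) a (a + 2 * PI) = 0).
  { rewrite (RInt_derive_open (fun t => f t * g t)).
    - rewrite Pf, Pg. apply Rminus_diag.
    - generalize PI_RGT_0; lra.
    - intros; apply (continuous_mult f g); auto.
    - intros; apply (continuous_plus (fun t => df t * g t) (fun t => f t * dg t)); auto.
    - intros t _. apply (is_derive_mult f g); auto. intros; apply Rmult_comm. }
  rewrite RInt_plus_cont in H by auto. lra.
Qed.

(** * Harmonic functions in polar coordinates *)

Lemma continuous_R_plus (f g : R -> R) (x : R) :
  continuous f x -> continuous g x -> continuous (fun x => f x + g x) x.
Proof. exact (continuous_plus f g x). Qed.

Lemma continuous_R_minus (f g : R -> R) (x : R) :
  continuous f x -> continuous g x -> continuous (fun x => f x - g x) x.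
Proof. exact (continuous_minus f g x). Qed.

Lemma continuous_R_opp (f : R -> R) (x : R) :
  continuous f x -> continuous (fun x => - f x) x.
Proof. exact (continuous_opp f x). Qed.

Lemma continuous_R_mult (f g : R -> R) (x : R) :
  continuous f x -> continuous g x -> continuous (fun x => f x * g x) x.
Proof. exact (continuous_mult f g x). Qed.

Lemma continuous_R_comp (f g : R -> R) (x : R) :
  continuous g x -> continuous f (g x) -> continuous (fun x => f (g x)) x.
Proof. exact (continuous_comp g f x). Qed.

Lemma continuous_R_inv (f : R -> R) (x : R) :
  continuous f x -> f x <> 0 -> continuous (fun x => / f x) x.
Proof. intros; apply (continuous_comp f Rinv); auto. now apply continuous_Rinv. Qed.

Lemma continuity_2d_pt_div (f g : R -> R -> R) (x y : R) :
  continuity_2d_pt f x y -> continuity_2d_pt g x y -> g x y <> 0 ->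
  continuity_2d_pt (fun x y => f x y / g x y) x y.
Proof.
  intros. apply continuity_2d_pt_mult; auto. now apply continuity_2d_pt_inv.
Qed.

Lemma continuity_2d_pt_comp_1d (f : R -> R) (g : R -> R -> R) (x y : R) :
  continuous f (g x y) -> continuity_2d_pt g x y ->
  continuity_2d_pt (fun x y => f (g x y)) x y.
Proof. intros Hf. apply continuity_1d_2d_pt_comp. now apply continuity_pt_filterlim. Qed.

Lemma is_derive_eq (f : R -> R) (x l l' : R) : is_derive f x l -> l = l' -> is_derive f x l'.
Proof. now intros H <-. Qed.

Lemma is_derive_R_mult (f g : R -> R) (x df dg : R) :
  is_derive f x df -> is_derive g x dg -> is_derive (fun x => f x * g x) x (df * g x + f x * dg).
Proof. intros. apply (is_derive_mult f g); auto. intros; apply Rmult_comm. Qed.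

Lemma is_derive_R_plus (f g : R -> R) (x df dg : R) :
  is_derive f x df -> is_derive g x dg -> is_derive (fun x => f x + g x) x (df + dg).
Proof. exact (is_derive_plus f g x df dg). Qed.

Lemma is_derive_R_minus (f g : R -> R) (x df dg : R) :
  is_derive f x df -> is_derive g x dg -> is_derive (fun x => f x - g x) x (df - dg).
Proof. exact (is_derive_minus f g x df dg). Qed.

Lemma is_derive_R_scal (f : R -> R) (k x df : R) :
  is_derive f x df -> is_derive (fun x => k * f x) x (k * df).
Proof. exact (is_derive_scal f x k df). Qed.

Lemma is_derive_R_comp (f g : R -> R) (x df dg : R) :
  is_derive g x dg -> is_derive f (g x) df -> is_derive (fun x => f (g x)) x (dg * df).
Proof. intros Hg Hf. exact (is_derive_comp f g x df dg Hf Hg). Qed.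

Lemma continuous_R_cos x : continuous cos x. Proof. apply continuous_cos. Qed.
Lemma continuous_R_sin x : continuous sin x. Proof. apply continuous_sin. Qed.

Lemma continuous_R_sqr (x : R) : continuous (fun y => y ^ 2) x.
Proof. apply (ex_derive_continuous (fun y : R => y ^ 2)). auto_derive. exact I. Qed.

(* Coquelicot leaves some equalities at the sort of a structure on [R], where [ring] fails. *)
Ltac rring := match goal with |- @eq _ ?a ?b => change (@eq R a b) end; ring.

Lemma continuous_R_div (f g : R -> R) (x : R) :
  continuous f x -> continuous g x -> g x <> 0 -> continuous (fun x => f x / g x) x.
Proof. intros. apply continuous_R_mult; auto. now apply continuous_R_inv. Qed.

Ltac cont1 := cbv beta; try assumption; lazymatch goal with
  | |- continuous (fun _ => ?c) _ => apply continuous_const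
  | |- continuous (fun x => x) _ => apply continuous_id
  | |- continuous (fun t => @?f t + @?g t) ?x => apply (continuous_R_plus f g x); cont1
  | |- continuous (fun t => @?f t - @?g t) ?x => apply (continuous_R_minus f g x); cont1
  | |- continuous (fun t => @?f t * @?g t) ?x => apply (continuous_R_mult f g x); cont1
  | |- continuous (fun t => @?f t / @?g t) ?x => apply (continuous_R_div f g x); cont1
  | |- continuous (fun t => - @?f t) ?x => apply (continuous_R_opp f x); cont1
  | |- continuous (fun t => @?f t ^ 2) ?x =>
      apply (continuous_R_comp (fun y => y ^ 2) f x); [cont1 | apply continuous_R_sqr]
  | |- continuous (fun t => cos (@?f t)) ?x =>
      apply (continuous_R_comp cos f x); [cont1 | apply continuous_R_cos]
  | |- continuous (fun t => sin (@?f t)) ?x =>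
      apply (continuous_R_comp sin f x); [cont1 | apply continuous_R_sin]
  | |- continuous (fun t => Rabs (@?f t)) ?x =>
      apply (continuous_R_comp Rabs f x); [cont1 | apply continuous_Rabs]
  | |- continuous cos _ => apply continuous_R_cos
  | |- continuous sin _ => apply continuous_R_sin
  | |- _ => idtac
  end.

Ltac cont2 := cbv beta; try assumption; lazymatch goal with
  | |- continuity_2d_pt (fun _ _ => ?c) _ _ => apply continuity_2d_pt_const
  | |- continuity_2d_pt (fun x _ => x) _ _ => apply continuity_2d_pt_id1
  | |- continuity_2d_pt (fun _ y => y) _ _ => apply continuity_2d_pt_id2
  | |- continuity_2d_pt (fun x y => @?f x y + @?g x y) ?a ?b =>
      apply (continuity_2d_pt_plus f g a b); cont2
  | |- continuity_2d_pt (fun x y => @?f x y - @?g x y) ?a ?b =>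
      apply (continuity_2d_pt_minus f g a b); cont2
  | |- continuity_2d_pt (fun x y => @?f x y * @?g x y) ?a ?b =>
      apply (continuity_2d_pt_mult f g a b); cont2
  | |- continuity_2d_pt (fun x y => @?f x y / @?g x y) ?a ?b =>
      apply (continuity_2d_pt_div f g a b); cont2
  | |- continuity_2d_pt (fun x y => - @?f x y) ?a ?b =>
      apply (continuity_2d_pt_opp f a b); cont2
  | |- continuity_2d_pt (fun x y => @?f x y ^ 2) ?a ?b =>
      apply (continuity_2d_pt_comp_1d (fun z => z ^ 2) f a b); [apply continuous_R_sqr | cont2]
  | |- continuity_2d_pt (fun x y => cos (@?f x y)) ?a ?b =>
      apply (continuity_2d_pt_comp_1d cos f a b); [apply continuous_R_cos | cont2]
  | |- continuity_2d_pt (fun x y => sin (@?f x y)) ?a ?b =>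
      apply (continuity_2d_pt_comp_1d sin f a b); [apply continuous_R_sin | cont2]
  | |- continuity_2d_pt (fun x y => Rabs (@?f x y)) ?a ?b =>
      apply (continuity_2d_pt_comp_1d Rabs f a b); [apply continuous_Rabs | cont2]
  | |- _ => idtac
  end.

(* [U], [Ur], [Ut] are a function of polar coordinates and its partial derivatives in the unit disk,
   extended continuously to all of [R * R]; only the values for [0 <= r <= 1] carry information.
   The last field is the polar Laplace equation [r (r U_r)_r = - U_tt]. *)
Record polar_harmonic (U Ur Ut : R -> R -> R) : Prop := {
  ph_cont : forall r t, continuity_2d_pt U r t;
  ph_cont_r : forall r t, continuity_2d_pt Ur r t;
  ph_cont_t : forall r t, continuity_2d_pt Ut r t;
  ph_per : forall r t, U r (t + 2 * PI) = U r t;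
  ph_per_r : forall r t, Ur r (t + 2 * PI) = Ur r t;
  ph_per_t : forall r t, Ut r (t + 2 * PI) = Ut r t;
  ph_derive_r : forall r t, 0 < r < 1 -> is_derive (fun r => U r t) r (Ur r t);
  ph_derive_t : forall r t, 0 < r < 1 -> is_derive (U r) t (Ut r t);
  ph_laplace : exists W : R -> R -> R, forall r t, 0 < r < 1 ->
    is_derive (fun r => r * Ur r t) r (W r t) /\
    is_derive (Ut r) t (- (r * W r t)) /\ continuity_2d_pt W r t }.

Lemma polar_harmonic_const (k : R) :
  polar_harmonic (fun _ _ => k) (fun _ _ => 0) (fun _ _ => 0).
Proof.
  split; intros; cont2; auto; try apply (is_derive_const k).
  exists (fun _ _ => 0). intros r t _. split; [|split; [|now cont2]].
  - apply is_derive_ext with (fun _ => 0); [intros; rring|apply (is_derive_const 0)].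
  - eapply is_derive_eq; [apply (is_derive_const 0)|unfold zero; simpl; ring].
Qed.

Lemma is_derive_R_opp (f : R -> R) (x df : R) :
  is_derive f x df -> is_derive (fun x => - f x) x (- df).
Proof. exact (is_derive_opp f x df). Qed.

Lemma is_derive_shift (f : R -> R) (h x l : R) :
  is_derive f (x + h) l -> is_derive (fun t => f (t + h)) x l.
Proof.
  intros H. eapply is_derive_eq.
  - apply (is_derive_R_comp f (fun t => t + h)); eauto.
    apply (is_derive_R_plus (fun t => t) (fun _ => h)); [apply (is_derive_id x)|apply (is_derive_const h)].
  - unfold one, zero; simpl. ring.
Qed.

Lemma polar_harmonic_rotate (h : R) (U Ur Ut : R -> R -> R) :
  polar_harmonic U Ur Ut ->
  polar_harmonic (fun r t => U r (t + h)) (fun r t => Ur r (t + h)) (fun r t => Ut r (t + h)).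
Proof.
  intros [C Cr Ct Pe Per Pet Dr Dt [W HW]].
  assert (Hs : forall (F : R -> R -> R) r t, continuity_2d_pt F r (t + h) ->
             continuity_2d_pt (fun r t => F r (t + h)) r t).
  { intros F r t HF. apply (continuity_2d_pt_comp F (fun r _ => r) (fun _ t => t + h)); cont2. }
  split; intros; auto;
    try (replace (t + 2 * PI + h) with (t + h + 2 * PI) by ring; auto).
  - now apply (is_derive_shift (U r)), Dt.
  - exists (fun r t => W r (t + h)). intros r t Hr. destruct (HW r (t + h) Hr) as (H1 & H2 & H3).
    split; [exact H1|split; [now apply (is_derive_shift (Ut r))|auto]].
Qed.

Lemma polar_harmonic_dilate (b : R) (U Ur Ut : R -> R -> R) :
  0 < b <= 1 -> polar_harmonic U Ur Ut ->
  polar_harmonic (fun r t => U (b * r) t) (fun r t => b * Ur (b * r) t) (fun r t => Ut (b * r) t).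
Proof.
  intros Hb [C Cr Ct Pe Per Pet Dr Dt [W HW]].
  assert (Hs : forall (F : R -> R -> R) r t, continuity_2d_pt F (b * r) t ->
             continuity_2d_pt (fun r t => F (b * r) t) r t).
  { intros F r t HF. apply (continuity_2d_pt_comp F (fun r _ => b * r) (fun _ t => t)); cont2. }
  assert (Hbr : forall r, 0 < r < 1 -> 0 < b * r < 1) by (intros; nra).
  assert (Hd : forall r, is_derive (fun r => b * r) r b).
  { intros r. eapply is_derive_eq; [apply is_derive_R_scal, (is_derive_id r)|].
    unfold one; simpl; ring. }
  split; intros; auto; cont2; auto.
  - now rewrite Per.
  - apply (is_derive_R_comp (fun r => U r t) (fun r => b * r)); auto.
  - exists (fun r t => b * W (b * r) t). intros r t Hr.
    destruct (HW (b * r) t (Hbr _ Hr)) as (H1 & H2 & H3).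
    split; [|split].
    + apply is_derive_ext with (fun r => b * r * Ur (b * r) t); [intros; rring|].
      apply (is_derive_R_comp (fun r => r * Ur r t) (fun r => b * r)); auto.
    + eapply is_derive_eq; eauto. ring.
    + cont2. now apply Hs.
Qed.

(** Green's first identity, differentiated in the radius: the flux of [V grad U] through the circle
    of radius [r] changes at the rate of the Dirichlet integrand on that circle. The factor [r] is
    arc length, and it makes the flux vanish at the origin. *)
Lemma green_first (U Ur Ut V Vr Vt : R -> R -> R) (a r : R) :
  polar_harmonic U Ur Ut -> polar_harmonic V Vr Vt -> 0 < r < 1 ->
  is_derive (fun r => RInt (fun t => V r t * (r * Ur r t)) a (a + 2 * PI)) r
    (RInt (fun t => r * (Vr r t * Ur r t) + Vt r t * Ut r t / r) a (a + 2 * PI)).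
Proof.
  intros [C Cr Ct Pe Per Pet Dr Dt [W HW]] [D Dr' Dt' Qe Qer Qet Er Et _] Hr.
  assert (CW : forall t, continuous (W r) t) by (intros; apply continuous_slice_r, HW, Hr).
  assert (SC : forall F : R -> R -> R, (forall r t, continuity_2d_pt F r t) ->
            forall t, continuous (F r) t) by (intros; apply continuous_slice_r; auto).
  replace (RInt (fun t => r * (Vr r t * Ur r t) + Vt r t * Ut r t / r) a (a + 2 * PI))
    with (RInt (fun t => Vr r t * (r * Ur r t) + V r t * W r t) a (a + 2 * PI)).
  - apply (is_derive_RInt_param_strip (fun r t => V r t * (r * Ur r t))
      (fun r t => Vr r t * (r * Ur r t) + V r t * W r t) 0 1); auto.
    + intros y t Hy. apply (is_derive_R_mult (fun r => V r t) (fun r => r * Ur r t)); [auto|apply (HW y t Hy)].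
    + intros y t Hy. destruct (HW y t Hy) as (_ & _ & H). cont2; auto.
    + intros y t Hy. cont1; apply continuous_slice_r; auto.
  - assert (H : RInt (fun t => V r t * (- (r * W r t))) a (a + 2 * PI) =
                - RInt (fun t => Vt r t * Ut r t) a (a + 2 * PI)).
    { apply RInt_by_parts_period; auto.
      - intros; apply HW; auto.
      - intros; cont1; auto. }
    rewrite (RInt_cont_ext _ (fun t => - r * (V r t * W r t))), RInt_scal_cont in H
      by (intros; cont1; auto; ring).
    rewrite RInt_plus_cont by (intros; cont1; auto).
    rewrite (RInt_cont_ext (fun t => r * (Vr r t * Ur r t) + Vt r t * Ut r t / r)
       (fun t => Vr r t * (r * Ur r t) + / r * (Vt r t * Ut r t))) by (intros; field; lra).
    rewrite RInt_plus_cont by (intros; cont1; auto).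
    rewrite RInt_scal_cont by (intros; cont1; auto).
    apply Rplus_eq_compat_l.
    assert (r * RInt (fun t => V r t * W r t) a (a + 2 * PI) =
       RInt (fun t => Vt r t * Ut r t) a (a + 2 * PI)) as <- by lra.
    rewrite <- Rmult_assoc, Rinv_l, Rmult_1_l; auto; lra.
Qed.

(** The derivative in [green_first] is symmetric in the two functions, so the difference of the two
    fluxes is constant in [r], and it is zero at [r = 0]. *)
Lemma green_second (U Ur Ut V Vr Vt : R -> R -> R) (a : R) :
  polar_harmonic U Ur Ut -> polar_harmonic V Vr Vt ->
  RInt (fun t => V 1 t * Ur 1 t) a (a + 2 * PI) = RInt (fun t => U 1 t * Vr 1 t) a (a + 2 * PI).
Proof.
  intros HU HV.
  set (E := fun r => RInt (fun t => V r t * (r * Ur r t)) a (a + 2 * PI)).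
  set (F := fun r => RInt (fun t => U r t * (r * Vr r t)) a (a + 2 * PI)).
  assert (Hpi := PI_RGT_0).
  assert (CE : forall r, continuous E r).
  { intros r. apply (continuous_RInt_param (fun r t => V r t * (r * Ur r t)) (r - 1) (r + 1)); try lra.
    intros y t _. cont2. apply HV. apply HU. }
  assert (CF : forall r, continuous F r).
  { intros r. apply (continuous_RInt_param (fun r t => U r t * (r * Vr r t)) (r - 1) (r + 1)); try lra.
    intros y t _. cont2. apply HU. apply HV. }
  assert (H : E 1 - F 1 = E 0 - F 0).
  { apply (eq_of_zero_derive (fun r => E r - F r)); try lra.
    - intros; apply (continuous_R_minus E F); auto.
    - intros r Hr. eapply is_derive_eq.
      + apply (is_derive_R_minus E F); [apply (green_first U Ur Ut V Vr Vt)|apply (green_first V Vr Vt U Ur Ut)];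
          auto.
      + apply Rminus_diag_eq, RInt_cont_ext. intros t. unfold Rdiv. ring. }
  unfold E, F in H.
  rewrite (RInt_cont_ext (fun t => V 0 t * (0 * Ur 0 t)) (fun _ => 0)) in H by (intros; ring).
  rewrite (RInt_cont_ext (fun t => U 0 t * (0 * Vr 0 t)) (fun _ => 0)) in H by (intros; ring).
  rewrite (RInt_cont_ext _ (fun t => V 1 t * (1 * Ur 1 t))) by (intros; ring).
  rewrite (RInt_cont_ext (fun t => U 1 t * Vr 1 t) (fun t => U 1 t * (1 * Vr 1 t)))
    by (intros; ring).
  lra.
Qed.

(** * The Poisson kernel *)

(** The squared distance from [r exp (i t)] to [1]. *)
Definition pois_den (r t : R) : R := 1 - 2 * r * cos t + r ^ 2.
Definition pois (r t : R) : R := (1 - r ^ 2) / pois_den r t.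
Definition pois_r (r t : R) : R := (2 * (1 + r ^ 2) * cos t - 4 * r) / pois_den r t ^ 2.
Definition pois_t (r t : R) : R := - ((1 - r ^ 2) * (2 * r * sin t) / pois_den r t ^ 2).
(** The radial derivative of [r * pois_r], which plays the role of [W] in [ph_laplace]. *)
Definition pois_w (r t : R) : R :=
  (1 - r ^ 2) * 2 * (cos t * pois_den r t - 4 * r * sin t ^ 2) / pois_den r t ^ 3.

Lemma cos_double_half (t : R) : cos t = 1 - 2 * sin (t / 2) ^ 2.
Proof. replace t with (2 * (t / 2)) at 1 by field. rewrite cos_2a_sin. ring. Qed.

Lemma pois_den_half (r t : R) : pois_den r t = (1 - r) ^ 2 + 4 * r * sin (t / 2) ^ 2.
Proof. unfold pois_den. rewrite (cos_double_half t). ring. Qed.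

Lemma pois_den_pos (r t : R) : -1 < r < 1 -> 0 < pois_den r t.
Proof. intros Hr. unfold pois_den. generalize (COS_bound t). intros. destruct (Rle_lt_dec 0 r); nra. Qed.

Lemma pois_pos (r t : R) : -1 < r < 1 -> 0 < pois r t.
Proof.
  intros Hr. apply Rdiv_lt_0_compat; [nra|]. now apply pois_den_pos.
Qed.

Lemma cos_per (t : R) : cos (t + 2 * PI) = cos t.
Proof. rewrite cos_plus, cos_2PI, sin_2PI. ring. Qed.

Lemma sin_per (t : R) : sin (t + 2 * PI) = sin t.
Proof. rewrite sin_plus, cos_2PI, sin_2PI. ring. Qed.

Lemma is_derive_pois_r (r t : R) : -1 < r < 1 -> is_derive (fun r => pois r t) r (pois_r r t).
Proof.
  intros Hr. assert (H := pois_den_pos r t Hr).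
  unfold pois, pois_r, pois_den in *. auto_derive; [nra|field; nra].
Qed.

Lemma is_derive_pois_t (r t : R) : -1 < r < 1 -> is_derive (pois r) t (pois_t r t).
Proof.
  intros Hr. assert (H := pois_den_pos r t Hr).
  unfold pois, pois_t, pois_den in *. auto_derive; [nra|field; nra].
Qed.

Lemma is_derive_pois_rr (r t : R) :
  -1 < r < 1 -> is_derive (fun r => r * pois_r r t) r (pois_w r t).
Proof.
  intros Hr. assert (H := pois_den_pos r t Hr).
  unfold pois_w, pois_r, pois_den in *. auto_derive; [repeat split; nra|].
  replace (sin t ^ 2) with (1 - cos t ^ 2) by (generalize (sin2_cos2 t); unfold Rsqr; lra).
  field. nra.
Qed.

Lemma is_derive_pois_tt (r t : R) :
  -1 < r < 1 -> is_derive (pois_t r) t (- (r * pois_w r t)).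
Proof.
  intros Hr. assert (H := pois_den_pos r t Hr).
  unfold pois_w, pois_t, pois_den in *. auto_derive; [repeat split; nra|]. field. nra.
Qed.

Lemma continuity_2d_pt_pow (f : R -> R -> R) (n : nat) (x y : R) :
  continuity_2d_pt f x y -> continuity_2d_pt (fun x y => f x y ^ n) x y.
Proof.
  intros Hf. induction n as [|n IH]; simpl; [apply continuity_2d_pt_const|].
  now apply (continuity_2d_pt_mult f (fun x y => f x y ^ n)).
Qed.

Lemma continuity_pois_den (r t : R) : continuity_2d_pt pois_den r t.
Proof. unfold pois_den. cont2. Qed.

Lemma continuity_pois (r t : R) : -1 < r < 1 ->
  continuity_2d_pt pois r t /\ continuity_2d_pt pois_r r t /\
  continuity_2d_pt pois_t r t /\ continuity_2d_pt pois_w r t.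
Proof.
  intros Hr. assert (H := pois_den_pos r t Hr). assert (HD := continuity_pois_den r t).
  unfold pois, pois_r, pois_t, pois_w.
  split; [|split; [|split]]; cont2; try apply continuity_2d_pt_pow; auto;
    try apply pow_nonzero; lra.
Qed.

(** Retraction of the line onto [[0, 1]]: composing the radius with it extends functions known on
    the closed disk continuously to all of [R * R], so that continuity carries no side
    conditions. *)
Definition clamp (r : R) : R := Rmax 0 (Rmin 1 r).

Lemma clamp_id (r : R) : 0 <= r <= 1 -> clamp r = r.
Proof. intros H. unfold clamp. rewrite Rmin_right, Rmax_right; lra. Qed.

Lemma clamp_bound (r : R) : 0 <= clamp r <= 1.
Proof.
  unfold clamp. split; [apply Rmax_l|]. apply Rmax_lub; [lra|apply Rmin_l].
Qed.

Lemma clamp_lipschitz (x y : R) : Rabs (clamp x - clamp y) <= Rabs (x - y).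
Proof.
  unfold clamp, Rmax, Rmin. repeat destruct Rle_dec; unfold Rabs; repeat destruct Rcase_abs; lra.
Qed.

Lemma continuous_clamp (r : R) : continuous clamp r.
Proof.
  apply continuity_pt_filterlim. intros eps Heps. exists eps. split; [exact Heps|].
  intros y [_ Hy]. simpl in *. unfold R_dist in *.
  eapply Rle_lt_trans; [apply clamp_lipschitz|exact Hy].
Qed.

Lemma clamp_near (r : R) : 0 < r < 1 -> locally r (fun x => x = clamp x).
Proof.
  intros Hr. apply (filter_imp (fun y => 0 < y /\ y < 1)).
  - intros y Hy. rewrite clamp_id; lra.
  - apply filter_and; [apply open_gt | apply open_lt]; lra.
Qed.

Lemma is_derive_clamp (f : R -> R) (r l : R) :
  0 < r < 1 -> is_derive f r l -> is_derive (fun r => f (clamp r)) r l.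
Proof.
  intros Hr. apply is_derive_ext_loc. apply (filter_imp (fun x => x = clamp x)).
  - intros x Hx. now rewrite <- Hx.
  - now apply clamp_near.
Qed.

(** The factor [a < 1] moves the singularity of the kernel outside the closed disk, so that Green's
    formula applies up to [r = 1]. *)
Lemma polar_harmonic_pois (a : R) : 0 < a < 1 ->
  polar_harmonic (fun r t => pois (a * clamp r) t) (fun r t => a * pois_r (a * clamp r) t)
    (fun r t => pois_t (a * clamp r) t).
Proof.
  intros Ha.
  assert (Hc : forall r, -1 < a * clamp r < 1) by (intros r; generalize (clamp_bound r); nra).
  assert (HF : forall (F : R -> R -> R) r t, continuity_2d_pt F (a * clamp r) t ->
            continuity_2d_pt (fun r t => F (a * clamp r) t) r t).
  { intros F r t H. apply (continuity_2d_pt_comp F (fun r _ => a * clamp r) (fun _ t => t)); cont2.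
    apply (continuity_2d_pt_fst clamp), continuous_clamp. }
  assert (Hd : forall r, is_derive (fun r => a * r) r a).
  { intros r. eapply is_derive_eq; [apply is_derive_R_scal, (is_derive_id r)|].
    unfold one; simpl; ring. }
  split; intros.
  - apply HF, continuity_pois, Hc.
  - cont2. apply HF, continuity_pois, Hc.
  - apply HF, continuity_pois, Hc.
  - unfold pois, pois_den. now rewrite cos_per.
  - unfold pois_r, pois_den. now rewrite cos_per.
  - unfold pois_t, pois_den. now rewrite cos_per, sin_per.
  - rewrite (clamp_id r) by lra. apply (is_derive_clamp (fun r => pois (a * r) t)); auto.
    apply (is_derive_R_comp (fun r => pois r t) (fun r => a * r)); auto.
    apply is_derive_pois_r. nra.
  - now apply is_derive_pois_t.
  - exists (fun r t => a * pois_w (a * clamp r) t). intros r t Hr. split; [|split].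
    + rewrite clamp_id by lra.
      apply is_derive_ext_loc with (fun r => a * r * pois_r (a * r) t).
      { apply (filter_imp (fun x => x = clamp x)); [|now apply clamp_near].
        intros x Hx. rewrite <- Hx. rring. }
      apply (is_derive_R_comp (fun r => r * pois_r r t) (fun r => a * r)); auto.
      apply is_derive_pois_rr. nra.
    + eapply is_derive_eq; [now apply is_derive_pois_tt|]. rewrite clamp_id by lra. ring.
    + cont2. apply HF, continuity_pois, Hc.
Qed.

Lemma PI_period : PI = - PI + 2 * PI.
Proof. ring. Qed.

(** The integral does not depend on [r]: its derivative is proportional to the flux of a harmonic
    function, which is zero by [green_second] against the constant [1]. At [r = 0] the kernel is
    [1]. *)
Lemma RInt_pois (r : R) : 0 <= r < 1 -> RInt (pois r) (- PI) PI = 2 * PI.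
Proof.
  intros Hr. assert (Hpi := PI_RGT_0).
  replace (2 * PI) with (RInt (pois 0) (- PI) PI).
  - apply (eq_of_zero_derive (fun r => RInt (pois r) (- PI) PI)); try lra.
    + intros x Hx. apply (continuous_RInt_param pois (-1) 1); try lra.
      intros; now apply continuity_pois.
    + intros x Hx. replace 0 with (RInt (pois_r x) (- PI) PI).
      * apply (is_derive_RInt_param_strip pois pois_r (-1) 1); try lra.
        -- intros; now apply is_derive_pois_r.
        -- intros; now apply continuity_pois.
        -- intros; apply continuous_slice_r; now apply continuity_pois.
      * assert (Hx1 : 0 < x < 1) by lra.
        generalize (green_second _ _ _ _ _ _ (- PI)
          (polar_harmonic_pois x Hx1) (polar_harmonic_const 1)).
        rewrite <- PI_period.
        rewrite (RInt_cont_ext (fun t => pois (x * clamp 1) t * 0) (fun _ => 0)) by (intros; rring).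
        rewrite clamp_id, Rmult_1_r, RInt_const_R by lra.
        rewrite (RInt_cont_ext (fun t => 1 * (x * pois_r x t)) (fun t => x * pois_r x t)) by (intros; rring).
        rewrite RInt_scal_cont by (intros; apply continuous_slice_r, continuity_pois; lra).
        intros H. rewrite Rmult_0_l in H. apply Rmult_integral in H. destruct H; lra.
  - rewrite (RInt_cont_ext _ (fun _ => 1)); [rewrite RInt_const_R; rring|].
    intros t. unfold pois, pois_den. field.
Qed.

(** This bounds the tail of the kernel: the denominator is at least [4 * r * sin (t / 2) ^ 2], so
    the weight cancels the peak and leaves a quantity of order [1 - r]. *)
Lemma pois_sin_half_le (r t : R) :
  0 < r < 1 -> pois r t * sin (t / 2) ^ 2 <= (1 - r ^ 2) / (4 * r).
Proof.
  intros Hr. assert (HD := pois_den_pos r t ltac:(lra)). unfold pois.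
  apply Rmult_le_reg_r with (4 * r * pois_den r t); [nra|].
  replace ((1 - r ^ 2) / pois_den r t * sin (t / 2) ^ 2 * (4 * r * pois_den r t))
    with ((1 - r ^ 2) * (4 * r * sin (t / 2) ^ 2)) by (field; lra).
  replace ((1 - r ^ 2) / (4 * r) * (4 * r * pois_den r t))
    with ((1 - r ^ 2) * pois_den r t) by (field; lra).
  apply Rmult_le_compat_l; [nra|]. rewrite pois_den_half. nra.
Qed.

Lemma sin_half_sqr_le (d s : R) : 0 < d <= PI -> d <= Rabs s <= PI ->
  sin (d / 2) ^ 2 <= sin (s / 2) ^ 2.
Proof.
  intros Hd Hs.
  assert (H0 : 0 < sin (d / 2)) by (apply sin_gt_0; lra).
  assert (H : sin (s / 2) ^ 2 = sin (Rabs s / 2) ^ 2).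
  { unfold Rabs. destruct (Rcase_abs s); auto.
    replace (- s / 2) with (- (s / 2)) by field. rewrite sin_neg. ring. }
  rewrite H. apply pow_incr. split; [lra|]. apply sin_incr_1; lra.
Qed.

(* The integral of [pois (r / rho)] against [U rho] does not depend on [rho] in (r, 1], by Green's
   formula, and it tends to [2 PI U r 0] as [rho] decreases to [r]. *)
Lemma poisson_formula_0 (U Ur Ut : R -> R -> R) (m r : R) :
  polar_harmonic U Ur Ut -> (forall r t, Rabs (U r t) <= m) -> 0 < r < 1 ->
  RInt (fun s => pois r s * U 1 s) (- PI) PI = 2 * PI * U r 0.
Proof.
  intros HU Hm Hr. assert (Hpi := PI_RGT_0).
  assert (Hq : forall p, r < p -> -1 < r / p < 1).
  { intros p Hp. split.
    - apply Rlt_trans with 0; [lra|]. apply Rdiv_lt_0_compat; lra.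
    - apply Rlt_div_l; lra. }
  set (Psi := fun p => RInt (fun s => pois (r / p) s * U p s) (- PI) PI).
  assert (HC : forall F : R -> R -> R, (forall x t, -1 < x < 1 -> continuity_2d_pt F x t) ->
     forall y t, r < y -> continuity_2d_pt (fun p s => F (r / p) s) y t).
  { intros F HF y t Hy. apply (continuity_2d_pt_comp F (fun p _ => r / p) (fun _ t => t)); cont2.
    apply HF, Hq, Hy. lra. }
  assert (HPsi : forall p, r < p < 1 -> Psi 1 = Psi p).
  { intros p Hp. apply eq_of_zero_derive; try lra.
    - intros x Hx. apply (continuous_RInt_param (fun p s => pois (r / p) s * U p s) r 2); try lra.
      intros y t Hy. cont2; [|apply HU]. apply (HC pois); [|lra]. intros; now apply continuity_pois.
    - intros x Hx.
      replace 0 with (RInt (fun s => - (r / x ^ 2) * pois_r (r / x) s * U x s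
                                     + pois (r / x) s * Ur x s) (- PI) PI).
      + apply (is_derive_RInt_param_strip (fun p s => pois (r / p) s * U p s)
         (fun x s => - (r / x ^ 2) * pois_r (r / x) s * U x s + pois (r / x) s * Ur x s) p 1); try lra.
        * intros y t Hy. apply (is_derive_R_mult (fun y => pois (r / y) t) (fun y => U y t)).
          -- apply (is_derive_R_comp (fun y => pois y t) (fun y => r / y)).
             ++ auto_derive; [lra|field; lra].
             ++ apply is_derive_pois_r, Hq. lra.
          -- apply HU. lra.
        * intros y t Hy. cont2; try apply HU.
          -- nra.
          -- apply (HC pois_r); [|lra]. intros; now apply continuity_pois.
          -- apply (HC pois); [|lra]. intros; now apply continuity_pois.
        * intros y t Hy. cont1; apply continuous_slice_r; [|apply HU].
          apply continuity_pois, Hq. lra.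
      + assert (Ha : 0 < r / x < 1) by (split; [apply Rdiv_lt_0_compat; lra|apply Hq; lra]).
        (* On the circle of radius [x], rescaled to radius one, the kernel has parameter
           [r / x < 1]; up to the factor [/ x], the two terms of the derivative are the two sides of
           Green's formula. *)
        generalize (green_second _ _ _ _ _ _ (- PI)
          (polar_harmonic_pois (r / x) Ha) (polar_harmonic_dilate x U Ur Ut ltac:(lra) HU)).
        rewrite <- PI_period, clamp_id, !Rmult_1_r by lra. intros H.
        assert (C1 : forall t, continuous (pois_r (r / x)) t)
          by (intros; apply continuous_slice_r, continuity_pois; lra).
        assert (C2 : forall t, continuous (pois (r / x)) t)
          by (intros; apply continuous_slice_r, continuity_pois; lra).
        assert (C3 : forall t, continuous (U x) t) by (intros; apply continuous_slice_r, HU).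
        assert (C4 : forall t, continuous (Ur x) t) by (intros; apply continuous_slice_r, HU).
        rewrite (RInt_cont_ext _ (fun s => / x * (pois (r / x) s * (x * Ur x s))
           - / x * (U x s * (r / x * pois_r (r / x) s)))) by (intros; field; lra).
        rewrite RInt_minus_cont by (intros; cont1; auto).
        rewrite !RInt_scal_cont by (intros; cont1; auto).
        rewrite H. apply Rminus_diag. }
  replace (RInt (fun s => pois r s * U 1 s) (- PI) PI) with (Psi 1)
    by (unfold Psi; now rewrite Rdiv_1_r).
  assert (Hm0 : 0 <= m) by (eapply Rle_trans; [apply Rabs_pos|apply (Hm 0 0)]).
  apply cond_eq. intros e0 He0.
  (* The part near [0] and the tail will each cost at most [2 * PI * e]. *)
  set (e := e0 / (4 * PI + 1)).
  assert (He : 0 < e) by (apply Rdiv_lt_0_compat; lra).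
  destruct (ph_cont _ _ _ HU r 0 (mkposreal _ He)) as [d Hd]. simpl in Hd.
  set (d' := Rmin d PI).
  assert (Hd' : 0 < d' <= PI) by (split; [apply Rmin_pos; [apply cond_pos|lra]|apply Rmin_r]).
  set (S := sin (d' / 2) ^ 2).
  assert (HS : 0 < S) by (apply pow_lt, sin_gt_0; lra).
  (* [k * sin (s / 2) ^ 2] dominates the oscillation [2 * m] of [U] once [d' <= Rabs s], so
     [e + k * sin (s / 2) ^ 2] bounds the difference everywhere. *)
  set (k := 2 * m / S).
  assert (Hk : 0 <= k) by (apply Rdiv_le_0_compat; lra).
  (* With [q = r / (r + h)] the tail is [h * k * (2 * r + h) / (4 * r * (r + h))], at most
     [h * k / r ^ 2]; this fixes the last bound on [h]. *)
  set (h := Rmin (Rmin d (1 - r)) (e * r ^ 2 / (k + 1)) / 2).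
  assert (Hh : 0 < h /\ h < d /\ h < 1 - r /\ h * k <= e * r ^ 2).
  { assert (H1 : 0 < e * r ^ 2 / (k + 1)) by (apply Rdiv_lt_0_compat; [apply Rmult_lt_0_compat; [auto|apply pow_lt; lra]|lra]).
    assert (H2 := cond_pos d).
    assert (H3 : 0 < Rmin (Rmin d (1 - r)) (e * r ^ 2 / (k + 1))) by (repeat apply Rmin_pos; lra).
    assert (H4 : 2 * h <= e * r ^ 2 / (k + 1))
      by (unfold h; generalize (Rmin_r (Rmin d (1 - r)) (e * r ^ 2 / (k + 1))); lra).
    assert (H5 : 2 * h <= Rmin d (1 - r))
      by (unfold h; generalize (Rmin_l (Rmin d (1 - r)) (e * r ^ 2 / (k + 1))); lra).
    assert (H6 : 0 < h) by (unfold h; lra).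
    generalize (Rmin_l d (1 - r)) (Rmin_r d (1 - r)). intros.
    assert (H7 : 2 * h * (k + 1) <= e * r ^ 2)
      by (apply Rle_div_r in H4; lra).
    assert (H8 : 0 <= h * k) by (apply Rmult_le_pos; lra).
    repeat split; lra. }
  destruct Hh as (Hh0 & Hhd & Hhr & Hhk).
  rewrite (HPsi (r + h)) by lra.
  set (q := r / (r + h)).
  assert (Hq1 : 0 < q < 1) by (split; [apply Rdiv_lt_0_compat; lra|apply Hq; lra]).
  assert (C2 : forall t, continuous (pois q) t)
    by (intros; apply continuous_slice_r, continuity_pois; lra).
  assert (C3 : forall t, continuous (U (r + h)) t) by (intros; apply continuous_slice_r, HU).
  assert (E : Psi (r + h) - 2 * PI * U r 0 =
    RInt (fun s => pois q s * (U (r + h) s - U r 0)) (- PI) PI).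
  { rewrite <- (RInt_pois q) by lra. unfold Psi. fold q.
    rewrite (RInt_cont_ext (fun s => pois q s * (U (r + h) s - U r 0))
      (fun s => pois q s * U (r + h) s - U r 0 * pois q s)) by (intros; rring).
    rewrite RInt_minus_cont, RInt_scal_cont by (intros; cont1; auto).
    rewrite (Rmult_comm (U r 0)). reflexivity. }
  rewrite E.
  apply Rle_lt_trans with (RInt (fun s => e * pois q s + k * ((1 - q ^ 2) / (4 * q))) (- PI) PI).
  - eapply Rle_trans.
    + apply abs_RInt_le; [lra|]. apply ex_RInt_cont. intros t; cont1; auto.
    + apply RInt_le_cont; [lra|intros s; cont1; auto|intros s; cont1; auto|].
      intros s Hs. rewrite Rabs_mult, (Rabs_pos_eq (pois q s))
        by (apply Rlt_le, pois_pos; lra).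
      assert (Hp := pois_pos q s ltac:(lra)).
      apply Rle_trans with (pois q s * (e + k * sin (s / 2) ^ 2)).
      * apply Rmult_le_compat_l; [lra|].
        destruct (Rlt_le_dec (Rabs s) d') as [Hsd|Hsd].
        -- apply Rle_trans with e.
           ++ apply Rlt_le, Hd.
              ** rewrite Rabs_pos_eq; lra.
              ** rewrite Rminus_0_r. eapply Rlt_le_trans; [exact Hsd|apply Rmin_l].
           ++ assert (0 <= k * sin (s / 2) ^ 2) by (apply Rmult_le_pos; [lra|apply pow2_ge_0]). lra.
        -- apply Rle_trans with (2 * m).
           ++ eapply Rle_trans; [apply Rabs_triang|]. rewrite Rabs_Ropp.
              generalize (Hm (r + h) s) (Hm r 0). lra.
           ++ assert (HSs : S <= sin (s / 2) ^ 2).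
              { apply sin_half_sqr_le; auto. split; auto. apply Rabs_le; lra. }
              replace (2 * m) with (k * S) by (unfold k; field; lra). nra.
      * replace (pois q s * (e + k * sin (s / 2) ^ 2))
          with (e * pois q s + k * (pois q s * sin (s / 2) ^ 2)) by ring.
        apply Rplus_le_compat_l, Rmult_le_compat_l; auto. now apply pois_sin_half_le.
  - rewrite RInt_plus_cont, RInt_scal_cont, RInt_pois, RInt_const_R by (intros; cont1; auto; lra).
    assert (Hkq : k * ((1 - q ^ 2) / (4 * q)) <= e).
    { replace (k * ((1 - q ^ 2) / (4 * q))) with (h * k * ((2 * r + h) / (4 * r * (r + h))))
        by (unfold q; field; lra).
      assert ((2 * r + h) / (4 * r * (r + h)) <= / r ^ 2).
      { apply Rle_div_l; [nra|]. replace (/ r ^ 2 * (4 * r * (r + h))) with (4 + 4 * h / r) by (field; lra).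
        assert (0 < h / r) by (apply Rdiv_lt_0_compat; lra).
        unfold Rdiv in *. nra. }
      apply Rle_trans with (h * k * / r ^ 2).
      - apply Rmult_le_compat_l; [nra|auto].
      - apply (Rle_div_l (h * k) e (r ^ 2)); [nra|lra]. }
    replace e0 with (e * (4 * PI + 1)) by (unfold e; field; lra).
    nra.
Qed.

Lemma poisson_formula_punctured (U Ur Ut : R -> R -> R) (m r t : R) :
  polar_harmonic U Ur Ut -> (forall r t, Rabs (U r t) <= m) -> 0 < r < 1 ->
  RInt (fun s => pois r s * U 1 (s + t)) (- PI) PI = 2 * PI * U r t.
Proof.
  intros HU Hm Hr.
  rewrite (poisson_formula_0 _ _ _ m r (polar_harmonic_rotate t _ _ _ HU)); auto.
  now rewrite Rplus_0_l.
Qed.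

Lemma continuous_left_ge (g : R -> R) (k : R) :
  continuous g 1 -> (forall r, 0 < r < 1 -> k <= g r) -> k <= g 1.
Proof.
  intros Hc Hg. apply Rnot_lt_le. intros Hneg.
  apply continuity_pt_filterlim in Hc.
  destruct (Hc (k - g 1) ltac:(lra)) as [d [Hd H]]. simpl in H. unfold R_dist in H.
  set (e := Rmin d 1 / 2).
  assert (He : 0 < e < 1 /\ e < d).
  { unfold e. generalize (Rmin_l d 1) (Rmin_r d 1) (Rmin_pos d 1 ltac:(lra) ltac:(lra)). lra. }
  assert (H1 : Rabs (g (1 - e) - g 1) < k - g 1).
  { apply H. split; [split; [exact I|lra]|]. rewrite Rabs_left; lra. }
  apply Rabs_lt_between in H1. generalize (Hg (1 - e) ltac:(lra)). lra.
Qed.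

Lemma continuous_left_le (g : R -> R) (k : R) :
  continuous g 1 -> (forall r, 0 < r < 1 -> g r <= k) -> g 1 <= k.
Proof.
  intros Hc Hg. apply Ropp_le_cancel. apply (continuous_left_ge (fun r => - g r)); [cont1|].
  intros r Hr. apply Ropp_le_contravar. auto.
Qed.

(** The tangential derivative is given only for [r < 1]; its integrated form passes to the limit
    [r = 1] by continuity and is then differentiated. *)
Lemma is_derive_boundary (U Ur Ut : R -> R -> R) (t : R) :
  polar_harmonic U Ur Ut -> is_derive (U 1) t (Ut 1 t).
Proof.
  intros HU.
  assert (SC : forall F : R -> R -> R, (forall r t, continuity_2d_pt F r t) ->
            forall r t, continuous (F r) t) by (intros; apply continuous_slice_r; auto).
  assert (H : forall b, t - 1 <= b -> U 1 b = U 1 (t - 1) + RInt (Ut 1) (t - 1) b).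
  { intros b Hb.
    set (g := fun r => U r b - U r (t - 1) - RInt (Ut r) (t - 1) b).
    assert (Hg : continuous g 1).
    { apply (continuous_R_minus (fun r => U r b - U r (t - 1)) (fun r => RInt (Ut r) (t - 1) b)).
      - cont1; apply (continuous_slice_l U), HU.
      - apply (continuous_RInt_param Ut 0 2); try lra. intros; apply HU. }
    assert (Hz : forall r, 0 < r < 1 -> g r = 0).
    { intros r Hr. unfold g. rewrite (RInt_derive_open (U r) (Ut r)); auto.
      - apply Rminus_diag.
      - apply SC, HU.
      - apply SC, HU.
      - intros; now apply HU. }
    generalize (continuous_left_ge g 0 Hg ltac:(intros; rewrite Hz; lra)).
    generalize (continuous_left_le g 0 Hg ltac:(intros; rewrite Hz; lra)).
    unfold g. lra. }
  apply is_derive_ext_loc with (fun b => U 1 (t - 1) + RInt (Ut 1) (t - 1) b).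
  - apply (filter_imp (fun y => t - 1 < y)); [|apply open_gt; lra].
    intros y Hy. symmetry. apply H. lra.
  - eapply is_derive_eq.
    + apply (is_derive_R_plus (fun _ => U 1 (t - 1))); [apply (is_derive_const (U 1 (t - 1)))|].
      apply is_derive_upper. apply SC, HU.
    + unfold zero; simpl; ring.
Qed.

Lemma poisson_formula_r (U Ur Ut : R -> R -> R) (m r t : R) :
  polar_harmonic U Ur Ut -> (forall r t, Rabs (U r t) <= m) -> 0 < r < 1 ->
  RInt (fun s => pois_r r s * U 1 (s + t)) (- PI) PI = 2 * PI * Ur r t.
Proof.
  intros HU Hm Hr.
  assert (C : forall s, continuous (fun s => U 1 (s + t)) s).
  { intros s. apply (continuous_R_comp (U 1) (fun s => s + t)); [cont1|apply continuous_slice_r, HU]. }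
  assert (H : is_derive (fun r => RInt (fun s => pois r s * U 1 (s + t)) (- PI) PI) r
     (RInt (fun s => pois_r r s * U 1 (s + t)) (- PI) PI)).
  { apply (is_derive_RInt_param_strip (fun r s => pois r s * U 1 (s + t))
      (fun r s => pois_r r s * U 1 (s + t)) 0 1); auto.
    - intros y s Hy. eapply is_derive_eq.
      + apply (is_derive_R_mult (fun z => pois z s) (fun _ => U 1 (s + t)));
          [apply is_derive_pois_r; lra|apply (is_derive_const (U 1 (s + t)))].
      + unfold zero; simpl; ring.
    - intros y s Hy. cont2; [apply continuity_pois; lra|].
      now apply (continuity_2d_pt_snd (fun s => U 1 (s + t))).
    - intros y s Hy. cont1; auto. apply continuous_slice_r, continuity_pois; lra. }
  rewrite <- (is_derive_unique _ _ _ H).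
  apply is_derive_unique.
  apply is_derive_ext_loc with (fun r => 2 * PI * U r t).
  - apply (filter_imp (fun y => 0 < y /\ y < 1)).
    + intros y Hy. symmetry. now apply (poisson_formula_punctured U Ur Ut m).
    + apply filter_and; [apply open_gt | apply open_lt]; lra.
  - apply is_derive_R_scal. now apply HU.
Qed.

(** The derivative in [t] first falls on the boundary values; an integration by parts moves it to
    the kernel, whence the minus sign. *)
Lemma poisson_formula_t (U Ur Ut : R -> R -> R) (m r t : R) :
  polar_harmonic U Ur Ut -> (forall r t, Rabs (U r t) <= m) -> 0 < r < 1 ->
  RInt (fun s => pois_t r s * U 1 (s + t)) (- PI) PI = - (2 * PI * Ut r t).
Proof.
  intros HU Hm Hr.
  assert (C : forall t s, continuous (fun s => U 1 (s + t)) s).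
  { intros t' s. apply (continuous_R_comp (U 1) (fun s => s + t')); [cont1|apply continuous_slice_r, HU]. }
  assert (C' : forall s, continuous (fun s => Ut 1 (s + t)) s).
  { intros s. apply (continuous_R_comp (Ut 1) (fun s => s + t)); [cont1|apply continuous_slice_r, HU]. }
  assert (H : is_derive (fun t => RInt (fun s => pois r s * U 1 (s + t)) (- PI) PI) t
     (RInt (fun s => pois r s * Ut 1 (s + t)) (- PI) PI)).
  { apply (is_derive_RInt_param_strip (fun t s => pois r s * U 1 (s + t))
      (fun t s => pois r s * Ut 1 (s + t)) (t - 1) (t + 1)); try lra.
    - intros y s _. apply (is_derive_R_scal (fun y => U 1 (s + y))).
      apply is_derive_ext with (fun y => U 1 (y + s)); [intros; now rewrite Rplus_comm|].
      rewrite Rplus_comm. apply (is_derive_shift (U 1)), (is_derive_boundary U Ur Ut), HU.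
    - intros y s Hy. cont2.
      + apply (continuity_2d_pt_snd (pois r)), continuous_slice_r, continuity_pois; lra.
      + apply (continuity_2d_pt_comp Ut (fun _ _ => 1) (fun y s => s + y)); cont2. apply HU.
    - intros y s Hy. cont1; auto. apply continuous_slice_r, continuity_pois; lra. }
  replace (2 * PI * Ut r t) with (RInt (fun s => pois r s * Ut 1 (s + t)) (- PI) PI).
  - assert (HP : RInt (fun s => pois r s * Ut 1 (s + t)) (- PI) (- PI + 2 * PI) =
      - RInt (fun s => pois_t r s * U 1 (s + t)) (- PI) (- PI + 2 * PI)).
    { apply (RInt_by_parts_period (pois r) (fun s => U 1 (s + t))); auto.
    + intros; apply is_derive_pois_t; lra.
    + intros; apply is_derive_shift, (is_derive_boundary U Ur Ut), HU.
    + intros; apply continuous_slice_r, continuity_pois; lra.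
    + intros; unfold pois, pois_den. now rewrite cos_per.
    + intros s. replace (s + 2 * PI + t) with (s + t + 2 * PI) by ring. apply HU. }
    rewrite <- PI_period in HP. rewrite HP. symmetry. apply Ropp_involutive.
  - rewrite <- (is_derive_unique _ _ _ H).
    apply is_derive_unique.
    apply is_derive_ext with (fun t => 2 * PI * U r t).
    + intros y. symmetry. now apply (poisson_formula_punctured U Ur Ut m).
    + apply is_derive_R_scal. now apply HU.
Qed.

Lemma polar_harmonic_lin (a b : R) (U Ur Ut V Vr Vt : R -> R -> R) :
  polar_harmonic U Ur Ut -> polar_harmonic V Vr Vt ->
  polar_harmonic (fun r t => a * U r t + b * V r t) (fun r t => a * Ur r t + b * Vr r t)
    (fun r t => a * Ut r t + b * Vt r t).
Proof.
  intros [C Cr Ct Pe Per Pet Dr Dt [W HW]] [D Dr' Dt' Qe Qer Qet Er Et [Z HZ]].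
  assert (Hl : forall (f g : R -> R) x df dg, is_derive f x df -> is_derive g x dg ->
     is_derive (fun x => a * f x + b * g x) x (a * df + b * dg)).
  { intros. apply is_derive_R_plus; now apply is_derive_R_scal. }
  split.
  - intros; cont2; auto.
  - intros; cont2; auto.
  - intros; cont2; auto.
  - intros; now rewrite Pe, Qe.
  - intros; now rewrite Per, Qer.
  - intros; now rewrite Pet, Qet.
  - intros r t Hr. apply (Hl (fun r => U r t) (fun r => V r t)); auto.
  - intros r t Hr. apply (Hl (U r) (V r)); auto.
  - exists (fun r t => a * W r t + b * Z r t). intros r t Hr.
    destruct (HW r t Hr) as (H1 & H2 & H3). destruct (HZ r t Hr) as (H4 & H5 & H6).
    split; [|split; [|now cont2]].
    + apply is_derive_ext with (fun r => a * (r * Ur r t) + b * (r * Vr r t)); [intros; rring|].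
      now apply (Hl (fun r => r * Ur r t) (fun r => r * Vr r t)).
    + eapply is_derive_eq; [apply (Hl (Ut r) (Vt r)); eauto|ring].
Qed.

(** * Lifts of circle maps of degree one *)

(** [cl_incr] encodes at once that [phi] increases and that [exp (i phi)] is injective on the
    circle. Positivity of [w] would be too strong: the boundary homeomorphism may have critical
    points. *)
Record circle_lift (phi w : R -> R) : Prop := {
  cl_derive : forall t, is_derive phi t (w t);
  cl_cont : forall t, continuous w t;
  cl_per : forall t, phi (t + 2 * PI) = phi t + 2 * PI;
  cl_incr : forall t h, 0 < h < 2 * PI -> 0 < phi (t + h) - phi t < 2 * PI }.

Lemma cl_continuous (phi w : R -> R) (t : R) : circle_lift phi w -> continuous phi t.
Proof. intros H. eapply continuous_is_derive, H. Qed.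

(** [cl_incr] speaks only of steps shorter than [2 * PI]; longer ones are reached by adding steps of
    length [PI]. *)
Lemma cl_strict (phi w : R -> R) (s t : R) : circle_lift phi w -> s < t -> phi s < phi t.
Proof.
  intros H Hst. assert (Hpi := PI_RGT_0).
  assert (HN : forall n s t, s < t < s + (INR n + 1) * PI -> phi s < phi t).
  { induction n as [|n IH]; intros x y Hxy.
    - simpl in Hxy. generalize (cl_incr _ _ H x (y - x) ltac:(lra)).
      replace (x + (y - x)) with y by ring. lra.
    - rewrite S_INR in Hxy. destruct (Rlt_le_dec y (x + 2 * PI)) as [Hy|Hy].
      + generalize (cl_incr _ _ H x (y - x) ltac:(lra)).
        replace (x + (y - x)) with y by ring. lra.
      + assert (phi x < phi (y - PI)) by (apply IH; lra).
        generalize (cl_incr _ _ H (y - PI) PI ltac:(lra)).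
        replace (y - PI + PI) with y by ring. lra. }
  destruct (INR_archimed PI (t - s)) as [n Hn]; [lra|].
  apply (HN n). lra.
Qed.

Lemma cl_le (phi w : R -> R) (s t : R) : circle_lift phi w -> phi s <= phi t -> s <= t.
Proof.
  intros H Hst. apply Rnot_lt_le. intros Hlt. generalize (cl_strict _ _ _ _ H Hlt). lra.
Qed.

Lemma cl_lt (phi w : R -> R) (s t : R) : circle_lift phi w -> phi s < phi t -> s < t.
Proof.
  intros H Hst. apply Rnot_le_lt. intros [Hlt|Heq].
  - generalize (cl_strict _ _ _ _ H Hlt). lra.
  - subst. lra.
Qed.

Lemma cl_surj (phi w : R -> R) (y : R) : circle_lift phi w -> exists s, phi s = y.
Proof.
  intros H. assert (Hpi := PI_RGT_0).
  assert (HN : forall n t, phi (t + INR n * (2 * PI)) = phi t + INR n * (2 * PI)).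
  { induction n as [|n IH]; intros t.
    - simpl. now rewrite Rmult_0_l, !Rplus_0_r.
    - rewrite S_INR. replace (t + (INR n + 1) * (2 * PI)) with (t + INR n * (2 * PI) + 2 * PI) by ring.
      rewrite (cl_per _ _ H), IH. ring. }
  destruct (INR_archimed (2 * PI) (Rabs (y - phi 0))) as [n Hn]; [lra|].
  assert (Ha := HN n 0). assert (Hb := HN n (- (INR n * (2 * PI)))).
  rewrite Rplus_0_l in Ha. rewrite Rplus_opp_l in Hb.
  apply Rgt_lt, Rabs_lt_between in Hn.
  destruct (IVT_gen_consistent phi (- (INR n * (2 * PI))) (INR n * (2 * PI)) y) as [s [_ Hs]].
  - intros x. eapply cl_continuous; eauto.
  - rewrite Rmin_left, Rmax_right; lra.
  - now exists s.
Qed.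

(* The three kernels span the trigonometric polynomials of degree one over [pois_den ^ 2]. *)
Lemma pois_span (r : R) (G : R -> R) (a b A B C : R) :
  0 < r < 1 -> (forall s, continuous G s) ->
  RInt (fun s => pois r s * G s) a b = 0 ->
  RInt (fun s => pois_r r s * G s) a b = 0 ->
  RInt (fun s => pois_t r s * G s) a b = 0 ->
  RInt (fun s => (A + B * cos s + C * sin s) / pois_den r s ^ 2 * G s) a b = 0.
Proof.
  intros Hr HG H0 H1 H2.
  assert (C0 : forall t, continuous (pois r) t)
    by (intros; apply continuous_slice_r, continuity_pois; lra).
  assert (C1 : forall t, continuous (pois_r r) t)
    by (intros; apply continuous_slice_r, continuity_pois; lra).
  assert (C2 : forall t, continuous (pois_t r) t)
    by (intros; apply continuous_slice_r, continuity_pois; lra).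
  (* Cramer's rule: over [pois_den ^ 2], comparison of the constant and cosine coefficients is a
     linear system for [al] and [be] with determinant [d]; the sine coefficient gives [ga]. *)
  set (d := 2 * (1 - r ^ 2) ^ 3).
  assert (Hd : 0 < d) by (unfold d; apply Rmult_lt_0_compat; [lra|apply pow_lt; nra]).
  set (al := (2 * (1 + r ^ 2) * A + 4 * r * B) / d).
  set (be := ((1 - r ^ 2) * (1 + r ^ 2) * B + 2 * r * (1 - r ^ 2) * A) / d).
  set (ga := - C / ((1 - r ^ 2) * (2 * r))).
  rewrite (RInt_cont_ext _ (fun s => al * (pois r s * G s) + be * (pois_r r s * G s)
     + ga * (pois_t r s * G s))).
  - rewrite !RInt_plus_cont by (intros; cont1; auto).
    rewrite !RInt_scal_cont by (intros; cont1; auto).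
    rewrite H0, H1, H2. rring.
  - intros s. assert (HD := pois_den_pos r s ltac:(lra)).
    unfold al, be, ga, pois, pois_r, pois_t.
    replace (A + B * cos s + C * sin s) with
      (al * (1 - r ^ 2) * pois_den r s + be * (2 * (1 + r ^ 2) * cos s - 4 * r)
        + ga * - ((1 - r ^ 2) * (2 * r * sin s))).
    + unfold al, be, ga. field. unfold d in *. repeat split; nra.
    + unfold al, be, ga, d, pois_den. field. repeat split; nra.
Qed.

(** * Nonvanishing of the Jacobian *)

Lemma cos_eq_1_bounded (x : R) : cos x = 1 -> - (2 * PI) < x < 2 * PI -> x = 0.
Proof.
  intros Hc Hx. rewrite (cos_double_half x) in Hc.
  assert (Hs : sin (x / 2) = 0) by nra.
  assert (Hpi := PI_RGT_0).
  destruct (Rtotal_order x 0) as [Hlt|[Heq|Hgt]]; auto.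
  - generalize (sin_gt_0 (- (x / 2)) ltac:(lra) ltac:(lra)). rewrite sin_neg. lra.
  - generalize (sin_gt_0 (x / 2) ltac:(lra) ltac:(lra)). lra.
Qed.

Lemma unit_angle (a b : R) : a ^ 2 + b ^ 2 = 1 -> exists k, a = cos k /\ b = sin k.
Proof.
  intros H. assert (Ha : -1 <= a <= 1) by nra.
  assert (Hs : sin (acos a) ^ 2 = b ^ 2).
  { generalize (sin2_cos2 (acos a)). rewrite cos_acos by auto. unfold Rsqr. nra. }
  assert (Hor : b = sin (acos a) \/ b = - sin (acos a)).
  { assert (Hm : (b - sin (acos a)) * (b + sin (acos a)) = 0) by (ring_simplify; lra).
    apply Rmult_integral in Hm. destruct Hm; [left|right]; lra. }
  destruct Hor as [Hb|Hb].
  - exists (acos a). now rewrite cos_acos.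
  - exists (- acos a). now rewrite cos_neg, sin_neg, cos_acos.
Qed.

Lemma cos_bound_abs (x : R) : Rabs (cos x) <= 1.
Proof. apply Rabs_le. generalize (COS_bound x). lra. Qed.

(* If both derivatives vanished, [U 1 - U r t] would be orthogonal to every trigonometric polynomial
   of degree one divided by [pois_den ^ 2].  As [phi] winds once around the circle, [U 1 - U r t]
   has just two sign changes, at [s1] and [s2], so it has the sign of the polynomial
   [sin ((s - s1) / 2) * sin ((s2 - s) / 2)]: a contradiction. *)
Lemma no_critical_point (U Ur Ut : R -> R -> R) (phi w : R -> R) (m k r t : R) :
  polar_harmonic U Ur Ut -> (forall r t, Rabs (U r t) <= m) -> circle_lift phi w ->
  (forall s, U 1 s = cos (phi s - k)) -> 0 < r < 1 ->
  ~ (Ur r t = 0 /\ Ut r t = 0).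
Proof.
  intros HU Hm Hphi HB Hr [Hr0 Ht0]. assert (Hpi := PI_RGT_0).
  set (c := U r t).
  assert (C1 : forall s, continuous (U 1) s) by (intros; apply continuous_slice_r, HU).
  assert (Cs : forall s, continuous (fun s => U 1 (s + t)) s)
    by (intros; apply (continuous_R_comp (U 1) (fun s => s + t)); [cont1|auto]).
  assert (CG : forall s, continuous (fun s => U 1 (s + t) - c) s) by (intros; cont1; auto).
  assert (CP : forall s, continuous (pois r) s)
    by (intros; apply continuous_slice_r, continuity_pois; lra).
  assert (CPr : forall s, continuous (pois_r r) s)
    by (intros; apply continuous_slice_r, continuity_pois; lra).
  assert (CPt : forall s, continuous (pois_t r) s)
    by (intros; apply continuous_slice_r, continuity_pois; lra).
  assert (E0 : RInt (fun s => pois r s * (U 1 (s + t) - c)) (- PI) PI = 0).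
  { rewrite (RInt_cont_ext _ (fun s => pois r s * U 1 (s + t) - c * pois r s)) by (intros; rring).
    rewrite RInt_minus_cont, RInt_scal_cont, RInt_pois by (try (intros; cont1; auto); lra).
    rewrite (poisson_formula_punctured U Ur Ut m) by auto. unfold c. rring. }
  assert (B1 : R -> R -> Rabs 1 <= 1) by (intros; rewrite Rabs_R1; lra).
  assert (I1 : RInt (pois_r r) (- PI) PI = 0).
  { assert (H := poisson_formula_r _ _ _ 1 r t (polar_harmonic_const 1) B1 Hr).
    cbv beta in H. rewrite Rmult_0_r in H. rewrite <- H. apply RInt_cont_ext. intros; rring. }
  assert (I2 : RInt (pois_t r) (- PI) PI = 0).
  { assert (H := poisson_formula_t _ _ _ 1 r t (polar_harmonic_const 1) B1 Hr).
    cbv beta in H. rewrite Rmult_0_r, Ropp_0 in H. rewrite <- H.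
    apply RInt_cont_ext. intros; rring. }
  assert (E1 : RInt (fun s => pois_r r s * (U 1 (s + t) - c)) (- PI) PI = 0).
  { rewrite (RInt_cont_ext _ (fun s => pois_r r s * U 1 (s + t) - c * pois_r r s)) by (intros; rring).
    rewrite RInt_minus_cont, RInt_scal_cont, I1 by (intros; cont1; auto).
    rewrite (poisson_formula_r U Ur Ut m), Hr0 by auto. rring. }
  assert (E2 : RInt (fun s => pois_t r s * (U 1 (s + t) - c)) (- PI) PI = 0).
  { rewrite (RInt_cont_ext _ (fun s => pois_t r s * U 1 (s + t) - c * pois_t r s)) by (intros; rring).
    rewrite RInt_minus_cont, RInt_scal_cont, I2 by (intros; cont1; auto).
    rewrite (poisson_formula_t U Ur Ut m), Ht0 by auto. rring. }
  assert (Hc1 : -1 <= c).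
  { apply Rnot_lt_le. intros Hlt.
    assert (0 < RInt (fun s => pois r s * (U 1 (s + t) - c)) (- PI) PI); [|lra].
    apply RInt_gt_0; [lra| |intros; cont1; auto].
    intros x _. apply Rmult_lt_0_compat; [apply pois_pos; lra|].
    rewrite HB. generalize (COS_bound (phi (x + t) - k)). lra. }
  (* If [c >= 1], the Poisson mean of [c - U 1 >= 0] vanishes, so [cos (phi - k) = 1] on an arc, and
     [phi] would be constant there. *)
  assert (Hc2 : c < 1).
  { apply Rnot_le_lt. intros Hge.
    assert (Hz : forall s, - PI < s < PI -> pois r s * (c - U 1 (s + t)) = 0).
    { apply RInt_zero_nonneg; [lra|intros; cont1; auto| |].
      - intros s _. apply Rmult_le_pos; [apply Rlt_le, pois_pos; lra|].
        rewrite HB. generalize (COS_bound (phi (s + t) - k)). lra.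
      - rewrite (RInt_cont_ext _ (fun s => - 1 * (pois r s * (U 1 (s + t) - c)))) by (intros; rring).
        rewrite RInt_scal_cont, E0 by (intros; cont1; auto). lra. }
    assert (Hone' : forall s, - PI < s < PI -> cos (phi (s + t) - k) = 1).
    { intros s Hs. generalize (Hz s Hs) (pois_pos r s ltac:(lra)) (COS_bound (phi (s + t) - k)).
      rewrite HB. intros H1 H2 H3. apply Rmult_integral in H1. destruct H1; lra. }
    assert (H0 := Hone' 0 ltac:(lra)). assert (H1 := Hone' 1 ltac:(generalize PI2_1; lra)).
    rewrite Rplus_0_l in H0.
    assert (Hs0 : sin (phi t - k) = 0).
    { generalize (sin2_cos2 (phi t - k)). rewrite H0. unfold Rsqr. nra. }
    generalize (cl_incr _ _ Hphi t 1 ltac:(generalize PI2_1; lra)). rewrite (Rplus_comm t 1).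
    intros Hin. assert (phi (1 + t) - phi t = 0); [|lra].
    apply cos_eq_1_bounded; [|lra].
    replace (phi (1 + t) - phi t) with ((phi (1 + t) - k) - (phi t - k)) by ring.
    rewrite cos_minus, H0, H1, Hs0. ring. }
  (* Modulo [2 * PI], the set where [U 1 > c] is [Rabs (phi - k) < al]. Here [al > 0] comes from
     [c < 1]; the extreme case [al = PI], where [s2 = s1 + 2 * PI], is allowed. *)
  set (al := acos c).
  assert (Hal : 0 < al <= PI).
  { unfold al. destruct (acos_bound c) as [[Hp|Hp] Hq]; [lra|].
    exfalso. assert (Hcc := cos_acos c ltac:(lra)). rewrite <- Hp, cos_0 in Hcc. lra. }
  assert (Hcal : cos al = c) by (apply cos_acos; lra).
  destruct (cl_surj _ _ (k - al) Hphi) as [s1 Hs1].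
  destruct (cl_surj _ _ (k + al) Hphi) as [s2 Hs2].
  destruct (cl_surj _ _ k Hphi) as [s0 Hs0].
  assert (H10 : s1 < s0) by (apply (cl_lt _ _ _ _ Hphi); lra).
  assert (H02 : s0 < s2) by (apply (cl_lt _ _ _ _ Hphi); lra).
  assert (H21 : s2 <= s1 + 2 * PI)
    by (apply (cl_le _ _ _ _ Hphi); rewrite (cl_per _ _ Hphi); lra).
  set (T := fun s => sin ((s - s1) / 2) * sin ((s2 - s) / 2)).
  assert (HTG : forall s, s1 < s < s1 + 2 * PI -> 0 <= T s * (U 1 s - c)).
  { intros s Hs. unfold T.
    assert (Hsin1 : 0 < sin ((s - s1) / 2)) by (apply sin_gt_0; lra).
    assert (L1 := cl_strict _ _ _ _ Hphi (proj1 Hs)).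
    assert (L2 := cl_strict _ _ _ _ Hphi (proj2 Hs)). rewrite (cl_per _ _ Hphi) in L2.
    rewrite HB, <- Hcal.
    destruct (Rle_lt_dec s s2) as [Hle|Hlt].
    - assert (Hsin2 : 0 <= sin ((s2 - s) / 2)) by (apply sin_ge_0; lra).
      assert (L3 : phi s <= phi s2).
      { destruct Hle as [Hle|Hle]; [|subst; lra]. left. eapply cl_strict; eauto. }
      apply Rmult_le_pos; [nra|].
      assert (cos al <= cos (phi s - k)); [|lra].
      destruct (Rle_lt_dec 0 (phi s - k)).
      + apply cos_decr_1; lra.
      + rewrite <- (cos_neg (phi s - k)). apply cos_decr_1; lra.
    - assert (Hsin2 : 0 <= sin ((s - s2) / 2)) by (apply sin_ge_0; lra).
      replace ((s2 - s) / 2) with (- ((s - s2) / 2)) by field. rewrite sin_neg.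
      assert (L3 : phi s2 < phi s) by (eapply cl_strict; eauto).
      assert (cos (phi s - k) <= cos al); [|assert (0 <= sin ((s - s1) / 2) * sin ((s - s2) / 2)) by nra; nra].
      destruct (Rle_lt_dec (phi s - k) PI).
      + apply cos_decr_1; lra.
      + rewrite <- (cos_neg (phi s - k)), <- cos_per. apply cos_decr_1; lra. }
  (* By the product formula [T (s + t)] is half of [cos (s + t - mid) - cos ((s2 - s1) / 2)], a
     trigonometric polynomial of degree one in [s]. *)
  set (mid := (s1 + s2) / 2).
  set (H := fun s => (- cos ((s2 - s1) / 2) / 2 + cos (t - mid) / 2 * cos s
      + - sin (t - mid) / 2 * sin s) / pois_den r s ^ 2 * (U 1 (s + t) - c)).
  assert (HT : forall s, H s = T (s + t) / pois_den r s ^ 2 * (U 1 (s + t) - c)).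
  { intros s. unfold H. f_equal. f_equal. unfold T.
    set (x := (s + t - s1) / 2). set (y := (s2 - (s + t)) / 2).
    replace ((s2 - s1) / 2) with (x + y) by (unfold x, y; field).
    assert (Hxy : cos (x - y) = cos (t - mid) * cos s - sin (t - mid) * sin s).
    { rewrite <- cos_plus. f_equal. unfold x, y, mid. field. }
    rewrite cos_minus in Hxy. rewrite cos_plus. lra. }
  assert (HD : forall s, pois_den r s <> 0) by (intros; generalize (pois_den_pos r s ltac:(lra)); lra).
  assert (CH : forall s, continuous H s).
  { intros s. unfold H. cont1; auto.
    - apply continuous_slice_r, continuity_pois_den.
    - now apply pow_nonzero. }
  assert (PH : forall s, H (s + 2 * PI) = H s).
  { intros s. unfold H, pois_den. rewrite cos_per, sin_per.
    replace (s + 2 * PI + t) with (s + t + 2 * PI) by ring.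
    now rewrite (ph_per _ _ _ HU). }
  (* Periodicity moves the integral to the period that starts at [s1 - t], the one on which [HTG]
     gives the sign. *)
  assert (I : RInt H (s1 - t) (s1 - t + 2 * PI) = 0).
  { rewrite (RInt_period H (s1 - t) (- PI)) by auto. rewrite <- PI_period.
    now apply pois_span. }
  assert (Hz : H (s0 - t) = 0).
  { apply (RInt_zero_nonneg H (s1 - t) (s1 - t + 2 * PI)); auto; try lra.
    intros s Hs. rewrite HT.
    replace (T (s + t) / pois_den r s ^ 2 * (U 1 (s + t) - c))
      with (T (s + t) * (U 1 (s + t) - c) / pois_den r s ^ 2) by (field; auto).
    apply Rdiv_le_0_compat; [apply HTG; lra|]. apply pow2_gt_0, HD. }
  rewrite HT in Hz. replace (s0 - t + t) with s0 in Hz by ring.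
  rewrite HB, Hs0, Rminus_diag, cos_0 in Hz.
  assert (0 < T s0) by (apply Rmult_lt_0_compat; apply sin_gt_0; lra).
  apply Rmult_integral in Hz. destruct Hz as [Hz|Hz]; [|lra].
  assert (0 < T s0 / pois_den r (s0 - t) ^ 2); [|lra].
  apply Rdiv_lt_0_compat; auto. apply pow2_gt_0, HD.
Qed.

(** The vector is a column of the matrix, if one is nonzero, turned by a right angle. Unit length
    makes [p * U + q * V] equal to [cos (phi - k)] on the circle, as [no_critical_point]
    requires. *)
Lemma kernel_unit_vector (a b c d : R) :
  a * d - b * c = 0 -> exists p q, p ^ 2 + q ^ 2 = 1 /\ p * a + q * c = 0 /\ p * b + q * d = 0.
Proof.
  intros H.
  assert (N : forall x y, 0 < x ^ 2 + y ^ 2 ->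
     (x / sqrt (x ^ 2 + y ^ 2)) ^ 2 + (y / sqrt (x ^ 2 + y ^ 2)) ^ 2 = 1).
  { intros x y Hp. assert (Hs := sqrt_lt_R0 _ Hp).
    assert (Hq := sqrt_sqrt _ (Rlt_le _ _ Hp)).
    set (z := sqrt (x ^ 2 + y ^ 2)) in *.
    replace ((x / z) ^ 2 + (y / z) ^ 2) with ((x ^ 2 + y ^ 2) / (z * z)) by (field; lra).
    rewrite Hq. field. lra. }
  destruct (Req_dec (c ^ 2 + a ^ 2) 0) as [H1|H1].
  - destruct (Req_dec (d ^ 2 + b ^ 2) 0) as [H2|H2].
    + exists 1, 0. assert (a = 0) by nra. assert (b = 0) by nra. subst. repeat split; ring.
    + assert (Hp : 0 < d ^ 2 + (- b) ^ 2) by nra.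
      exists (d / sqrt (d ^ 2 + (- b) ^ 2)), (- b / sqrt (d ^ 2 + (- b) ^ 2)).
      split; [now apply N|].
      split; unfold Rdiv; [|ring].
      replace (d * / sqrt (d ^ 2 + (- b) ^ 2) * a + - b * / sqrt (d ^ 2 + (- b) ^ 2) * c)
        with ((a * d - b * c) * / sqrt (d ^ 2 + (- b) ^ 2)) by ring.
      rewrite H. ring.
  - assert (Hp : 0 < c ^ 2 + (- a) ^ 2) by nra.
    exists (c / sqrt (c ^ 2 + (- a) ^ 2)), (- a / sqrt (c ^ 2 + (- a) ^ 2)).
    split; [now apply N|].
    split; unfold Rdiv; [ring|].
    replace (c * / sqrt (c ^ 2 + (- a) ^ 2) * b + - a * / sqrt (c ^ 2 + (- a) ^ 2) * d)
      with (- (a * d - b * c) * / sqrt (c ^ 2 + (- a) ^ 2)) by ring.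
    rewrite H. ring.
Qed.

Lemma jacobian_nonzero (U Ur Ut V Vr Vt : R -> R -> R) (phi w : R -> R) (m r t : R) :
  polar_harmonic U Ur Ut -> polar_harmonic V Vr Vt ->
  (forall r t, Rabs (U r t) <= m) -> (forall r t, Rabs (V r t) <= m) ->
  circle_lift phi w -> (forall s, U 1 s = cos (phi s)) -> (forall s, V 1 s = sin (phi s)) ->
  0 < r < 1 -> Ur r t * Vt r t - Ut r t * Vr r t <> 0.
Proof.
  intros HU HV HmU HmV Hphi HBU HBV Hr H0.
  destruct (kernel_unit_vector _ _ _ _ H0) as (p & q & Hpq & Hx & Hy).
  destruct (unit_angle p q Hpq) as (k & Hp & Hq).
  apply (no_critical_point _ _ _ phi w (2 * m) k r t (polar_harmonic_lin p q _ _ _ _ _ _ HU HV)); auto.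
  - intros x y. eapply Rle_trans; [apply Rabs_triang|]. rewrite !Rabs_mult.
    assert (Rabs p <= 1) by (subst; apply cos_bound_abs).
    assert (Rabs q <= 1) by (apply Rabs_le; subst q; generalize (SIN_bound k); lra).
    generalize (HmU x y) (HmV x y) (Rabs_pos (U x y)) (Rabs_pos (V x y)) (Rabs_pos p) (Rabs_pos q).
    intros. nra.
  - intros s. rewrite HBU, HBV, cos_minus, Hp, Hq. ring.
Qed.

(** The strip [0 < r < 1] of the [(r, t)] plane is convex, so the intermediate value theorem applies
    on the segment between the two points. *)
Lemma jacobian_sign (j : R -> R -> R) (r t r' t' : R) :
  (forall r t, continuity_2d_pt j r t) -> (forall r t, 0 < r < 1 -> j r t <> 0) ->
  0 < r < 1 -> 0 < r' < 1 -> 0 < j r t -> 0 < j r' t'.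
Proof.
  intros Hc Hn Hr Hr' Hp. apply Rnot_le_lt. intros Hle.
  set (g := fun x => j (r + x * (r' - r)) (t + x * (t' - t))).
  destruct (IVT_gen_consistent g 0 1 0) as [x [Hx Hg]].
  - intros x. apply (continuous_comp_2d j (fun x => r + x * (r' - r)) (fun x => t + x * (t' - t)));
      [apply Hc|cont1|cont1].
  - unfold g. rewrite !Rmult_0_l, !Rmult_1_l, !Rplus_0_r.
    replace (r + (r' - r)) with r' by ring. replace (t + (t' - t)) with t' by ring.
    rewrite Rmin_right, Rmax_left; lra.
  - rewrite Rmin_left, Rmax_right in Hx by lra.
    apply (Hn (r + x * (r' - r)) (t + x * (t' - t))); auto. destruct (Rle_lt_dec r r'); split; nra.
Qed.

(** * Energy and area as boundary integrals *)

(** The energy on circles enters as a continuous [e] that agrees with the polar expression for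
    [0 < r < 1]: the latter contains a division by [r], while the Cartesian energy supplied later is
    continuous at the origin. *)
Lemma energy_identity (U Ur Ut : R -> R -> R) (e : R -> R) :
  polar_harmonic U Ur Ut -> (forall r, continuous e r) ->
  (forall r, 0 < r < 1 ->
     e r = RInt (fun t => r * (Ur r t * Ur r t) + Ut r t * Ut r t / r) 0 (2 * PI)) ->
  RInt e 0 1 = RInt (fun t => U 1 t * Ur 1 t) 0 (2 * PI).
Proof.
  intros HU He Hr. assert (Hpi := PI_RGT_0).
  rewrite (RInt_derive_open (fun r => RInt (fun t => U r t * (r * Ur r t)) 0 (2 * PI))); auto.
  - rewrite (RInt_cont_ext (fun t => U 0 t * (0 * Ur 0 t)) (fun _ => 0)) by (intros; rring).
    rewrite RInt_const_R.
    rewrite (RInt_cont_ext (fun t => U 1 t * (1 * Ur 1 t)) (fun t => U 1 t * Ur 1 t))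
      by (intros; rring).
    rring.
  - lra.
  - intros r. apply (continuous_RInt_param (fun r t => U r t * (r * Ur r t)) (r - 1) (r + 1)); try lra.
    intros; cont2; apply HU.
  - intros r Hr1. rewrite Hr by auto.
    generalize (green_first U Ur Ut U Ur Ut 0 r HU HU Hr1). now rewrite Rplus_0_l.
Qed.

(** The integral of [U * Vt] has as derivative that of [Ur * Vt + U * M], and by parts in [t] the
    second term becomes [- Ut * Vr]. [M] is the mixed derivative of [V], which [polar_harmonic] does
    not contain; [Vt 0 t = 0] removes the contribution of the origin. *)
Lemma area_identity (U Ur Ut V Vr Vt M : R -> R -> R) (j : R -> R) :
  polar_harmonic U Ur Ut -> polar_harmonic V Vr Vt ->
  (forall r t, 0 < r < 1 -> is_derive (fun r => Vt r t) r (M r t) /\ is_derive (Vr r) t (M r t) /\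
     continuity_2d_pt M r t) ->
  (forall t, Vt 0 t = 0) ->
  (forall r, continuous j r) ->
  (forall r, 0 < r < 1 -> j r = RInt (fun t => Ur r t * Vt r t - Ut r t * Vr r t) 0 (2 * PI)) ->
  RInt j 0 1 = RInt (fun t => U 1 t * Vt 1 t) 0 (2 * PI).
Proof.
  intros HU HV HM H0 Hj Hr. assert (Hpi := PI_RGT_0).
  rewrite (RInt_derive_open (fun r => RInt (fun t => U r t * Vt r t) 0 (2 * PI))); auto.
  - rewrite (RInt_cont_ext (fun t => U 0 t * Vt 0 t) (fun _ => 0)) by (intros; rewrite H0; rring).
    rewrite RInt_const_R. rring.
  - lra.
  - intros r. apply (continuous_RInt_param (fun r t => U r t * Vt r t) (r - 1) (r + 1)); try lra.
    intros; cont2. apply HU. apply HV.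
  - intros r Hr1. rewrite Hr by auto.
    assert (CM : forall t, continuous (M r) t) by (intros; apply continuous_slice_r, HM, Hr1).
    assert (CU : forall t, continuous (U r) t) by (intros; apply continuous_slice_r, HU).
    assert (CUr : forall t, continuous (Ur r) t) by (intros; apply continuous_slice_r, HU).
    assert (CUt : forall t, continuous (Ut r) t) by (intros; apply continuous_slice_r, HU).
    assert (CVr : forall t, continuous (Vr r) t) by (intros; apply continuous_slice_r, HV).
    assert (CVt : forall t, continuous (Vt r) t) by (intros; apply continuous_slice_r, HV).
    eapply is_derive_eq.
    + apply (is_derive_RInt_param_strip (fun r t => U r t * Vt r t)
        (fun r t => Ur r t * Vt r t + U r t * M r t) 0 1); auto.
      * intros y t Hy. apply (is_derive_R_mult (fun r => U r t) (fun r => Vt r t)).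
        -- now apply HU.
        -- now apply HM.
      * intros y t Hy. cont2; try apply HU; try apply HV. now apply HM.
      * intros y t Hy. cont1; apply continuous_slice_r; [apply HU|apply HV].
    + rewrite RInt_plus_cont, RInt_minus_cont by (intros; cont1; auto).
      apply Rplus_eq_compat_l.
      assert (HP : RInt (fun t => U r t * M r t) 0 (0 + 2 * PI) =
         - RInt (fun t => Ut r t * Vr r t) 0 (0 + 2 * PI)).
      { apply RInt_by_parts_period; auto; try apply HU; try apply HV; auto.
        - intros; now apply HU.
        - intros; now apply HM. }
      now rewrite Rplus_0_l in HP.
Qed.

(** * Inequalities for the sine *)

(** A crude slope is enough: up to [PI / 6] the cosine is at least [1 / 2], and beyond it
    [sin y >= 1 / 2] while [y / 4 <= PI / 8 <= 1 / 2]. *)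
Lemma sin_ge_quarter (y : R) : 0 <= y <= PI / 2 -> y / 4 <= sin y.
Proof.
  intros Hy. assert (Hpi := PI_RGT_0). assert (H4 := PI_4).
  destruct (Rle_lt_dec y (PI / 6)) as [H|H].
  - destruct (MVT_gen sin 0 y cos) as [c [Hc E]].
    + intros; apply is_derive_sin.
    + intros; apply continuity_pt_filterlim, continuous_sin.
    + rewrite Rmin_left, Rmax_right in Hc by lra. rewrite sin_0 in E.
      assert (cos (PI / 3) <= cos c) by (apply cos_decr_1; lra).
      rewrite cos_PI3 in *. nra.
  - assert (sin (PI / 6) <= sin y) by (apply sin_incr_1; lra).
    rewrite sin_PI6 in *. lra.
Qed.

Lemma sqr_le_sin_half (a : R) : - PI <= a <= PI -> a ^ 2 <= 64 * sin (a / 2) ^ 2.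
Proof.
  intros Ha.
  assert (H : forall b, 0 <= b <= PI -> b ^ 2 <= 64 * sin (b / 2) ^ 2).
  { intros b Hb. generalize (sin_ge_quarter (b / 2) ltac:(lra)). intros. nra. }
  destruct (Rle_lt_dec 0 a); [apply H; lra|].
  replace (sin (a / 2) ^ 2) with (sin (- a / 2) ^ 2).
  - replace (a ^ 2) with ((- a) ^ 2) by ring. apply H. lra.
  - replace (- a / 2) with (- (a / 2)) by field. rewrite sin_neg. ring.
Qed.

Lemma abs_sin_le (x : R) : Rabs (sin x) <= Rabs x.
Proof.
  destruct (MVT_gen sin 0 x cos) as [c [_ E]].
  - intros; apply is_derive_sin.
  - intros; apply continuity_pt_filterlim, continuous_sin.
  - rewrite sin_0, !Rminus_0_r in E. rewrite E, Rabs_mult.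
    generalize (cos_bound_abs c) (Rabs_pos x). nra.
Qed.

(** The cosine is above [cos x0] on [(- x0, x0)] and below it on [(x0, 2 * PI - x0)], so the sine
    minus its tangent peaks at [x0] although the sine is not concave on the whole interval. *)
Lemma sin_below_tangent (x0 x : R) : 0 < x0 < PI -> - x0 <= x <= 2 * PI - x0 -> x <> x0 ->
  sin x < sin x0 + (x - x0) * cos x0.
Proof.
  intros H0 Hx Hne.
  assert (HD : forall y, is_derive sin y (cos y)) by (intros; apply is_derive_sin).
  assert (HM : forall a b, a < b -> exists c, a < c < b /\ sin b - sin a = cos c * (b - a)).
  { intros a b Hab. destruct (MVT_cor2 sin cos a b Hab) as [c [E Hc]].
    - intros; apply is_derive_Reals, HD.
    - now exists c. }
  destruct (Rtotal_order x x0) as [Hlt|[Heq|Hgt]]; [|contradiction|].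
  - destruct (HM x x0 Hlt) as [c [Hc E]].
    assert (cos x0 < cos c).
    { destruct (Rle_lt_dec 0 c); [apply cos_decreasing_1; lra|].
      rewrite <- (cos_neg c). apply cos_decreasing_1; lra. }
    nra.
  - destruct (HM x0 x Hgt) as [c [Hc E]].
    assert (cos c < cos x0).
    { destruct (Rle_lt_dec c PI); [apply cos_decreasing_1; lra|].
      rewrite <- (cos_neg c), <- cos_per. apply cos_decreasing_1; lra. }
    nra.
Qed.

(** Apply [sin_below_tangent] at [x0 = a / 2] to [p - a / 2]: the range [0 <= p <= 2 * PI] is
    exactly its interval. Negative [a] reduces to positive by [(a, p) -> (- a, - p)], under which
    both factors change sign. *)
Lemma chord_defect (a p : R) :
  - PI <= a <= PI -> (0 < a -> 0 <= p <= 2 * PI) -> (a < 0 -> - (2 * PI) <= p <= 0) ->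
  a <> 0 -> p <> a ->
  0 < sin (a / 2) * (sin (a / 2) + (p - a) * cos (a / 2) - sin (p - a / 2)).
Proof.
  intros Ha Hp Hn Ha0 Hpa. assert (Hpi := PI_RGT_0).
  assert (H : forall a p, 0 < a <= PI -> 0 <= p <= 2 * PI -> p <> a ->
     0 < sin (a / 2) * (sin (a / 2) + (p - a) * cos (a / 2) - sin (p - a / 2))).
  { intros b q Hb Hq Hne. apply Rmult_lt_0_compat; [apply sin_gt_0; lra|].
    generalize (sin_below_tangent (b / 2) (q - b / 2) ltac:(lra) ltac:(lra) ltac:(lra)).
    replace (q - b / 2 - b / 2) with (q - b) by field. lra. }
  destruct (Rtotal_order a 0) as [Hlt|[Heq|Hgt]]; [|contradiction|apply H; lra].
  replace (sin (a / 2)) with (- sin (- a / 2)).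
  2: { replace (a / 2) with (- (- a / 2)) by field. now rewrite sin_neg. }
  replace (cos (a / 2)) with (cos (- a / 2)).
  2: { replace (- a / 2) with (- (a / 2)) by field. now rewrite cos_neg. }
  replace (sin (p - a / 2)) with (- sin (- p - - a / 2)).
  2: { replace (p - a / 2) with (- (- p - - a / 2)) by field. now rewrite sin_neg. }
  generalize (H (- a) (- p) ltac:(lra) ltac:(lra) ltac:(lra)). lra.
Qed.

(** * Circle homeomorphisms *)

Section CircleLift.

Variables phi w : R -> R.
Hypothesis Hphi : circle_lift phi w.

Definition lift_inc (a t : R) : R := phi (t + a) - phi t.
Definition lift_cos (a : R) : R := RInt (fun t => cos (lift_inc a t)) 0 (2 * PI).
Definition lift_sin (a : R) : R := RInt (fun t => sin (lift_inc a t)) 0 (2 * PI).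
(** This is [sin (a / 2)] times the integral over [t] of [sin (a / 2) - sin (lift_inc a t - a / 2)].
    It vanishes when [phi] is a translation; the outer factor compensates the sign of the integral
    for negative [a]. *)
Definition lift_defect (a : R) : R :=
  sin (a / 2) * (sin (a / 2) * (2 * PI + lift_cos a) - cos (a / 2) * lift_sin a).

Lemma continuous_phi (t : R) : continuous phi t.
Proof. now apply cl_continuous with w. Qed.

Lemma continuity_lift_inc (a t : R) : continuity_2d_pt lift_inc a t.
Proof.
  unfold lift_inc. cont2.
  - apply (continuity_2d_pt_comp_1d phi (fun a t => t + a)); [apply continuous_phi|cont2].
  - apply (continuity_2d_pt_snd phi), continuous_phi.
Qed.

Lemma continuous_lift_inc (a t : R) : continuous (lift_inc a) t.
Proof. apply continuous_slice_r, continuity_lift_inc. Qed.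

Lemma lift_inc_per (a t : R) : lift_inc a (t + 2 * PI) = lift_inc a t.
Proof.
  unfold lift_inc. replace (t + 2 * PI + a) with (t + a + 2 * PI) by ring.
  rewrite !(cl_per _ _ Hphi). ring.
Qed.

Lemma lift_inc_per_l (a t : R) : lift_inc (a + 2 * PI) t = lift_inc a t + 2 * PI.
Proof.
  unfold lift_inc. replace (t + (a + 2 * PI)) with (t + a + 2 * PI) by ring.
  rewrite (cl_per _ _ Hphi). ring.
Qed.

Lemma is_derive_lift_inc_t (a t : R) : is_derive (lift_inc a) t (w (t + a) - w t).
Proof.
  apply (is_derive_R_minus (fun t => phi (t + a)) phi).
  - apply is_derive_shift, (cl_derive _ _ Hphi).
  - apply (cl_derive _ _ Hphi).
Qed.

Lemma is_derive_lift_inc_a (a t : R) : is_derive (fun a => lift_inc a t) a (w (t + a)).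
Proof.
  eapply is_derive_eq.
  - apply (is_derive_R_minus (fun a => phi (t + a)) (fun _ => phi t)).
    + apply is_derive_ext with (fun a => phi (a + t)); [intros; now rewrite Rplus_comm|].
      apply is_derive_shift, (cl_derive _ _ Hphi).
    + apply (is_derive_const (phi t)).
  - rewrite (Rplus_comm t a). unfold zero; simpl; ring.
Qed.

Lemma lift_inc_bound_pos (a t : R) : 0 < a < 2 * PI -> 0 <= lift_inc a t <= 2 * PI.
Proof. intros Ha. unfold lift_inc. generalize (cl_incr _ _ Hphi t a Ha). lra. Qed.

Lemma lift_inc_bound_neg (a t : R) : - (2 * PI) < a < 0 -> - (2 * PI) <= lift_inc a t <= 0.
Proof.
  intros Ha. unfold lift_inc. generalize (cl_incr _ _ Hphi (t + a) (- a) ltac:(lra)).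
  replace (t + a + - a) with t by ring. lra.
Qed.

Lemma RInt_w : RInt w 0 (2 * PI) = 2 * PI.
Proof.
  rewrite (RInt_derive_open phi w).
  - generalize (cl_per _ _ Hphi 0). rewrite Rplus_0_l. intros ->. rring.
  - generalize PI_RGT_0; lra.
  - apply continuous_phi.
  - apply (cl_cont _ _ Hphi).
  - intros; apply (cl_derive _ _ Hphi).
Qed.

(** [phi t - t] is periodic, so a shift does not change its integral over a period. *)
Lemma RInt_lift_inc (a : R) : RInt (lift_inc a) 0 (2 * PI) = 2 * PI * a.
Proof.
  set (chi := fun t => phi t - t).
  assert (Cc : forall t, continuous chi t) by (intros; unfold chi; cont1; apply continuous_phi).
  assert (H : RInt (fun t => chi (t + a)) 0 (0 + 2 * PI) = RInt chi 0 (0 + 2 * PI)).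
  { apply RInt_period_shift; auto. intros t. unfold chi. rewrite (cl_per _ _ Hphi). ring. }
  rewrite Rplus_0_l in H.
  rewrite (RInt_cont_ext (lift_inc a) (fun t => chi (t + a) - chi t + a)).
  - rewrite RInt_plus_cont, RInt_minus_cont, H, RInt_const_R.
    + rring.
    + intros t. apply (continuous_R_comp chi (fun t => t + a)); [cont1|auto].
    + auto.
    + intros t. apply (continuous_R_minus (fun t => chi (t + a)) chi); auto.
      apply (continuous_R_comp chi (fun t => t + a)); [cont1|auto].
    + intros; cont1.
  - intros t. unfold lift_inc, chi. ring.
Qed.

Lemma continuous_cos_inc (a t : R) : continuous (fun t => cos (lift_inc a t)) t.
Proof. cont1. apply continuous_lift_inc. Qed.

Lemma continuous_sin_inc (a t : R) : continuous (fun t => sin (lift_inc a t)) t.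
Proof. cont1. apply continuous_lift_inc. Qed.

Lemma continuous_lift_cos (a : R) : continuous lift_cos a.
Proof.
  apply (continuous_RInt_param (fun a t => cos (lift_inc a t)) (a - 1) (a + 1)); try lra.
  - generalize PI_RGT_0; lra.
  - intros; cont2. apply continuity_lift_inc.
Qed.

Lemma continuity_w_sum (a t : R) : continuity_2d_pt (fun a t => w (t + a)) a t.
Proof.
  apply (continuity_2d_pt_comp_1d w (fun a t => t + a)); [apply (cl_cont _ _ Hphi)|cont2].
Qed.

(** Differentiation gives the weight [w (t + a)]. It may be replaced by [w t], the weight of the
    radial pairing, because [(w (t + a) - w t) * cos (lift_inc a t)] is the derivative in [t] of the
    periodic function [sin (lift_inc a t)]. *)
Lemma is_derive_lift_sin (a : R) :
  is_derive lift_sin a (RInt (fun t => w t * cos (lift_inc a t)) 0 (2 * PI)).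
Proof.
  assert (Cw := cl_cont _ _ Hphi).
  assert (Cws : forall t, continuous (fun t => w (t + a)) t)
    by (intros; apply (continuous_R_comp w (fun t => t + a)); [cont1|auto]).
  eapply is_derive_eq.
  - apply (is_derive_RInt_param_strip (fun a t => sin (lift_inc a t))
      (fun a t => w (t + a) * cos (lift_inc a t)) (a - 1) (a + 1)); try lra.
    + intros y t _. apply (is_derive_R_comp sin (fun a => lift_inc a t)).
      * apply is_derive_lift_inc_a.
      * apply is_derive_sin.
    + intros y t _. cont2; [apply continuity_w_sum|apply continuity_lift_inc].
    + intros y t _. apply continuous_sin_inc.
  - assert (H : RInt (fun t => (w (t + a) - w t) * cos (lift_inc a t)) 0 (2 * PI) = 0).
    { rewrite (RInt_derive_open (fun t => sin (lift_inc a t))).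
      - rewrite <- (Rplus_0_l (2 * PI)), lift_inc_per. apply Rminus_diag.
      - generalize PI_RGT_0; lra.
      - apply continuous_sin_inc.
      - intros t. cont1; auto. apply continuous_lift_inc.
      - intros t _. apply (is_derive_R_comp sin (lift_inc a)).
        + apply is_derive_lift_inc_t.
        + apply is_derive_sin. }
    rewrite (RInt_cont_ext _ (fun t => w (t + a) * cos (lift_inc a t)
       - w t * cos (lift_inc a t))) in H by (intros; rring).
    rewrite RInt_minus_cont in H by (intros; cont1; auto; apply continuous_lift_inc).
    apply Rminus_diag_uniq, H.
Qed.

Lemma continuous_lift_sin (a : R) : continuous lift_sin a.
Proof. eapply continuous_is_derive, is_derive_lift_sin. Qed.

Lemma lift_sin_per (a : R) : lift_sin (a + 2 * PI) = lift_sin a.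
Proof. apply RInt_cont_ext. intros t. now rewrite lift_inc_per_l, sin_per. Qed.

Lemma continuous_half (f : R -> R) (a : R) :
  (forall x, continuous f x) -> continuous (fun a => f (a / 2)) a.
Proof.
  intros Hf. apply (continuous_R_comp f (fun a => a / 2)); auto.
  apply (continuous_R_mult (fun a => a) (fun _ => / 2)); cont1.
Qed.

Lemma continuous_lift_defect (a : R) : continuous lift_defect a.
Proof.
  assert (Hs := continuous_half sin a continuous_R_sin).
  assert (Hc := continuous_half cos a continuous_R_cos).
  unfold lift_defect. cont1; try exact Hs; try exact Hc.
  apply continuous_lift_cos. apply continuous_lift_sin.
Qed.

Definition defect_density (a t : R) : R :=
  sin (a / 2) * (sin (a / 2) + (lift_inc a t - a) * cos (a / 2) - sin (lift_inc a t - a / 2)).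

Lemma continuous_defect_density (a t : R) : continuous (defect_density a) t.
Proof. unfold defect_density. cont1; apply continuous_lift_inc. Qed.

(* The linear term of the tangent contributes nothing, since [lift_inc a] has mean [a]. *)
Lemma lift_defect_eq (a : R) : lift_defect a = RInt (defect_density a) 0 (2 * PI).
Proof.
  assert (Ci := continuous_lift_inc a).
  set (s := sin (a / 2)). set (c := cos (a / 2)).
  rewrite (RInt_cont_ext (defect_density a) (fun t => s * (s * cos (lift_inc a t))
     - s * (c * sin (lift_inc a t)) + s * c * lift_inc a t + s * (s - c * a))).
  - rewrite !RInt_plus_cont, RInt_minus_cont, !RInt_scal_cont, RInt_lift_inc, RInt_const_R
      by (intros; cont1; auto).
    unfold lift_defect. fold s c. unfold lift_cos, lift_sin. rring.
  - intros t. unfold defect_density. rewrite sin_minus. fold s c. ring.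
Qed.

Lemma defect_density_pos (a t : R) : - PI < a < PI -> a <> 0 -> lift_inc a t <> a ->
  0 < defect_density a t.
Proof.
  intros Ha H0 Hne. apply chord_defect; auto; try lra.
  - intros. apply lift_inc_bound_pos. generalize PI_RGT_0; lra.
  - intros. apply lift_inc_bound_neg. generalize PI_RGT_0; lra.
Qed.

Lemma defect_density_ge_0 (a t : R) : - PI < a < PI -> 0 <= defect_density a t.
Proof.
  intros Ha. destruct (Req_dec a 0) as [H0|H0].
  - subst. unfold defect_density. rewrite Rdiv_0_l, sin_0, Rmult_0_l. lra.
  - destruct (Req_dec (lift_inc a t) a) as [H1|H1].
    + unfold defect_density. rewrite H1. replace (a - a / 2) with (a / 2) by field.
      right. ring.
    + left. now apply defect_density_pos.
Qed.

Lemma lift_defect_ge_0 (a : R) : - PI < a < PI -> 0 <= lift_defect a.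
Proof.
  intros Ha. rewrite lift_defect_eq. apply RInt_ge_0.
  - generalize PI_RGT_0; lra.
  - apply ex_RInt_cont, continuous_defect_density.
  - intros t _. now apply defect_density_ge_0.
Qed.

Lemma lift_translation :
  RInt lift_defect (- PI) PI <= 0 -> forall t, phi t = t + (phi PI - PI).
Proof.
  intros H. assert (Hpi := PI_RGT_0).
  assert (H1 : forall a, - PI < a < PI -> lift_defect a = 0).
  { apply RInt_zero_nonneg; auto; try lra.
    - apply continuous_lift_defect.
    - intros; now apply lift_defect_ge_0. }
  assert (H2 : forall a t, - PI < a < PI -> 0 < t < 2 * PI -> lift_inc a t = a).
  { intros a t Ha Ht. destruct (Req_dec a 0) as [H0|H0].
    - subst. unfold lift_inc. rewrite Rplus_0_r. ring.
    - destruct (Req_dec (lift_inc a t) a) as [|Hne]; auto.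
      generalize (defect_density_pos a t Ha H0 Hne).
      rewrite (RInt_zero_nonneg (defect_density a) 0 (2 * PI)); auto; try lra.
      + apply continuous_defect_density.
      + intros; now apply defect_density_ge_0.
      + rewrite <- lift_defect_eq, H1; auto. lra. }
  set (k := phi PI - PI).
  (* So far the equality is known on [(0, 2 * PI)], with base point [PI]. The squared deviation is
     periodic, continuous and nonnegative with zero integral, which extends it to all [t], multiples
     of [2 * PI] included. *)
  set (g := fun t => (phi t - t - k) * (phi t - t - k)).
  assert (Cg : forall t, continuous g t) by (intros; unfold g; cont1; apply continuous_phi).
  assert (Pg : forall t, g (t + 2 * PI) = g t)
    by (intros; unfold g; rewrite (cl_per _ _ Hphi); ring).
  assert (I0 : RInt g 0 (0 + 2 * PI) = 0).
  { rewrite Rplus_0_l.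
    rewrite (RInt_ext g (fun _ => 0)); [rewrite RInt_const_R; rring|].
    intros t Ht. rewrite Rmin_left, Rmax_right in Ht by lra.
    assert (E := H2 (t - PI) PI ltac:(lra) ltac:(lra)). unfold lift_inc in E.
    replace (PI + (t - PI)) with t in E by ring. unfold g, k.
    replace (phi t - t - (phi PI - PI)) with 0 by lra. rring. }
  intros t.
  assert (Hz : g t = 0).
  { apply (RInt_zero_nonneg g (t - PI) (t - PI + 2 * PI)); auto; try lra.
    - intros; apply Rle_0_sqr.
    - rewrite (RInt_period g (t - PI) 0); auto. lra. }
  unfold g in Hz. apply Rmult_integral in Hz. lra.
Qed.

Lemma w_bounded : exists L, forall t, - PI <= t <= 3 * PI -> Rabs (w t) <= L.
Proof.
  destruct (continuity_ab_maj (fun t => Rabs (w t)) (- PI) (3 * PI)) as [x [Hx _]].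
  - generalize PI_RGT_0; lra.
  - intros c _. apply continuity_pt_filterlim.
    apply (continuous_R_comp Rabs w); [apply (cl_cont _ _ Hphi)|apply continuous_Rabs].
  - now exists (Rabs (w x)).
Qed.

(** [Rabs (lift_inc a t) <= L * Rabs a], so [lift_cos] drops below [2 * PI] at most quadratically,
    and [cos a <= 1]. The bound is in [sin (a / 2) ^ 2] in order to cancel [pois_den]; [32] is half
    of the [64] in [sqr_le_sin_half]. *)
Lemma lift_cos_ge : exists C, 0 <= C /\ forall a, - PI < a < PI ->
  - (C * sin (a / 2) ^ 2) <= lift_cos a - 2 * PI * cos a.
Proof.
  destruct w_bounded as [L HL]. assert (Hpi := PI_RGT_0).
  assert (HL0 : 0 <= L) by (eapply Rle_trans; [apply Rabs_pos|apply (HL 0); lra]).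
  exists (2 * PI * (32 * L ^ 2)).
  split; [apply Rmult_le_pos; [lra|]; generalize (pow2_ge_0 L); lra|].
  intros a Ha.
  assert (Hinc : forall t, 0 < t < 2 * PI -> lift_inc a t ^ 2 <= 64 * L ^ 2 * sin (a / 2) ^ 2).
  { intros t Ht. destruct (MVT_gen phi t (t + a) w) as [c [Hc E]].
    - intros; apply (cl_derive _ _ Hphi).
    - intros; apply continuity_pt_filterlim, continuous_phi.
    - assert (Hcb : - PI <= c <= 3 * PI).
      { unfold Rmin, Rmax in Hc. destruct (Rle_dec t (t + a)); lra. }
      unfold lift_inc. rewrite E. replace (t + a - t) with a by ring.
      assert (Hw : w c ^ 2 <= L ^ 2).
      { generalize (HL c Hcb) (Rabs_pos (w c)). intros.
        rewrite <- (pow2_abs (w c)). apply pow_incr. lra. }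
      rewrite Rpow_mult_distr. generalize (sqr_le_sin_half a ltac:(lra)).
      generalize (pow2_ge_0 (w c)) (pow2_ge_0 a) (pow2_ge_0 (sin (a / 2))). intros.
      apply Rle_trans with (L ^ 2 * a ^ 2).
      + apply Rmult_le_compat_r; auto.
      + replace (64 * L ^ 2 * sin (a / 2) ^ 2) with (L ^ 2 * (64 * sin (a / 2) ^ 2)) by ring.
        apply Rmult_le_compat_l; [apply pow2_ge_0|auto]. }
  assert (H : RInt (fun _ => 1 - 32 * L ^ 2 * sin (a / 2) ^ 2) 0 (2 * PI) <= lift_cos a).
  { apply RInt_le_cont; [lra|intros; cont1|apply continuous_cos_inc|].
    intros t Ht. rewrite (cos_double_half (lift_inc a t)).
    assert (Hs : sin (lift_inc a t / 2) ^ 2 <= (lift_inc a t / 2) ^ 2).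
    { rewrite <- (pow2_abs (sin _)), <- (pow2_abs (lift_inc a t / 2)).
      apply pow_incr. split; [apply Rabs_pos|apply abs_sin_le]. }
    generalize (Hinc t Ht). nra. }
  rewrite RInt_const_R in H. generalize (COS_bound a). nra.
Qed.

(* After an integration by parts, and after subtraction of the same identity for the identity map of
   the circle, the integrand is a positive multiple of the
   nonnegative [lift_defect] plus a term that is negligible as [r] tends to 1. *)
Lemma pois_lift_identity (r : R) : 0 < r < 1 ->
  RInt (fun a => pois r a * RInt (fun t => (w t - 1) * cos (lift_inc a t)) 0 (2 * PI)) (- PI) PI =
  - RInt (fun a => pois r a / pois_den r a *
      ((1 - r) ^ 2 * (lift_cos a - 2 * PI * cos a) + 4 * r * lift_defect a)) (- PI) PI.
Proof.
  intros Hr. assert (Cw := cl_cont _ _ Hphi). assert (Hpi := PI_RGT_0).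
  assert (CP : forall s, continuous (pois r) s)
    by (intros; apply continuous_slice_r, continuity_pois; lra).
  assert (CPt : forall s, continuous (pois_t r) s)
    by (intros; apply continuous_slice_r, continuity_pois; lra).
  assert (HD : forall s, 0 < pois_den r s) by (intros; apply pois_den_pos; lra).
  set (q' := fun a => RInt (fun t => w t * cos (lift_inc a t)) 0 (2 * PI)).
  assert (Cq' : forall a, continuous q' a).
  { intros a. apply (continuous_RInt_param (fun a t => w t * cos (lift_inc a t)) (a - 1) (a + 1)); try lra.
    intros; cont2; [apply (continuity_2d_pt_snd w); auto|apply continuity_lift_inc]. }
  assert (Cc := continuous_lift_cos). assert (Cs := continuous_lift_sin).
  (* For the identity map both [q'] and [lift_cos] equal [2 * PI * cos a]. Subtracting it from each
     leaves the difference unchanged and makes the error [lift_cos a - 2 * PI * cos a] small at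
     [a = 0]. *)
  rewrite (RInt_cont_ext _ (fun a => pois r a * (q' a - 2 * PI * cos a)
     - pois r a * (lift_cos a - 2 * PI * cos a))).
  2: { intros a. rewrite <- Rmult_minus_distr_l. apply Rmult_eq_compat_l.
       rewrite (RInt_cont_ext _ (fun t => w t * cos (lift_inc a t) - cos (lift_inc a t)))
         by (intros; rring).
       rewrite RInt_minus_cont by (intros; cont1; auto; apply continuous_lift_inc).
       unfold q', lift_cos. rring. }
  rewrite RInt_minus_cont by (intros; cont1; auto).
  assert (HP : RInt (fun a => pois r a * (q' a - 2 * PI * cos a)) (- PI) (- PI + 2 * PI) =
     - RInt (fun a => pois_t r a * (lift_sin a - 2 * PI * sin a)) (- PI) (- PI + 2 * PI)).
  { apply RInt_by_parts_period; auto.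
    - intros; apply is_derive_pois_t; lra.
    - intros a. apply (is_derive_R_minus lift_sin (fun a => 2 * PI * sin a)).
      + apply is_derive_lift_sin.
      + apply is_derive_R_scal, is_derive_sin.
    - intros; cont1; auto.
    - intros; unfold pois, pois_den; now rewrite cos_per.
    - intros; now rewrite lift_sin_per, sin_per. }
  rewrite <- PI_period in HP. rewrite HP.
  rewrite (RInt_cont_ext (fun a => pois r a / pois_den r a *
      ((1 - r) ^ 2 * (lift_cos a - 2 * PI * cos a) + 4 * r * lift_defect a))
    (fun a => pois_t r a * (lift_sin a - 2 * PI * sin a)
      + pois r a * (lift_cos a - 2 * PI * cos a))).
  - rewrite RInt_plus_cont by (intros; cont1; auto). rring.
  - intros a. unfold pois, pois_t, lift_defect.
    set (s := sin (a / 2)). set (c := cos (a / 2)).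
    replace (sin a) with (2 * s * c).
    2: { unfold s, c. rewrite <- sin_2a. f_equal. field. }
    assert (Hd := pois_den_half r a). fold s in Hd.
    rewrite (cos_double_half a). fold s.
    assert (Hc2 : c ^ 2 = 1 - s ^ 2)
      by (unfold s, c; generalize (sin2_cos2 (a / 2)); unfold Rsqr; lra).
    (* The split of [pois_den] into [(1 - r) ^ 2] and [4 * r * s ^ 2] is what separates the error
       term from [lift_defect]. *)
    replace ((1 - r) ^ 2) with (pois_den r a - 4 * r * s ^ 2) by lra.
    generalize (HD a). generalize (pois_den r a). intros d Hd0.
    apply Rmult_eq_reg_r with (d ^ 2); [|apply pow_nonzero; lra].
    field_simplify; try lra.
    rewrite Hc2. ring.
Qed.

(** For [r > 1 / 2], [sin (a / 2) ^ 2 / pois_den r a <= 1 / (4 * r) <= 1 / 2] controls the error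
    term, and [pois_den <= 4] with [(1 + r) * (4 * r) >= 2] bounds the weight of [lift_defect] below
    by [(1 - r) / 8]. The factor [1 - r] is the step of the difference quotient in
    [boundary_gap]. *)
Lemma pois_lift_bound : exists C, 0 <= C /\ forall r, 1 / 2 < r < 1 ->
  RInt (fun a => pois r a * RInt (fun t => (w t - 1) * cos (lift_inc a t)) 0 (2 * PI)) (- PI) PI
  <= (1 - r) * (C * (1 - r) - RInt lift_defect (- PI) PI / 8).
Proof.
  destruct lift_cos_ge as (C & HC & HCa). assert (Hpi := PI_RGT_0).
  exists (C * PI). split; [apply Rmult_le_pos; lra|].
  intros r Hr. rewrite pois_lift_identity by lra.
  assert (CP : forall s, continuous (pois r) s)
    by (intros; apply continuous_slice_r, continuity_pois; lra).
  assert (CD : forall s, continuous (pois_den r) s)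
    by (intros; apply continuous_slice_r, continuity_pois_den).
  assert (HD : forall s, 0 < pois_den r s) by (intros; apply pois_den_pos; lra).
  assert (HDn : forall s, pois_den r s <> 0) by (intros s; generalize (HD s); lra).
  assert (Cc := continuous_lift_cos). assert (Cdf := continuous_lift_defect).
  assert (H : RInt (fun a => - ((1 - r) ^ 2 * (C / 2)) * pois r a
      + (1 - r) / 8 * lift_defect a) (- PI) PI <=
    RInt (fun a => pois r a / pois_den r a *
      ((1 - r) ^ 2 * (lift_cos a - 2 * PI * cos a) + 4 * r * lift_defect a)) (- PI) PI).
  { apply RInt_le_cont; [lra|intros; cont1; auto|intros; cont1; auto|].
    intros a Ha.
    assert (Hp := pois_pos r a ltac:(lra)).
    assert (Hs : sin (a / 2) ^ 2 / pois_den r a <= / 2).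
    { apply Rle_div_l; [apply HD|]. rewrite pois_den_half.
      generalize (pow2_ge_0 (1 - r)) (pow2_ge_0 (sin (a / 2))). nra. }
    assert (Hd4 : pois_den r a <= 4).
    { unfold pois_den. generalize (COS_bound a). nra. }
    assert (E := lift_defect_ge_0 a Ha).
    rewrite Rmult_plus_distr_l. apply Rplus_le_compat.
    - apply Rle_trans with (pois r a / pois_den r a * ((1 - r) ^ 2 * - (C * sin (a / 2) ^ 2))).
      + replace (pois r a / pois_den r a * ((1 - r) ^ 2 * - (C * sin (a / 2) ^ 2)))
          with (- (((1 - r) ^ 2 * C * pois r a) * (sin (a / 2) ^ 2 / pois_den r a))) by (field; auto).
        assert (0 <= (1 - r) ^ 2 * C * pois r a).
        { apply Rmult_le_pos; [|lra]. apply Rmult_le_pos; [apply pow2_ge_0|lra]. }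
        nra.
      + apply Rmult_le_compat_l; [apply Rlt_le, Rdiv_lt_0_compat; auto|].
        apply Rmult_le_compat_l; [apply pow2_ge_0|auto].
    - replace (pois r a / pois_den r a * (4 * r * lift_defect a))
        with ((1 - r ^ 2) * (4 * r) / (pois_den r a ^ 2) * lift_defect a)
        by (unfold pois; field; auto).
      apply Rmult_le_compat_r; auto.
      apply (Rle_div_r ((1 - r) / 8) _ (pois_den r a ^ 2)); [apply pow_lt; auto|].
      apply Rle_trans with ((1 - r) / 8 * 16).
      + apply Rmult_le_compat_l; [lra|]. replace 16 with (4 ^ 2) by ring.
        apply pow_incr. generalize (HD a); lra.
      + replace ((1 - r ^ 2) * (4 * r)) with ((1 - r) * ((1 + r) * (4 * r))) by ring.
        replace ((1 - r) / 8 * 16) with ((1 - r) * 2) by field.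
        apply Rmult_le_compat_l; nra. }
  rewrite RInt_plus_cont, !RInt_scal_cont, RInt_pois in H by (try (intros; cont1; auto); lra).
  lra.
Qed.

End CircleLift.

(** * Harmonic maps with boundary values [exp (i phi)] *)

Section PolarMap.

Variables U Ur Ut V Vr Vt : R -> R -> R.
Variables phi w : R -> R.
Variable m : R.
Hypothesis HU : polar_harmonic U Ur Ut.
Hypothesis HV : polar_harmonic V Vr Vt.
Hypothesis HmU : forall r t, Rabs (U r t) <= m.
Hypothesis HmV : forall r t, Rabs (V r t) <= m.
Hypothesis Hphi : circle_lift phi w.
Hypothesis HU1 : forall s, U 1 s = cos (phi s).
Hypothesis HV1 : forall s, V 1 s = sin (phi s).

Lemma boundary_Ut (t : R) : Ut 1 t = - (w t * sin (phi t)).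
Proof.
  rewrite <- (is_derive_unique _ _ _ (is_derive_boundary U Ur Ut t HU)).
  apply is_derive_unique. apply is_derive_ext with (fun t => cos (phi t)); [intros; symmetry; auto|].
  eapply is_derive_eq.
  - apply (is_derive_R_comp cos phi); [apply (cl_derive _ _ Hphi)|apply is_derive_cos].
  - ring.
Qed.

Lemma boundary_Vt (t : R) : Vt 1 t = w t * cos (phi t).
Proof.
  rewrite <- (is_derive_unique _ _ _ (is_derive_boundary V Vr Vt t HV)).
  apply is_derive_unique. apply is_derive_ext with (fun t => sin (phi t)); [intros; symmetry; auto|].
  apply (is_derive_R_comp sin phi); [apply (cl_derive _ _ Hphi)|apply is_derive_sin].
Qed.

(** By parts, the integral of [U * Vt] equals that of [- Ut * V]; their sum is the integral of [w],
    the increment [2 * PI] of the lift. *)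
Lemma boundary_area : RInt (fun t => U 1 t * Vt 1 t) 0 (2 * PI) = PI.
Proof.
  assert (CU : forall t, continuous (U 1) t) by (intros; apply continuous_slice_r, HU).
  assert (CUt : forall t, continuous (Ut 1) t) by (intros; apply continuous_slice_r, HU).
  assert (CV : forall t, continuous (V 1) t) by (intros; apply continuous_slice_r, HV).
  assert (CVt : forall t, continuous (Vt 1) t) by (intros; apply continuous_slice_r, HV).
  assert (HP : RInt (fun t => U 1 t * Vt 1 t) 0 (0 + 2 * PI) =
     - RInt (fun t => Ut 1 t * V 1 t) 0 (0 + 2 * PI)).
  { apply RInt_by_parts_period; auto; try apply HU; try apply HV; auto.
    - intros; now apply is_derive_boundary with Ur.
    - intros; now apply is_derive_boundary with Vr. }
  rewrite Rplus_0_l in HP.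
  assert (HW := RInt_w phi w Hphi).
  rewrite (RInt_cont_ext w (fun t => U 1 t * Vt 1 t - Ut 1 t * V 1 t)) in HW.
  - rewrite RInt_minus_cont in HW by (intros; cont1; auto). lra.
  - intros t. rewrite boundary_Ut, boundary_Vt, HU1, HV1.
    replace (cos (phi t) * (w t * cos (phi t)) - - (w t * sin (phi t)) * sin (phi t))
      with (w t * (Rsqr (sin (phi t)) + Rsqr (cos (phi t)))) by (unfold Rsqr; ring).
    rewrite sin2_cos2. ring.
Qed.

(** The function [K] of the overview. *)
Definition radial_pairing (r : R) : R :=
  RInt (fun t => (w t - 1) * (U r t * cos (phi t) + V r t * sin (phi t))) 0 (2 * PI).
Definition radial_pairing' (r : R) : R :=
  RInt (fun t => (w t - 1) * (Ur r t * cos (phi t) + Vr r t * sin (phi t))) 0 (2 * PI).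

Lemma continuity_phi_snd (r t : R) : continuity_2d_pt (fun _ t => phi t) r t.
Proof. apply (continuity_2d_pt_snd phi), (cl_continuous _ _ _ Hphi). Qed.

Lemma continuity_w_snd (r t : R) : continuity_2d_pt (fun _ t => w t) r t.
Proof. apply (continuity_2d_pt_snd w), (cl_cont _ _ Hphi). Qed.

Lemma continuous_radial_pairing (r : R) : continuous radial_pairing r.
Proof.
  apply (continuous_RInt_param (fun r t => (w t - 1) * (U r t * cos (phi t) + V r t * sin (phi t)))
    (r - 1) (r + 1)); try lra; [generalize PI_RGT_0; lra|].
  intros y t _. cont2; try apply HU; try apply HV; try apply continuity_w_snd; apply continuity_phi_snd.
Qed.

Lemma continuous_radial_pairing' (r : R) : continuous radial_pairing' r.
Proof.
  apply (continuous_RInt_param (fun r t => (w t - 1) * (Ur r t * cos (phi t) + Vr r t * sin (phi t)))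
    (r - 1) (r + 1)); try lra; [generalize PI_RGT_0; lra|].
  intros y t _. cont2; try apply HU; try apply HV; try apply continuity_w_snd; apply continuity_phi_snd.
Qed.

Lemma is_derive_radial_pairing (r : R) : 0 < r < 1 ->
  is_derive radial_pairing r (radial_pairing' r).
Proof.
  intros Hr.
  apply (is_derive_RInt_param_strip
    (fun r t => (w t - 1) * (U r t * cos (phi t) + V r t * sin (phi t)))
    (fun r t => (w t - 1) * (Ur r t * cos (phi t) + Vr r t * sin (phi t))) 0 1); auto.
  - intros y t Hy. apply is_derive_R_scal.
    apply is_derive_ext with (fun r => cos (phi t) * U r t + sin (phi t) * V r t); [intros; rring|].
    rewrite (Rmult_comm (Ur y t)), (Rmult_comm (Vr y t)).
    apply is_derive_R_plus; apply is_derive_R_scal; [now apply HU|now apply HV].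
  - intros y t _. cont2; try apply HU; try apply HV; try apply continuity_w_snd; apply continuity_phi_snd.
  - intros y t _. cont1; try apply (continuous_slice_r U); try apply (continuous_slice_r V); try apply HU; try apply HV;
      try apply (cl_cont _ _ Hphi); apply (cl_continuous _ _ _ Hphi).
Qed.

Lemma radial_pairing_1 : radial_pairing 1 = 0.
Proof.
  unfold radial_pairing. rewrite (RInt_cont_ext _ (fun t => w t - 1)).
  - rewrite RInt_minus_cont, (RInt_w phi w Hphi), RInt_const_R.
    + rring.
    + apply (cl_cont _ _ Hphi).
    + intros; cont1.
  - intros t. rewrite HU1, HV1.
    replace (cos (phi t) * cos (phi t) + sin (phi t) * sin (phi t)) with
      (Rsqr (sin (phi t)) + Rsqr (cos (phi t))) by (unfold Rsqr; ring).
    rewrite sin2_cos2. ring.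
Qed.

(** Poisson formula in [a] and Fubini, since [cos (lift_inc phi a t)] is the scalar product of the
    boundary values at [t + a] and [t]. *)
Lemma radial_pairing_pois (r : R) : 0 < r < 1 ->
  2 * PI * radial_pairing r =
  RInt (fun a => pois r a * RInt (fun t => (w t - 1) * cos (lift_inc phi a t)) 0 (2 * PI)) (- PI) PI.
Proof.
  intros Hr. assert (Hpi := PI_RGT_0).
  assert (Cw := cl_cont _ _ Hphi).
  assert (Cp : forall t, continuous phi t) by (intros; apply (cl_continuous _ _ _ Hphi)).
  assert (Cinc : forall a t, continuous (fun t => lift_inc phi a t) t)
    by (intros; now apply continuous_lift_inc with w).
  assert (CP : forall s, continuous (pois r) s)
    by (intros; apply continuous_slice_r, continuity_pois; lra).
  rewrite (RInt_cont_ext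
    (fun a => pois r a * RInt (fun t => (w t - 1) * cos (lift_inc phi a t)) 0 (2 * PI))
    (fun a => RInt (fun t => pois r a * ((w t - 1) * cos (lift_inc phi a t))) 0 (2 * PI))).
  2: { intros a. symmetry. apply RInt_scal_cont. intros; cont1; auto. }
  rewrite RInt_swap.
  - unfold radial_pairing. rewrite <- RInt_scal_cont.
    2: { intros t. cont1; auto; [apply (continuous_slice_r U), HU|apply (continuous_slice_r V), HV]. }
    apply RInt_cont_ext. intros t.
    assert (Cs : forall F : R -> R -> R, (forall r t, continuity_2d_pt F r t) ->
       forall s, continuous (fun s => F 1 (s + t)) s).
    { intros F HF s. apply (continuous_R_comp (F 1) (fun s => s + t)); [cont1|now apply continuous_slice_r]. }
    assert (CsU := Cs U (ph_cont _ _ _ HU)). assert (CsV := Cs V (ph_cont _ _ _ HV)).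
    rewrite (RInt_cont_ext _ (fun s => (w t - 1) * cos (phi t) * (pois r s * U 1 (s + t))
       + (w t - 1) * sin (phi t) * (pois r s * V 1 (s + t)))).
    + rewrite RInt_plus_cont, !RInt_scal_cont by (intros; cont1; auto).
      rewrite (poisson_formula_punctured U Ur Ut m), (poisson_formula_punctured V Vr Vt m) by auto. rring.
    + intros s. unfold lift_inc. rewrite HU1, HV1, (Rplus_comm s t), cos_minus. rring.
  - lra.
  - lra.
  - intros x y. cont2.
    + apply (continuity_2d_pt_fst (pois r)); auto.
    + apply continuity_w_snd.
    + apply continuity_lift_inc with w; auto.
Qed.

Definition boundary_jacobian (t : R) : R := Ur 1 t * Vt 1 t - Ut 1 t * Vr 1 t.

(** Write [K] for [radial_pairing] and [D] for the integral of [lift_defect]. The mean value theorem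
    on [[1 - h, 1]] gives [K (1 - h) = - h * K' c], so [pois_lift_bound] yields
    [2 * PI * K' c >= D / 8 - C * h]; then [h] tends to zero. *)
Lemma boundary_gap :
  RInt (lift_defect phi) (- PI) PI / (16 * PI) <=
  RInt boundary_jacobian 0 (2 * PI)
    - (RInt (fun t => U 1 t * Ur 1 t) 0 (2 * PI) + RInt (fun t => V 1 t * Vr 1 t) 0 (2 * PI)).
Proof.
  assert (Hpi := PI_RGT_0).
  assert (Cw := cl_cont _ _ Hphi).
  assert (Cp : forall t, continuous phi t) by (intros; apply (cl_continuous _ _ _ Hphi)).
  assert (CUr : forall t, continuous (Ur 1) t) by (intros; apply continuous_slice_r, HU).
  assert (CVr : forall t, continuous (Vr 1) t) by (intros; apply continuous_slice_r, HV).
  replace (RInt boundary_jacobian 0 (2 * PI)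
    - (RInt (fun t => U 1 t * Ur 1 t) 0 (2 * PI) + RInt (fun t => V 1 t * Vr 1 t) 0 (2 * PI)))
    with (radial_pairing' 1).
  - destruct (pois_lift_bound phi w Hphi) as (C & HC & Hb).
    set (D := RInt (lift_defect phi) (- PI) PI).
    change (RInt (lift_defect phi) (- PI) PI) with D in Hb.
    apply Rnot_lt_le. intros Hlt.
    assert (HD : 2 * PI * (D / (16 * PI)) = D / 8) by (field; lra).
    (* Of the slack [e], the drift of [radial_pairing'] will take one half and the error [C * h] one
       quarter. *)
    set (e := (D / 8 - 2 * PI * radial_pairing' 1)).
    assert (He : 0 < e).
    { unfold e. rewrite <- HD, <- Rmult_minus_distr_l. apply Rmult_lt_0_compat; lra. }
    set (x0 := e / (4 * PI)).
    assert (Hx0 : 0 < x0) by (apply Rdiv_lt_0_compat; lra).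
    assert (Hc := continuous_radial_pairing' 1). apply continuity_pt_filterlim in Hc.
    destruct (Hc x0 Hx0) as [d [Hd Hcd]]. simpl in Hcd. unfold R_dist in Hcd.
    set (h := Rmin (Rmin d 1 / 4) (e / (4 * (C + 1)))).
    assert (Hh : 0 < h /\ h < d /\ h < 1 / 2 /\ C * h <= e / 4).
    { assert (H1 : 0 < Rmin d 1) by (apply Rmin_pos; lra).
      assert (H2 : 0 < e / (4 * (C + 1))) by (apply Rdiv_lt_0_compat; lra).
      assert (H3 : 0 < h) by (apply Rmin_pos; lra).
      assert (H4 : h <= Rmin d 1 / 4) by apply Rmin_l.
      assert (H5 : h <= e / (4 * (C + 1))) by apply Rmin_r.
      generalize (Rmin_l d 1) (Rmin_r d 1). intros.
      apply (Rle_div_r h e (4 * (C + 1))) in H5; [|lra].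
      repeat split; nra. }
    destruct Hh as (Hh0 & Hhd & Hh1 & HhC).
    destruct (MVT_gen radial_pairing (1 - h) 1 radial_pairing') as [c [Hc' E]].
    + intros x Hx. rewrite Rmin_left, Rmax_right in Hx by lra.
      apply is_derive_radial_pairing. lra.
    + intros x _. apply continuity_pt_filterlim, continuous_radial_pairing.
    + rewrite Rmin_left, Rmax_right in Hc' by lra.
      rewrite radial_pairing_1 in E. replace (1 - (1 - h)) with h in E by ring.
      assert (Hpo := Hb (1 - h) ltac:(lra)).
      rewrite <- radial_pairing_pois in Hpo by lra.
      replace (1 - (1 - h)) with h in Hpo by ring.
      assert (Hk : 2 * PI * radial_pairing (1 - h) = - (h * (2 * PI * radial_pairing' c))).
      { replace (radial_pairing (1 - h)) with (- (radial_pairing' c * h)) by lra. ring. }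
      rewrite Hk in Hpo.
      assert (Hpo' : D / 8 - C * h <= 2 * PI * radial_pairing' c).
      { apply Rmult_le_reg_l with h; auto. lra. }
      (* [c] may be [1] itself, a point that the limit hypothesis leaves out. *)
      assert (Hclose : Rabs (radial_pairing' c - radial_pairing' 1) < x0 \/ c = 1).
      { destruct (Req_dec c 1); [now right|left]. apply Hcd.
        split; [split; [exact I|auto]|]. rewrite Rabs_left1; lra. }
      assert (radial_pairing' c - radial_pairing' 1 < x0).
      { destruct Hclose as [Ha | ->]; [apply Rabs_lt_between in Ha; lra|lra]. }
      assert (2 * PI * (radial_pairing' c - radial_pairing' 1) < 2 * PI * x0)
        by (apply Rmult_lt_compat_l; lra).
      replace (2 * PI * x0) with (e / 2) in * by (unfold x0; field; lra).
      unfold e in *. lra.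
  - unfold radial_pairing'.
    rewrite (RInt_cont_ext _ (fun t => boundary_jacobian t - (U 1 t * Ur 1 t + V 1 t * Vr 1 t))).
    + assert (CU : forall t, continuous (U 1) t) by (intros; apply continuous_slice_r, HU).
      assert (CV : forall t, continuous (V 1) t) by (intros; apply continuous_slice_r, HV).
      assert (CUt : forall t, continuous (Ut 1) t) by (intros; apply continuous_slice_r, HU).
      assert (CVt : forall t, continuous (Vt 1) t) by (intros; apply continuous_slice_r, HV).
      rewrite RInt_minus_cont, RInt_plus_cont; auto; intros; unfold boundary_jacobian; cont1; auto.
    + intros t. unfold boundary_jacobian. rewrite boundary_Ut, boundary_Vt, HU1, HV1. rring.
Qed.

(** A negative sign inside would make the area integral nonpositive. On the circle the Jacobian may
    vanish, and its sign is a limit from inside. *)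
Lemma jacobian_nonneg (j : R -> R) (r t : R) :
  (forall r, continuous j r) ->
  (forall r, 0 < r < 1 -> j r = RInt (fun t => Ur r t * Vt r t - Ut r t * Vr r t) 0 (2 * PI)) ->
  0 < RInt j 0 1 -> 0 < r <= 1 -> 0 <= Ur r t * Vt r t - Ut r t * Vr r t.
Proof.
  intros Hj Hjr Hpos Hr. assert (Hpi := PI_RGT_0).
  set (J := fun r t => Ur r t * Vt r t - Ut r t * Vr r t).
  assert (CJ : forall r t, continuity_2d_pt J r t)
    by (intros; unfold J; cont2; try apply HU; apply HV).
  assert (HJ : forall r t, 0 < r < 1 -> J r t <> 0)
    by (intros; now apply (jacobian_nonzero U Ur Ut V Vr Vt phi w m)).
  assert (Hint : forall r t, 0 < r < 1 -> 0 < J r t).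
  { intros x s Hx. apply Rnot_le_lt. intros Hle.
    assert (Hneg : forall y u, 0 < y < 1 -> J y u < 0).
    { intros y u Hy. apply Rnot_le_lt. intros [Hp|H0].
      - generalize (jacobian_sign J y u x s CJ HJ Hy Hx Hp). lra.
      - now apply (HJ y u Hy). }
    apply Rlt_not_le with (1 := Hpos).
    apply Rle_trans with (RInt (fun _ => 0) 0 1); [|rewrite RInt_const_R; lra].
    apply RInt_le_cont; auto; [lra|intros; cont1|].
    intros y Hy. rewrite Hjr by auto.
    apply Rle_trans with (RInt (fun _ => 0) 0 (2 * PI)); [|rewrite RInt_const_R; lra].
    apply RInt_le_cont; [lra|intros; now apply continuous_slice_r with (f := J)|intros; cont1|].
    intros u _. apply Rlt_le, Hneg. lra. }
  change (0 <= J r t).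
  destruct (proj2 Hr) as [Hlt | ->]; [apply Rlt_le, Hint; lra|].
  apply (continuous_left_ge (fun r => J r t)).
  - now apply (continuous_slice_l J).
  - intros; now apply Rlt_le, Hint.
Qed.

End PolarMap.

(** * From Cartesian to polar coordinates *)

Lemma cont_on_comp (S : R -> R -> Prop) (G X Y : R -> R -> R) (a b : R) :
  cont_on S G -> continuity_2d_pt X a b -> continuity_2d_pt Y a b -> S (X a b) (Y a b) ->
  locally_2d (fun c d => S (X c d) (Y c d)) a b ->
  continuity_2d_pt (fun c d => G (X c d) (Y c d)) a b.
Proof.
  intros HG HX HY HS [d0 H0] eps.
  destruct (HG _ _ HS eps (cond_pos eps)) as (d & Hd & H).
  (* [continuity_2d_pt] uses boxes and [cont_on] uses discs: a box of half-side [d / 2] lies in the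
     disc of radius [d]. *)
  assert (Hd2 : 0 < d / 2) by lra.
  destruct (HX (mkposreal _ Hd2)) as [d1 H1]. destruct (HY (mkposreal _ Hd2)) as [d2 H2].
  simpl in H1, H2.
  exists (mkposreal _ (Rmin_stable_in_posreal d0 (mkposreal _ (Rmin_stable_in_posreal d1 d2)))).
  simpl. intros x y Hx Hy.
  assert (L0 := Rmin_l d0 (Rmin d1 d2)). assert (L1 := Rmin_r d0 (Rmin d1 d2)).
  assert (L2 := Rmin_l d1 d2). assert (L3 := Rmin_r d1 d2).
  apply H; [apply H0; lra|].
  assert (E1 := H1 x y ltac:(lra) ltac:(lra)). assert (E2 := H2 x y ltac:(lra) ltac:(lra)).
  apply Rabs_lt_between in E1, E2. nra.
Qed.

Definition pol (G : R -> R -> R) (r t : R) : R := G (clamp r * cos t) (clamp r * sin t).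

Lemma polar_norm (r t : R) : (r * cos t) ^ 2 + (r * sin t) ^ 2 = r ^ 2.
Proof.
  replace ((r * cos t) ^ 2 + (r * sin t) ^ 2) with (r ^ 2 * (Rsqr (sin t) + Rsqr (cos t)))
    by (unfold Rsqr; ring).
  rewrite sin2_cos2. ring.
Qed.

Lemma continuity_clamp_cos (r t : R) : continuity_2d_pt (fun r t => clamp r * cos t) r t.
Proof. cont2. apply (continuity_2d_pt_fst clamp), continuous_clamp. Qed.

Lemma continuity_clamp_sin (r t : R) : continuity_2d_pt (fun r t => clamp r * sin t) r t.
Proof. cont2. apply (continuity_2d_pt_fst clamp), continuous_clamp. Qed.

Lemma continuity_clamp (r t : R) : continuity_2d_pt (fun r _ => clamp r) r t.
Proof. apply (continuity_2d_pt_fst clamp), continuous_clamp. Qed.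

Lemma closed_disk_clamp (r t : R) : closed_disk (clamp r * cos t) (clamp r * sin t).
Proof. unfold closed_disk. rewrite polar_norm. generalize (clamp_bound r). nra. Qed.

Lemma open_disk_polar (r t : R) : 0 <= r < 1 -> open_disk (r * cos t) (r * sin t).
Proof. intros Hr. unfold open_disk. rewrite polar_norm. nra. Qed.

Lemma continuity_pol (G : R -> R -> R) (r t : R) :
  cont_on closed_disk G -> continuity_2d_pt (pol G) r t.
Proof.
  intros HG. apply (cont_on_comp closed_disk G (fun r t => clamp r * cos t) (fun r t => clamp r * sin t));
    auto using continuity_clamp_cos, continuity_clamp_sin, closed_disk_clamp.
  apply locally_2d_forall. intros; apply closed_disk_clamp.
Qed.

Lemma open_disk_open (x y : R) : open_disk x y -> locally_2d open_disk x y.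
Proof.
  intros H.
  assert (C : continuity_2d_pt (fun x y => x ^ 2 + y ^ 2) x y) by cont2.
  assert (He : 0 < 1 - (x ^ 2 + y ^ 2)) by (unfold open_disk in H; lra).
  destruct (C (mkposreal _ He)) as [d Hd]. simpl in Hd.
  exists d. intros u v Hu Hv. generalize (Hd u v Hu Hv). intros E.
  apply Rabs_lt_between in E. unfold open_disk. simpl in *. lra.
Qed.

Lemma continuity_open_disk (G : R -> R -> R) (x y : R) :
  cont_on open_disk G -> open_disk x y -> continuity_2d_pt G x y.
Proof.
  intros HG H.
  apply (cont_on_comp open_disk G (fun x _ => x) (fun _ y => y)); auto; [cont2|cont2|].
  now apply open_disk_open.
Qed.

Lemma continuity_pol_open (G : R -> R -> R) (r t : R) :
  cont_on open_disk G -> 0 < r < 1 -> continuity_2d_pt (pol G) r t.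
Proof.
  intros HG Hr.
  apply (continuity_2d_pt_comp G (fun r t => clamp r * cos t) (fun r t => clamp r * sin t));
    auto using continuity_clamp_cos, continuity_clamp_sin.
  apply continuity_open_disk; auto. rewrite clamp_id by lra. apply open_disk_polar. lra.
Qed.

Definition partials_in_disk (F Fx Fy : R -> R -> R) : Prop :=
  forall x y, open_disk x y -> partial_x F Fx x y /\ partial_y F Fy x y.

Lemma differentiable_in_disk (F Fx Fy : R -> R -> R) (x y : R) :
  partials_in_disk F Fx Fy -> cont_on open_disk Fx -> open_disk x y ->
  differentiable_pt_lim F x y (Fx x y) (Fy x y).
Proof.
  intros HF HC H. apply filterdiff_differentiable_pt_lim.
  eapply filterdiff_ext_lin.
  - apply (is_derive_filterdiff F x y Fx (Fy x y)).
    + assert (HL : locally_2d (fun x y => is_derive (fun z => F z y) x (Fx x y)) x y).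
      { eapply locally_2d_impl; [|apply open_disk_open, H].
        apply locally_2d_forall. intros u v Huv. apply is_derive_Reals, (HF u v Huv). }
      apply locally_2d_locally in HL. exact HL.
    + apply is_derive_Reals, (HF x y H).
    + apply (proj1 (continuity_2d_pt_filterlim Fx x y)). now apply continuity_open_disk.
  - intros [a b]. reflexivity.
Qed.

Lemma is_derive_polar (F Fx Fy : R -> R -> R) (r t : R) :
  partials_in_disk F Fx Fy -> cont_on open_disk Fx -> 0 < r < 1 ->
  is_derive (fun r => pol F r t) r (pol Fx r t * cos t + pol Fy r t * sin t) /\
  is_derive (pol F r) t (r * (pol Fy r t * cos t - pol Fx r t * sin t)).
Proof.
  intros HF HC Hr. unfold pol. rewrite (clamp_id r) by lra.
  assert (HD := differentiable_in_disk F Fx Fy _ _ HF HC (open_disk_polar r t ltac:(lra))).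
  split.
  - apply (is_derive_clamp (fun r => F (r * cos t) (r * sin t))); auto.
    eapply is_derive_eq.
    + apply is_derive_Reals, (derivable_pt_lim_comp_2d F (fun r => r * cos t) (fun r => r * sin t));
        [exact HD| |]; apply is_derive_Reals; auto_derive; auto; reflexivity.
    + ring.
  - eapply is_derive_eq.
    + apply is_derive_Reals, (derivable_pt_lim_comp_2d F (fun t => r * cos t) (fun t => r * sin t));
        [exact HD| |]; apply is_derive_Reals; auto_derive; auto; reflexivity.
    + ring.
Qed.

(** [harmonic_in_disk] carries the two mixed derivatives as unrelated functions; the polar Laplace
    equation and the polar mixed derivative both rest on their equality. *)
Lemma mixed_partials (F Fx Fy Fxy Fyx : R -> R -> R) (x y : R) :
  partials_in_disk F Fx Fy ->
  (forall x y, open_disk x y -> partial_y Fx Fxy x y /\ partial_x Fy Fyx x y) ->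
  cont_on open_disk Fxy -> cont_on open_disk Fyx -> open_disk x y -> Fxy x y = Fyx x y.
Proof.
  intros HF H2 Cxy Cyx Hxy.
  assert (Hline : forall u v, open_disk u v ->
    locally u (fun z => open_disk z v) /\ locally v (fun z => open_disk u z)).
  { intros u v Huv. destruct (open_disk_open u v Huv) as [d Hd]. split; exists d; intros z Hz;
      apply Hd; try exact Hz; rewrite Rminus_diag, Rabs_R0; apply cond_pos. }
  assert (D1 : forall u v, open_disk u v ->
     is_derive (fun z => Derive (fun t => F z t) v) u (Fyx u v)).
  { intros u v Huv. apply is_derive_ext_loc with (fun z => Fy z v).
    - apply (filter_imp (fun z => open_disk z v)); [|now apply Hline].
      intros z Hz. symmetry. apply is_derive_unique, is_derive_Reals, (HF z v Hz).
    - apply is_derive_Reals, (H2 u v Huv). }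
  assert (D2 : forall u v, open_disk u v ->
     is_derive (fun z => Derive (fun t => F t z) u) v (Fxy u v)).
  { intros u v Huv. apply is_derive_ext_loc with (fun z => Fx u z).
    - apply (filter_imp (fun z => open_disk u z)); [|now apply Hline].
      intros z Hz. symmetry. apply is_derive_unique, is_derive_Reals, (HF u z Hz).
    - apply is_derive_Reals, (H2 u v Huv). }
  assert (HL : forall P : R -> R -> Prop, (forall u v, open_disk u v -> P u v) -> locally_2d P x y).
  { intros P HP. eapply locally_2d_impl; [|apply open_disk_open, Hxy].
    apply locally_2d_forall. exact HP. }
  rewrite <- (is_derive_unique _ _ _ (D1 x y Hxy)), <- (is_derive_unique _ _ _ (D2 x y Hxy)).
  symmetry. apply Schwarz.
  - apply HL. intros u v Huv. split; [|split; [|split]].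
    + exists (Fx u v). apply is_derive_Reals, (HF u v Huv).
    + exists (Fy u v). apply is_derive_Reals, (HF u v Huv).
    + exists (Fyx u v). now apply D1.
    + exists (Fxy u v). now apply D2.
  - apply continuity_2d_pt_ext_loc with Fyx; [|now apply continuity_open_disk].
    apply HL. intros u v Huv. symmetry. now apply is_derive_unique, D1.
  - apply continuity_2d_pt_ext_loc with Fxy; [|now apply continuity_open_disk].
    apply HL. intros u v Huv. symmetry. now apply is_derive_unique, D2.
Qed.

Definition pol_r (Fx Fy : R -> R -> R) (r t : R) : R := pol Fx r t * cos t + pol Fy r t * sin t.
Definition pol_t (Fx Fy : R -> R -> R) (r t : R) : R :=
  clamp r * (pol Fy r t * cos t - pol Fx r t * sin t).

Lemma pol_per (G : R -> R -> R) (r t : R) : pol G r (t + 2 * PI) = pol G r t.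
Proof. unfold pol. now rewrite cos_per, sin_per. Qed.

Lemma cont_on_subset (S T : R -> R -> Prop) (G : R -> R -> R) :
  (forall x y, S x y -> T x y) -> cont_on T G -> cont_on S G.
Proof.
  intros H HG x y Hxy eps He. destruct (HG x y (H _ _ Hxy) eps He) as (d & Hd & HH).
  exists d. split; auto.
Qed.

Lemma open_closed_disk (x y : R) : open_disk x y -> closed_disk x y.
Proof. unfold open_disk, closed_disk. lra. Qed.

Lemma polar_harmonic_pol (F Fx Fy : R -> R -> R) :
  cont_on closed_disk F -> harmonic_in_disk F -> C1_closed_disk F Fx Fy ->
  polar_harmonic (pol F) (pol_r Fx Fy) (pol_t Fx Fy) /\
  exists M, forall r t, 0 < r < 1 ->
    is_derive (fun r => pol_t Fx Fy r t) r (M r t) /\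
    is_derive (pol_r Fx Fy r) t (M r t) /\ continuity_2d_pt M r t.
Proof.
  intros CF (Gx & Gy & Gxx & Gxy & Gyx & Gyy & HG & CGx & CGy & Cxx & Cxy & Cyx & Cyy)
    (HF & CFx & CFy).
  (* Harmonicity and smoothness up to the boundary come with separate first derivatives. They agree
     in the open disk, and the second derivatives are carried over to [Fx] and [Fy], which are
     continuous on the closed disk. *)
  assert (EG : forall x y, open_disk x y -> Gx x y = Fx x y /\ Gy x y = Fy x y).
  { intros x y Hxy. destruct (HG x y Hxy) as (A & B & _). destruct (HF x y Hxy) as (A' & B').
    split; eapply uniqueness_limite; eauto. }
  assert (HL : forall (P : R -> R -> Prop) x y, open_disk x y ->
     (forall u v, open_disk u v -> P u v) -> locally x (fun z => P z y) /\ locally y (fun z => P x z)).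
  { intros P u v Huv HP. destruct (open_disk_open u v Huv) as [d Hd]. split; exists d; intros z Hz;
      apply HP, Hd; try exact Hz; rewrite Rminus_diag, Rabs_R0; apply cond_pos. }
  assert (PX : partials_in_disk Fx Gxx Gxy).
  { intros x y Hxy. destruct (HG x y Hxy) as (_ & _ & A & B & _).
    split; apply is_derive_Reals.
    - apply is_derive_ext_loc with (fun z => Gx z y); [|now apply is_derive_Reals].
      apply (HL (fun u v => Gx u v = Fx u v) x y Hxy). intros; now apply EG.
    - apply is_derive_ext_loc with (fun z => Gx x z); [|now apply is_derive_Reals].
      apply (HL (fun u v => Gx u v = Fx u v) x y Hxy). intros; now apply EG. }
  assert (PY : partials_in_disk Fy Gyx Gyy).
  { intros x y Hxy. destruct (HG x y Hxy) as (_ & _ & _ & _ & A & B & _).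
    split; apply is_derive_Reals.
    - apply is_derive_ext_loc with (fun z => Gy z y); [|now apply is_derive_Reals].
      apply (HL (fun u v => Gy u v = Fy u v) x y Hxy). intros; now apply EG.
    - apply is_derive_ext_loc with (fun z => Gy x z); [|now apply is_derive_Reals].
      apply (HL (fun u v => Gy u v = Fy u v) x y Hxy). intros; now apply EG. }
  assert (OFx : cont_on open_disk Fx) by (eapply cont_on_subset; [apply open_closed_disk|auto]).
  assert (Hmix : forall x y, open_disk x y -> Gxy x y = Gyx x y).
  { intros x y Hxy. apply (mixed_partials F Fx Fy Gxy Gyx); auto.
    intros u v Huv. split; [apply (PX u v Huv)|apply (PY u v Huv)]. }
  assert (Hmixp : forall r t, 0 < r < 1 -> pol Gxy r t = pol Gyx r t).
  { intros r t Hr. apply Hmix. rewrite clamp_id by lra. apply open_disk_polar. lra. }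
  assert (Hlap : forall r t, 0 < r < 1 -> pol Gyy r t = - pol Gxx r t).
  { intros r t Hr. unfold pol. rewrite clamp_id by lra.
    generalize (HG _ _ (open_disk_polar r t ltac:(lra))). intros (_ & _ & _ & _ & _ & _ & E). lra. }
  assert (Dcos : forall t, is_derive cos t (- sin t)) by (intros; apply is_derive_cos).
  assert (Dsin : forall t, is_derive sin t (cos t)) by (intros; apply is_derive_sin).
  assert (Drr : forall r t, 0 < r < 1 -> is_derive (fun r => pol_r Fx Fy r t) r
     ((pol Gxx r t * cos t + pol Gxy r t * sin t) * cos t
       + (pol Gyx r t * cos t + pol Gyy r t * sin t) * sin t)).
  { intros r t Hr.
    destruct (is_derive_polar Fx Gxx Gxy r t PX Cxx Hr) as [A _].
    destruct (is_derive_polar Fy Gyx Gyy r t PY Cyx Hr) as [B _].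
    eapply is_derive_ext; [|eapply is_derive_eq;
      [apply is_derive_R_plus; [exact (is_derive_R_scal _ (cos t) _ _ A)|exact (is_derive_R_scal _ (sin t) _ _ B)]|]].
    - intros z. unfold pol_r. rring.
    - ring. }
  assert (Drt : forall r t, 0 < r < 1 -> is_derive (pol_r Fx Fy r) t
     ((pol Fy r t * cos t - pol Fx r t * sin t)
      + r * ((pol Gxy r t * cos t - pol Gxx r t * sin t) * cos t
         + (pol Gyy r t * cos t - pol Gyx r t * sin t) * sin t))).
  { intros r t Hr.
    destruct (is_derive_polar Fx Gxx Gxy r t PX Cxx Hr) as [_ A].
    destruct (is_derive_polar Fy Gyx Gyy r t PY Cyx Hr) as [_ B].
    eapply is_derive_eq.
    - apply is_derive_R_plus; apply is_derive_R_mult; eauto.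
    - ring. }
  assert (Dtt : forall r t, 0 < r < 1 -> is_derive (pol_t Fx Fy r) t
     (r * (r * ((pol Gyy r t * cos t - pol Gyx r t * sin t) * cos t
         - (pol Gxy r t * cos t - pol Gxx r t * sin t) * sin t)
       - pol Fy r t * sin t - pol Fx r t * cos t))).
  { intros r t Hr.
    destruct (is_derive_polar Fx Gxx Gxy r t PX Cxx Hr) as [_ A].
    destruct (is_derive_polar Fy Gyx Gyy r t PY Cyx Hr) as [_ B].
    eapply is_derive_eq.
    - apply is_derive_R_scal, is_derive_R_minus; apply is_derive_R_mult; eauto.
    - rewrite clamp_id by lra. ring. }
  assert (Dtr : forall r t, 0 < r < 1 -> is_derive (fun r => pol_t Fx Fy r t) r
     ((pol Fy r t * cos t - pol Fx r t * sin t)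
      + r * ((pol Gyx r t * cos t + pol Gyy r t * sin t) * cos t
         - (pol Gxx r t * cos t + pol Gxy r t * sin t) * sin t))).
  { intros r t Hr.
    destruct (is_derive_polar Fx Gxx Gxy r t PX Cxx Hr) as [A _].
    destruct (is_derive_polar Fy Gyx Gyy r t PY Cyx Hr) as [B _].
    eapply is_derive_ext; [|eapply is_derive_eq;
      [apply is_derive_R_mult; [apply (is_derive_clamp (fun r => r) r 1 Hr), (is_derive_id r)|
        apply is_derive_R_minus; [exact (is_derive_R_scal _ (cos t) _ _ B)|exact (is_derive_R_scal _ (sin t) _ _ A)]]|]].
    - intros z. unfold pol_t. rring.
    - rewrite clamp_id by lra. ring. }
  split.
  - split.
    + intros; now apply continuity_pol.
    + intros. unfold pol_r. cont2; now apply continuity_pol.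
    + intros. unfold pol_t. cont2; try apply continuity_clamp; now apply continuity_pol.
    + intros; apply pol_per.
    + intros; unfold pol_r. now rewrite !pol_per, cos_per, sin_per.
    + intros; unfold pol_t. now rewrite !pol_per, cos_per, sin_per.
    + intros r t Hr. now apply is_derive_polar.
    + intros r t Hr. unfold pol_t. rewrite clamp_id by lra. now apply is_derive_polar.
    + exists (fun r t => pol_r Fx Fy r t + r * ((pol Gxx r t * cos t + pol Gxy r t * sin t) * cos t
       + (pol Gyx r t * cos t + pol Gyy r t * sin t) * sin t)).
      intros r t Hr. split; [|split].
      * eapply is_derive_eq; [apply is_derive_R_mult; [apply (is_derive_id r)|now apply Drr]|].
        unfold one; simpl; ring.
      * eapply is_derive_eq; [now apply Dtt|].
        rewrite (Hmixp r t Hr), (Hlap r t Hr). unfold pol_r. ring.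
      * unfold pol_r. cont2; try (now apply continuity_pol); now apply continuity_pol_open.
  - exists (fun r t => (pol Fy r t * cos t - pol Fx r t * sin t)
      + r * ((pol Gxy r t * cos t - pol Gxx r t * sin t) * cos t
         + (pol Gyy r t * cos t - pol Gyx r t * sin t) * sin t)).
    intros r t Hr. split; [|split].
    + eapply is_derive_eq; [now apply Dtr|]. rewrite (Hmixp r t Hr). ring.
    + now apply Drt.
    + cont2; try (now apply continuity_pol); now apply continuity_pol_open.
Qed.

(** * Boundary behaviour of disk homeomorphisms *)

Lemma poisson_formula (U Ur Ut : R -> R -> R) (m r t : R) :
  polar_harmonic U Ur Ut -> (forall r t, Rabs (U r t) <= m) -> 0 <= r < 1 ->
  RInt (fun s => pois r s * U 1 (s + t)) (- PI) PI = 2 * PI * U r t.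
Proof.
  intros HU Hm [[Hr | <-] Hr1]; [now apply (poisson_formula_punctured U Ur Ut m)|].
  (* The radius is reversed, [r = 1 - x], so that the origin is approached as [x] tends to [1] from
     the left. *)
  set (g := fun x => RInt (fun s => pois (1 - x) s * U 1 (s + t)) (- PI) PI - 2 * PI * U (1 - x) t).
  assert (Hg : continuous g 1).
  { apply (continuous_R_minus (fun x => RInt (fun s => pois (1 - x) s * U 1 (s + t)) (- PI) PI)
      (fun x => 2 * PI * U (1 - x) t)).
    - apply (continuous_RInt_param (fun x s => pois (1 - x) s * U 1 (s + t)) 0 2); try lra.
      + generalize PI_RGT_0; lra.
      + intros y s Hy. cont2.
        * apply (continuity_2d_pt_comp pois (fun x _ => 1 - x) (fun _ s => s)); cont2.
          apply continuity_pois. lra.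
        * apply (continuity_2d_pt_comp U (fun _ _ => 1) (fun _ s => s + t)); cont2. apply HU.
    - cont1. apply (continuous_comp_2d U (fun x => 1 - x) (fun _ => t)); cont1. apply HU. }
  assert (Hz : forall x, 0 < x < 1 -> g x = 0).
  { intros x Hx. unfold g. rewrite (poisson_formula_punctured U Ur Ut m) by (auto; lra). apply Rminus_diag. }
  assert (G1 := continuous_left_ge g 0 Hg ltac:(intros; rewrite Hz; lra)).
  assert (G2 := continuous_left_le g 0 Hg ltac:(intros; rewrite Hz; lra)).
  unfold g in G1, G2. rewrite Rminus_diag in G1, G2. lra.
Qed.

Lemma polar_coordinates (x y : R) : exists r t, 0 <= r /\ x = r * cos t /\ y = r * sin t.
Proof.
  assert (Hn : 0 <= x ^ 2 + y ^ 2) by nra.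
  destruct (Req_dec (x ^ 2 + y ^ 2) 0) as [H0|H0].
  - exists 0, 0. assert (x = 0) by nra. assert (y = 0) by nra. repeat split; lra.
  - set (r := sqrt (x ^ 2 + y ^ 2)).
    assert (Hr : 0 < r) by (apply sqrt_lt_R0; lra).
    assert (Hrr : r * r = x ^ 2 + y ^ 2) by (apply sqrt_sqrt; lra).
    destruct (unit_angle (x / r) (y / r)) as (k & Hx & Hy).
    { replace ((x / r) ^ 2 + (y / r) ^ 2) with ((x ^ 2 + y ^ 2) / (r * r)) by (field; lra).
      rewrite Hrr. field. lra. }
    exists r, k. rewrite <- Hx, <- Hy. repeat split; [lra|field; lra|field; lra].
Qed.

(** The equality case of the Cauchy-Schwarz inequality. *)
Lemma unit_dot_eq (a b x y : R) :
  a ^ 2 + b ^ 2 <= 1 -> x ^ 2 + y ^ 2 <= 1 -> a * x + b * y = 1 -> x = a /\ y = b.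
Proof.
  intros H1 H2 H3. assert (H : (x - a) ^ 2 + (y - b) ^ 2 <= 0) by nra.
  assert (Hz : forall z, z ^ 2 <= 0 -> z = 0) by (intros; nra).
  generalize (pow2_ge_0 (x - a)) (pow2_ge_0 (y - b)). intros.
  split; apply Rminus_diag_uniq, Hz; lra.
Qed.

Lemma angle_eq (a b : R) : cos a = cos b -> sin a = sin b -> - (2 * PI) < a - b < 2 * PI -> a = b.
Proof.
  intros Hc Hs Hab. apply Rminus_diag_uniq, cos_eq_1_bounded; auto.
  rewrite cos_minus, Hc, Hs. generalize (sin2_cos2 b). unfold Rsqr. lra.
Qed.

(* Strong maximum principle, from the positivity of the Poisson kernel. *)
Lemma interior_to_interior (U Ur Ut V Vr Vt : R -> R -> R) (r t : R) :
  polar_harmonic U Ur Ut -> polar_harmonic V Vr Vt ->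
  (forall r t, U r t ^ 2 + V r t ^ 2 <= 1) ->
  (forall s h, 0 < h < 2 * PI -> ~ (U 1 (s + h) = U 1 s /\ V 1 (s + h) = V 1 s)) ->
  0 <= r < 1 -> U r t ^ 2 + V r t ^ 2 < 1.
Proof.
  intros HU HV Hb Hinj Hr. assert (Hpi := PI_RGT_0).
  destruct (Hb r t) as [|H1]; auto. exfalso.
  assert (BU : forall r t, Rabs (U r t) <= 1).
  { intros x y. apply Rabs_le. generalize (Hb x y). nra. }
  assert (BV : forall r t, Rabs (V r t) <= 1).
  { intros x y. apply Rabs_le. generalize (Hb x y). nra. }
  set (a := U r t) in *. set (b := V r t) in *.
  assert (CP : forall s, continuous (pois r) s)
    by (intros; apply continuous_slice_r, continuity_pois; lra).
  assert (CU : forall s, continuous (fun s => U 1 (s + t)) s).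
  { intros. apply (continuous_R_comp (U 1) (fun s => s + t)); [cont1|apply continuous_slice_r, HU]. }
  assert (CV : forall s, continuous (fun s => V 1 (s + t)) s).
  { intros. apply (continuous_R_comp (V 1) (fun s => s + t)); [cont1|apply continuous_slice_r, HV]. }
  (* [(a, b)] is a unit vector, so [1 - (a * U + b * V) >= 0] on the circle, with Poisson mean
     [1 - (a ^ 2 + b ^ 2) = 0]. Its vanishing makes the boundary map constant on an arc. *)
  assert (Hz : forall s, - PI < s < PI -> pois r s * (1 - (a * U 1 (s + t) + b * V 1 (s + t))) = 0).
  { apply RInt_zero_nonneg; [lra|intros; cont1; auto| |].
    - intros s _. apply Rmult_le_pos; [apply Rlt_le, pois_pos; lra|].
      generalize (Hb 1 (s + t)). intros.
      generalize (pow2_ge_0 (a - U 1 (s + t))) (pow2_ge_0 (b - V 1 (s + t))). lra.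
    - rewrite (RInt_cont_ext _ (fun s => pois r s - (a * (pois r s * U 1 (s + t))
        + b * (pois r s * V 1 (s + t))))) by (intros; rring).
      rewrite RInt_minus_cont, RInt_plus_cont, !RInt_scal_cont by (intros; cont1; auto).
      rewrite (poisson_formula U Ur Ut 1), (poisson_formula V Vr Vt 1), RInt_pois by auto.
      fold a b. right. replace (2 * PI - (a * (2 * PI * a) + b * (2 * PI * b)))
        with (2 * PI * (1 - (a ^ 2 + b ^ 2))) by ring. rewrite H1. ring. }
  assert (He : forall s, - PI < s < PI -> U 1 (s + t) = a /\ V 1 (s + t) = b).
  { intros s Hs. apply unit_dot_eq; [lra|apply Hb|].
    assert (E := Hz s Hs). assert (P := pois_pos r s ltac:(lra)).
    apply Rmult_integral in E. destruct E; lra. }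
  apply (Hinj t 1); [generalize PI2_1; lra|].
  destruct (He 0 ltac:(lra)) as [E1 E2]. destruct (He 1 ltac:(generalize PI2_1; lra)) as [E3 E4].
  rewrite Rplus_0_l in E1, E2. rewrite (Rplus_comm t 1), E1, E2, E3, E4. auto.
Qed.

(* A continuous injective map from the circle to itself is onto: otherwise the stereographic
   projection from a missed point [(a, b)] would give a continuous injective real function on the
   circle, but every continuous real function takes equal values at some pair of antipodes. *)
Lemma circle_map_onto (X Y : R -> R) (a b : R) :
  (forall t, continuous X t) -> (forall t, continuous Y t) ->
  (forall t, X (t + 2 * PI) = X t) -> (forall t, Y (t + 2 * PI) = Y t) ->
  (forall t, X t ^ 2 + Y t ^ 2 = 1) -> a ^ 2 + b ^ 2 = 1 ->
  (forall t, ~ (X (t + PI) = X t /\ Y (t + PI) = Y t)) ->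
  exists t, X t = a /\ Y t = b.
Proof.
  intros CX CY PX PY Hn Hab Hinj. apply NNPP. intros Hno.
  assert (Hpi := PI_RGT_0).
  (* Coordinates rotated so that [(a, b)] becomes [(1, 0)]; then [s / (1 - c)] is the stereographic
     coordinate. *)
  set (c := fun t => a * X t + b * Y t). set (s := fun t => a * Y t - b * X t).
  assert (Hcs : forall t, c t ^ 2 + s t ^ 2 = 1).
  { intros t. unfold c, s.
    replace ((a * X t + b * Y t) ^ 2 + (a * Y t - b * X t) ^ 2)
      with ((a ^ 2 + b ^ 2) * (X t ^ 2 + Y t ^ 2)) by ring.
    rewrite Hn, Hab. ring. }
  assert (Hc : forall t, 0 < 1 - c t).
  { intros t. assert (c t <= 1) by (generalize (Hcs t); nra).
    destruct H as [H|H]; [lra|]. exfalso. apply Hno. exists t.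
    apply unit_dot_eq; [lra|rewrite Hn; lra|exact H]. }
  set (k := fun t => s t / (1 - c t)).
  set (g := fun t => k (t + PI) - k t).
  assert (Ck : forall t, continuous k t).
  { intros t. unfold k, s, c. cont1; auto. generalize (Hc t). unfold c. lra. }
  assert (Cg : forall t, continuous g t).
  { intros t. apply (continuous_R_minus (fun t => k (t + PI)) k); auto.
    apply (continuous_R_comp k (fun t => t + PI)); [cont1|auto]. }
  assert (Hg : g PI = - g 0).
  { unfold g. rewrite Rplus_0_l. replace (PI + PI) with (0 + 2 * PI) by ring.
    assert (Pk : k (0 + 2 * PI) = k 0) by (unfold k, s, c; now rewrite PX, PY).
    rewrite Pk. ring. }
  destruct (IVT_gen_consistent g 0 PI 0 Cg) as [t [_ Ht]].
  { rewrite Hg. unfold Rmin, Rmax. destruct (Rle_dec (g 0) (- g 0)); lra. }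
  assert (Hk : k (t + PI) = k t) by (unfold g in Ht; lra).
  assert (H1 := Hc t). assert (H2 := Hc (t + PI)).
  assert (H3 := Hcs t). assert (H4 := Hcs (t + PI)).
  assert (Hkt : s t = k t * (1 - c t)) by (unfold k; field; lra).
  assert (Hkp : s (t + PI) = k t * (1 - c (t + PI))) by (rewrite <- Hk; unfold k; field; lra).
  assert (Q1 : 1 + c t = k t ^ 2 * (1 - c t)).
  { rewrite Hkt in H3. apply Rmult_eq_reg_r with (1 - c t); [|lra]. nra. }
  assert (Q2 : 1 + c (t + PI) = k t ^ 2 * (1 - c (t + PI))).
  { rewrite Hkp in H4. apply Rmult_eq_reg_r with (1 - c (t + PI)); [|lra]. nra. }
  assert (Hce : c (t + PI) = c t).
  { assert (E : (1 + k t ^ 2) * (c (t + PI) - c t) = 0) by lra.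
    apply Rmult_integral in E. generalize (pow2_ge_0 (k t)). destruct E; lra. }
  assert (Hse : s (t + PI) = s t) by (rewrite Hkp, Hkt, Hce; auto).
  assert (HX : forall t, X t = a * c t - b * s t).
  { intros u. unfold c, s. replace (a * (a * X u + b * Y u) - b * (a * Y u - b * X u))
      with ((a ^ 2 + b ^ 2) * X u) by ring. rewrite Hab. ring. }
  assert (HY : forall t, Y t = b * c t + a * s t).
  { intros u. unfold c, s. replace (b * (a * X u + b * Y u) + a * (a * Y u - b * X u))
      with ((a ^ 2 + b ^ 2) * Y u) by ring. rewrite Hab. ring. }
  apply (Hinj t). now rewrite (HX (t + PI)), (HY (t + PI)), Hce, Hse, <- HX, <- HY.
Qed.

(** The lift is a primitive of the angular speed [A * B' - B * A']: the scalar product of [(A, B)]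
    with [(cos phi, sin phi)] has zero derivative and equals [1] at [0], so the two unit vectors
    coincide. For a reversed orientation the lift is [- phi], whence the sign in front of the
    sine. *)
Lemma circle_lift_exists (A B A' B' : R -> R) :
  (forall t, is_derive A t (A' t)) -> (forall t, is_derive B t (B' t)) ->
  (forall t, continuous A' t) -> (forall t, continuous B' t) ->
  (forall t, A (t + 2 * PI) = A t) -> (forall t, B (t + 2 * PI) = B t) ->
  (forall t, A' (t + 2 * PI) = A' t) -> (forall t, B' (t + 2 * PI) = B' t) ->
  (forall t, A t ^ 2 + B t ^ 2 = 1) ->
  (forall t h, 0 < h < 2 * PI -> ~ (A (t + h) = A t /\ B (t + h) = B t)) ->
  exists phi w, circle_lift phi w /\ (forall t, A t = cos (phi t)) /\
    ((forall t, B t = sin (phi t)) \/ (forall t, B t = - sin (phi t))).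
Proof.
  intros DA DB CA' CB' PA PB PA' PB' Hn Hinj. assert (Hpi := PI_RGT_0).
  assert (CA : forall t, continuous A t) by (intros; eapply continuous_is_derive; eauto).
  assert (CB : forall t, continuous B t) by (intros; eapply continuous_is_derive; eauto).
  set (w := fun t => A t * B' t - B t * A' t).
  assert (Cw : forall t, continuous w t) by (intros; unfold w; cont1; auto).
  destruct (unit_angle (A 0) (B 0) (Hn 0)) as (k & Hk1 & Hk2).
  set (phi := fun t => k + RInt w 0 t).
  assert (Dphi : forall t, is_derive phi t (w t)).
  { intros t. eapply is_derive_eq.
    - apply (is_derive_R_plus (fun _ => k) (RInt w 0)); [apply (is_derive_const k)|].
      now apply is_derive_upper.
    - unfold zero; simpl; ring. }
  assert (Cphi : forall t, continuous phi t) by (intros; eapply continuous_is_derive; eauto).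
  assert (Hort : forall t, A t * A' t + B t * B' t = 0).
  { intros t.
    assert (E : is_derive (fun t => A t * A t + B t * B t) t (A' t * A t + A t * A' t + (B' t * B t + B t * B' t))).
    { apply is_derive_R_plus; apply is_derive_R_mult; auto. }
    assert (E' : is_derive (fun t => A t * A t + B t * B t) t 0).
    { apply is_derive_ext with (fun _ => 1); [|apply (is_derive_const 1)].
      intros x. rewrite <- (Hn x). rring. }
    apply is_derive_unique in E. apply is_derive_unique in E'. lra. }
  assert (HA' : forall t, A' t = - (w t * B t)).
  { intros t. unfold w. assert (H1 := Hort t). assert (H2 := Hn t).
    transitivity (A' t * (A t ^ 2 + B t ^ 2)); [rewrite H2; ring|].
    transitivity (A t * (A t * A' t + B t * B' t) - (A t * B' t - B t * A' t) * B t); [ring|].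
    rewrite H1. ring. }
  assert (HB' : forall t, B' t = w t * A t).
  { intros t. unfold w. assert (H1 := Hort t). assert (H2 := Hn t).
    transitivity (B' t * (A t ^ 2 + B t ^ 2)); [rewrite H2; ring|].
    transitivity (B t * (A t * A' t + B t * B' t) + (A t * B' t - B t * A' t) * A t); [ring|].
    rewrite H1. ring. }
  assert (HX : forall t, A t * cos (phi t) + B t * sin (phi t) = 1).
  { assert (DX : forall t, is_derive (fun t => A t * cos (phi t) + B t * sin (phi t)) t 0).
    { intros t. eapply is_derive_eq.
      - apply is_derive_R_plus; apply is_derive_R_mult; auto.
        + apply (is_derive_R_comp cos phi); [apply Dphi|apply is_derive_cos].
        + apply (is_derive_R_comp sin phi); [apply Dphi|apply is_derive_sin].
      - rewrite HA', HB'. ring. }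
    assert (E0 : A 0 * cos (phi 0) + B 0 * sin (phi 0) = 1).
    { unfold phi. rewrite RInt_point. unfold zero; simpl. rewrite Rplus_0_r, <- Hk1, <- Hk2.
      rewrite <- (Hn 0). ring. }
    intros t. rewrite <- E0. destruct (Rle_lt_dec 0 t) as [H|H].
    - apply (eq_of_zero_derive (fun t => A t * cos (phi t) + B t * sin (phi t))); auto.
      intros; eapply continuous_is_derive; eauto.
    - symmetry. apply (eq_of_zero_derive (fun t => A t * cos (phi t) + B t * sin (phi t))); auto; try lra.
      intros; eapply continuous_is_derive; eauto. }
  assert (HAB : forall t, A t = cos (phi t) /\ B t = sin (phi t)).
  { intros t. assert (E := unit_dot_eq (cos (phi t)) (sin (phi t)) (A t) (B t)).
    apply E; [generalize (sin2_cos2 (phi t)); unfold Rsqr; lra|rewrite Hn; lra|rewrite <- (HX t); ring]. }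
  set (psi := fun t h => phi (t + h) - phi t).
  assert (Hne : forall t h, 0 < h < 2 * PI -> cos (psi t h) <> 1).
  { intros t h Hh E. apply (Hinj t h Hh).
    destruct (HAB t) as [E1 E2]. destruct (HAB (t + h)) as [E3 E4].
    rewrite E1, E2, E3, E4. unfold psi in E. rewrite cos_minus in E.
    apply unit_dot_eq; generalize (sin2_cos2 (phi t)) (sin2_cos2 (phi (t + h))); unfold Rsqr; lra. }
  assert (Hper : forall t, cos (psi t (2 * PI)) = 1).
  { intros t. unfold psi. rewrite cos_minus.
    destruct (HAB t) as [E1 E2]. destruct (HAB (t + 2 * PI)) as [E3 E4].
    rewrite <- E1, <- E2, <- E3, <- E4, PA, PB, <- (Hn t). ring. }
  assert (Hadd : forall t, psi t (2 * PI) = psi t PI + psi (t + PI) PI).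
  { intros t. unfold psi. replace (t + PI + PI) with (t + 2 * PI) by ring. ring. }
  (* [psi] has no zero on the convex set of pairs [(t, h)] with [0 < h < 2 * PI], hence a constant
     sign there: this is the orientation. *)
  assert (Hline : forall t h t' h', 0 < h < 2 * PI -> 0 < h' < 2 * PI ->
     0 < psi t h -> 0 < psi t' h').
  { intros t h t' h' Hh Hh' Hp. apply Rnot_le_lt. intros Hle.
    set (g := fun x => phi (t + x * (t' - t) + (h + x * (h' - h))) - phi (t + x * (t' - t))).
    assert (Cg : forall x, continuous g x).
    { intros x. unfold g. cont1.
      - apply (continuous_R_comp phi (fun x => t + x * (t' - t) + (h + x * (h' - h)))); [cont1|auto].
      - apply (continuous_R_comp phi (fun x => t + x * (t' - t))); [cont1|auto]. }
    destruct (IVT_gen_consistent g 0 1 0 Cg) as [x [Hx E]].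
    - unfold g. rewrite !Rmult_0_l, !Rmult_1_l, !Rplus_0_r.
      replace (t + (t' - t)) with t' by ring. replace (h + (h' - h)) with h' by ring.
      fold (psi t h) (psi t' h'). rewrite Rmin_right, Rmax_left; lra.
    - rewrite Rmin_left, Rmax_right in Hx by lra.
      apply (Hne (t + x * (t' - t)) (h + x * (h' - h))).
      + destruct (Rle_lt_dec h h'); split; nra.
      + fold (psi (t + x * (t' - t)) (h + x * (h' - h))) in E.
        change (psi (t + x * (t' - t)) (h + x * (h' - h)) = 0) in E. rewrite E. apply cos_0. }
  (* The increment starts from zero at [h = 0]; to exceed [2 * PI] it would have to take this value
     before a full turn, against injectivity. *)
  assert (Hlt : forall e, e = 1 \/ e = -1 -> forall t h, 0 < h < 2 * PI -> e * psi t h < 2 * PI).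
  { intros e He t h Hh. apply Rnot_le_lt. intros Hge.
    assert (Cg : forall x, continuous (fun x => e * (phi (t + x) - phi t)) x).
    { intros x. cont1. apply (continuous_R_comp phi (fun x => t + x)); [cont1|auto]. }
    destruct (IVT_gen_consistent _ 0 h (2 * PI) Cg) as [x [Hx E]].
    - rewrite Rplus_0_r, Rminus_diag, Rmult_0_r. fold (psi t h).
      rewrite Rmin_left, Rmax_right; lra.
    - rewrite Rmin_left, Rmax_right in Hx by lra. fold (psi t x) in E.
      destruct (Req_dec x 0) as [->|Hx0].
      + unfold psi in E. rewrite Rplus_0_r, Rminus_diag, Rmult_0_r in E. lra.
      + apply (Hne t x ltac:(lra)).
        replace (cos (psi t x)) with (cos (e * psi t x)).
        * rewrite E. apply cos_2PI.
        * destruct He as [-> | ->]; [now rewrite Rmult_1_l|].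
          replace (-1 * psi t x) with (- psi t x) by ring. apply cos_neg. }
  assert (Hbound : forall e, e = 1 \/ e = -1 -> (forall t h, 0 < h < 2 * PI -> 0 < e * psi t h) ->
     circle_lift (fun t => e * phi t) (fun t => e * w t)).
  { intros e He Hp. split.
    - intros t. now apply is_derive_R_scal.
    - intros t. cont1; auto.
    - intros t.
      (* The increment over a full period has cosine one and is a sum of two increments in
         [(0, 2 * PI)], which leaves only [2 * PI]. *)
      assert (E : e * psi t (2 * PI) - 2 * PI = 0).
      { apply cos_eq_1_bounded.
        - rewrite cos_minus, cos_2PI, sin_2PI.
          destruct He as [-> | ->].
          + rewrite Rmult_1_l, Hper. ring.
          + replace (-1 * psi t (2 * PI)) with (- psi t (2 * PI)) by ring. rewrite cos_neg, Hper. ring.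
        - rewrite Hadd.
          assert (L1 := Hlt e He t PI ltac:(lra)). assert (L2 := Hlt e He (t + PI) PI ltac:(lra)).
          assert (P1 := Hp t PI ltac:(lra)). assert (P2 := Hp (t + PI) PI ltac:(lra)). lra. }
      unfold psi in E. lra.
    - intros t h Hh. replace (e * phi (t + h) - e * phi t) with (e * psi t h) by (unfold psi; ring).
      auto. }
  destruct (Rlt_le_dec 0 (psi 0 PI)) as [Hpos|Hneg].
  - exists (fun t => 1 * phi t), (fun t => 1 * w t). split; [|split; [|left]].
    + apply Hbound; auto. intros t h Hh. rewrite Rmult_1_l. apply (Hline 0 PI); auto. lra.
    + intros t. rewrite Rmult_1_l. apply HAB.
    + intros t. rewrite Rmult_1_l. apply HAB.
  - exists (fun t => -1 * phi t), (fun t => -1 * w t). split; [|split; [|right]].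
    + apply Hbound; auto. intros t h Hh.
      assert (Hle : psi t h <= 0).
      { apply Rnot_lt_le. intros Hp. generalize (Hline t h 0 PI Hh ltac:(lra) Hp). lra. }
      destruct Hle as [Hl|H0]; [lra|]. exfalso. apply (Hne t h Hh). rewrite H0. apply cos_0.
    + intros t. replace (-1 * phi t) with (- phi t) by ring. rewrite cos_neg. apply HAB.
    + intros t. replace (-1 * phi t) with (- phi t) by ring. rewrite sin_neg, Ropp_involutive. apply HAB.
Qed.

Lemma pol_1 (G : R -> R -> R) (t : R) : pol G 1 t = G (cos t) (sin t).
Proof. unfold pol. rewrite clamp_id, !Rmult_1_l by lra. reflexivity. Qed.

Lemma pol_inside (G : R -> R -> R) (r t : R) : 0 <= r <= 1 -> pol G r t = G (r * cos t) (r * sin t).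
Proof. intros Hr. unfold pol. now rewrite clamp_id. Qed.

(** [(X, Y)] is the inverse map along the circle. It stays on the circle and is onto, so
    [(cos s, sin s) = (X t, Y t)] for some [t], and [f] sends this point to [(cos t, sin t)]. *)
Lemma homeo_boundary (u v Ur Ut Vr Vt : R -> R -> R) :
  homeo_closed_disk u v -> polar_harmonic (pol u) Ur Ut -> polar_harmonic (pol v) Vr Vt ->
  (forall r t, pol u r t ^ 2 + pol v r t ^ 2 <= 1) /\
  (forall t h, 0 < h < 2 * PI -> ~ (pol u 1 (t + h) = pol u 1 t /\ pol v 1 (t + h) = pol v 1 t)) /\
  (forall t, pol u 1 t ^ 2 + pol v 1 t ^ 2 = 1).
Proof.
  intros (_ & _ & g1 & g2 & Cg1 & Cg2 & Hf & Hg & Hgf & Hfg) HU HV.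
  assert (Hpi := PI_RGT_0).
  assert (Hcirc : forall t, closed_disk (cos t) (sin t)).
  { intros t. unfold closed_disk. generalize (sin2_cos2 t). unfold Rsqr. lra. }
  assert (Hb : forall r t, pol u r t ^ 2 + pol v r t ^ 2 <= 1).
  { intros r t. apply Hf, closed_disk_clamp. }
  assert (Hinj : forall t h, 0 < h < 2 * PI ->
     ~ (pol u 1 (t + h) = pol u 1 t /\ pol v 1 (t + h) = pol v 1 t)).
  { intros t h Hh [E1 E2]. rewrite !pol_1 in E1, E2.
    destruct (Hgf _ _ (Hcirc t)) as [A1 A2]. destruct (Hgf _ _ (Hcirc (t + h))) as [B1 B2].
    rewrite E1, E2, A1 in B1. rewrite E1, E2, A2 in B2.
    assert (t + h = t); [|lra]. apply angle_eq; auto. lra. }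
  split; [exact Hb|split; [exact Hinj|]].
  intros s. rewrite !pol_1.
  set (X := fun t => g1 (cos t) (sin t)). set (Y := fun t => g2 (cos t) (sin t)).
  assert (Hfg' : forall t, u (X t) (Y t) = cos t /\ v (X t) (Y t) = sin t)
    by (intros; apply Hfg, Hcirc).
  destruct (circle_map_onto X Y (cos s) (sin s)) as (t & E1 & E2).
  - intros t. apply continuous_ext with (pol g1 1); [intros; apply pol_1|].
    now apply continuous_slice_r, continuity_pol.
  - intros t. apply continuous_ext with (pol g2 1); [intros; apply pol_1|].
    now apply continuous_slice_r, continuity_pol.
  - intros t. unfold X. now rewrite cos_per, sin_per.
  - intros t. unfold Y. now rewrite cos_per, sin_per.
  - intros t. destruct (Hg _ _ (Hcirc t)) as [Hlt|Heq]; [|exact Heq]. exfalso.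
    destruct (polar_coordinates (X t) (Y t)) as (r & a & Hr & Hx & Hy).
    change (X t ^ 2 + Y t ^ 2 < 1) in Hlt.
    rewrite Hx, Hy, polar_norm in Hlt.
    assert (Hr1 : r < 1) by nra.
    assert (E := interior_to_interior _ _ _ _ _ _ r a HU HV Hb Hinj (conj Hr Hr1)).
    rewrite !pol_inside, <- Hx, <- Hy in E by lra.
    rewrite (proj1 (Hfg' t)), (proj2 (Hfg' t)) in E.
    generalize (sin2_cos2 t). unfold Rsqr. lra.
  - generalize (sin2_cos2 s). unfold Rsqr. lra.
  - intros t [E1 E2]. destruct (Hfg' t) as [A1 A2]. destruct (Hfg' (t + PI)) as [B1 B2].
    rewrite E1, E2, A1 in B1. rewrite E1, E2, A2 in B2.
    assert (t = t + PI); [|lra]. apply angle_eq; auto. lra.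
  - rewrite <- E1, <- E2, (proj1 (Hfg' t)), (proj2 (Hfg' t)).
    generalize (sin2_cos2 t). unfold Rsqr. lra.
Qed.

Lemma polar_harmonic_unique (U Ur Ut V Vr Vt : R -> R -> R) (m r t : R) :
  polar_harmonic U Ur Ut -> polar_harmonic V Vr Vt ->
  (forall r t, Rabs (U r t) <= m) -> (forall r t, Rabs (V r t) <= m) ->
  (forall s, U 1 s = V 1 s) -> 0 <= r <= 1 -> U r t = V r t.
Proof.
  intros HU HV BU BV H1 [Hr0 [Hr | ->]]; [|auto].
  assert (Hpi := PI_RGT_0).
  apply Rmult_eq_reg_l with (2 * PI); [|lra].
  rewrite <- (poisson_formula U Ur Ut m), <- (poisson_formula V Vr Vt m) by auto.
  apply RInt_cont_ext. intros s. now rewrite H1.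
Qed.

(** The components of a rotation have this form, with phases [k] and [k - PI / 2]; they are the
    comparison functions in the equality case. *)
Lemma polar_harmonic_cos (k : R) :
  polar_harmonic (fun r t => clamp r * cos (t + k)) (fun _ t => cos (t + k))
    (fun r t => - (clamp r * sin (t + k))).
Proof.
  assert (Dc : forall t, is_derive (fun t => cos (t + k)) t (- sin (t + k)))
    by (intros; apply is_derive_shift, is_derive_cos).
  assert (Ds : forall t, is_derive (fun t => sin (t + k)) t (cos (t + k)))
    by (intros; apply is_derive_shift, is_derive_sin).
  assert (Hp : forall t, t + 2 * PI + k = t + k + 2 * PI) by (intros; ring).
  split.
  - intros; cont2; apply continuity_clamp.
  - intros; cont2.
  - intros; cont2; apply continuity_clamp.
  - intros; now rewrite Hp, cos_per.
  - intros; now rewrite Hp, cos_per.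
  - intros; now rewrite Hp, sin_per.
  - intros r t Hr. apply (is_derive_clamp (fun r => r * cos (t + k))); auto. auto_derive; auto. ring.
  - intros r t _. eapply is_derive_eq; [apply is_derive_R_scal, Dc|ring].
  - exists (fun _ t => cos (t + k)). intros r t Hr. split; [|split; [|cont2]].
    + auto_derive; auto. ring.
    + eapply is_derive_eq; [apply is_derive_R_opp, is_derive_R_scal, Ds|rewrite clamp_id by lra; ring].
Qed.

(** * The integrals of the statement in polar form *)

Lemma Rint_continuous (g : R -> R) (a b : R) :
  (forall t, continuous g t) -> Rint g a b (RInt g a b).
Proof.
  intros Hg. exists (ex_RInt_Reals_0 g a b (ex_RInt_cont g a b Hg)). symmetry. apply RInt_Reals.
Qed.

Definition radial_integral (G : R -> R -> R) (r : R) : R :=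
  RInt (fun t => pol G r t * clamp r) 0 (2 * PI).

Lemma continuous_radial_integral (G : R -> R -> R) (r : R) :
  (forall r t, continuity_2d_pt (pol G) r t) -> continuous (radial_integral G) r.
Proof.
  intros HG. apply (continuous_RInt_param (fun r t => pol G r t * clamp r) (r - 1) (r + 1)); try lra.
  - generalize PI_RGT_0; lra.
  - intros; cont2; auto. apply continuity_clamp.
Qed.

Lemma disk_integral_radial (G : R -> R -> R) :
  (forall r t, continuity_2d_pt (pol G) r t) -> disk_integral G (RInt (radial_integral G) 0 1).
Proof.
  intros HG. exists (radial_integral G). split.
  - intros r Hr. unfold radial_integral.
    rewrite (RInt_cont_ext _ (fun t => G (r * cos t) (r * sin t) * r)).
    + apply Rint_continuous. intros t.
      apply continuous_ext with (fun t => pol G r t * r).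
      * intros x. now rewrite pol_inside.
      * cont1. now apply continuous_slice_r.
    + intros t. now rewrite pol_inside, clamp_id.
  - apply Rint_continuous. intros; now apply continuous_radial_integral.
Qed.

Lemma circle_integral_pol (G : R -> R -> R) :
  (forall r t, continuity_2d_pt (pol G) r t) -> circle_integral G (RInt (pol G 1) 0 (2 * PI)).
Proof.
  intros HG. unfold circle_integral.
  rewrite (RInt_cont_ext _ (fun t => G (cos t) (sin t))) by (intros; apply pol_1).
  apply Rint_continuous. intros t. apply continuous_ext with (pol G 1).
  - intros; apply pol_1.
  - now apply continuous_slice_r.
Qed.

(** * Proof of the inequalities *)

(** The conclusion as a predicate, so that it can be transported along a reflection. *)
Definition energy_bounds (u v ux uy vx vy : R -> R -> R) : Prop :=
  exists B A J : R,
    circle_integral (fun x y => Rabs (jac ux uy vx vy x y)) B /\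
    disk_integral (HS2 ux uy vx vy) A /\
    disk_integral (fun x y => Rabs (jac ux uy vx vy x y)) J /\
    B >= A /\ A >= 2 * J /\ 2 * J = 2 * PI /\
    (B = A -> isometry_closed_disk u v).

Lemma energy_bounds_of_lift (u v ux uy vx vy : R -> R -> R) (phi w : R -> R) :
  cont_on closed_disk u -> cont_on closed_disk v ->
  harmonic_in_disk u -> harmonic_in_disk v ->
  C1_closed_disk u ux uy -> C1_closed_disk v vx vy ->
  (forall r t, pol u r t ^ 2 + pol v r t ^ 2 <= 1) ->
  circle_lift phi w -> (forall t, pol u 1 t = cos (phi t)) -> (forall t, pol v 1 t = sin (phi t)) ->
  energy_bounds u v ux uy vx vy.
Proof.
  intros Cu Cv Hu Hv C1u C1v Hb Hphi HU1 HV1. assert (Hpi := PI_RGT_0).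
  destruct (polar_harmonic_pol u ux uy Cu Hu C1u) as [HU _].
  destruct (polar_harmonic_pol v vx vy Cv Hv C1v) as [HV [M HM]].
  destruct C1u as (_ & Cux & Cuy). destruct C1v as (_ & Cvx & Cvy).
  assert (Kux := fun r t => continuity_pol ux r t Cux).
  assert (Kuy := fun r t => continuity_pol uy r t Cuy).
  assert (Kvx := fun r t => continuity_pol vx r t Cvx).
  assert (Kvy := fun r t => continuity_pol vy r t Cvy).
  assert (BU : forall r t, Rabs (pol u r t) <= 1).
  { intros x y. apply Rabs_le. generalize (Hb x y). nra. }
  assert (BV : forall r t, Rabs (pol v r t) <= 1).
  { intros x y. apply Rabs_le. generalize (Hb x y). nra. }
  set (N := HS2 ux uy vx vy). set (Jc := jac ux uy vx vy).
  set (Ja := fun x y => Rabs (jac ux uy vx vy x y)).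
  set (Nu := fun x y => ux x y ^ 2 + uy x y ^ 2). set (Nv := fun x y => vx x y ^ 2 + vy x y ^ 2).
  assert (KNu : forall r t, continuity_2d_pt (pol Nu) r t).
  { intros. change (continuity_2d_pt (fun r t => pol ux r t ^ 2 + pol uy r t ^ 2) r t). cont2; auto. }
  assert (KNv : forall r t, continuity_2d_pt (pol Nv) r t).
  { intros. change (continuity_2d_pt (fun r t => pol vx r t ^ 2 + pol vy r t ^ 2) r t). cont2; auto. }
  assert (KN : forall r t, continuity_2d_pt (pol N) r t).
  { intros. change (continuity_2d_pt (fun r t => pol ux r t ^ 2 + pol uy r t ^ 2
      + pol vx r t ^ 2 + pol vy r t ^ 2) r t). cont2; auto. }
  assert (KJ : forall r t, continuity_2d_pt (pol Jc) r t).
  { intros. change (continuity_2d_pt (fun r t => pol ux r t * pol vy r t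
      - pol uy r t * pol vx r t) r t). cont2; auto. }
  assert (KJa : forall r t, continuity_2d_pt (pol Ja) r t).
  { intros. change (continuity_2d_pt (fun r t => Rabs (pol Jc r t)) r t). cont2; auto. }
  assert (Hsc : forall t, sin t ^ 2 = 1 - cos t ^ 2)
    by (intros t; generalize (sin2_cos2 t); unfold Rsqr; lra).
  assert (Henergy : forall Fx Fy r t, 0 < r < 1 ->
     (pol Fx r t ^ 2 + pol Fy r t ^ 2) * clamp r =
     r * (pol_r Fx Fy r t * pol_r Fx Fy r t) + pol_t Fx Fy r t * pol_t Fx Fy r t / r).
  { intros Fx Fy r t Hr. unfold pol_r, pol_t. rewrite clamp_id by lra.
    generalize (pol Fx r t) (pol Fy r t). intros a b. field_simplify; [|lra].
    rewrite Hsc. ring. }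
  (* The determinant in polar coordinates is [r] times the Cartesian one. *)
  assert (Hjac : forall r t, 0 <= r <= 1 -> pol Jc r t * clamp r =
     pol_r ux uy r t * pol_t vx vy r t - pol_t ux uy r t * pol_r vx vy r t).
  { intros r t Hr. unfold pol_r, pol_t. rewrite clamp_id by lra.
    change (pol Jc r t) with (pol ux r t * pol vy r t - pol uy r t * pol vx r t).
    generalize (pol ux r t) (pol uy r t) (pol vx r t) (pol vy r t). intros a b c d.
    ring_simplify. rewrite Hsc. ring. }
  assert (EU := energy_identity _ _ _ (radial_integral Nu) HU
    (fun r => continuous_radial_integral Nu r KNu)
    (fun r Hr => RInt_cont_ext _ _ 0 (2 * PI) (fun t => Henergy ux uy r t Hr))).
  assert (EV := energy_identity _ _ _ (radial_integral Nv) HV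
    (fun r => continuous_radial_integral Nv r KNv)
    (fun r Hr => RInt_cont_ext _ _ 0 (2 * PI) (fun t => Henergy vx vy r t Hr))).
  assert (Hjr : forall r, 0 < r < 1 -> radial_integral Jc r =
     RInt (fun t => pol_r ux uy r t * pol_t vx vy r t - pol_t ux uy r t * pol_r vx vy r t) 0 (2 * PI)).
  { intros r Hr. apply RInt_cont_ext. intros t. apply Hjac. lra. }
  assert (EJ : RInt (radial_integral Jc) 0 1 = PI).
  { rewrite (area_identity _ _ _ _ _ _ M (radial_integral Jc) HU HV HM); auto.
    - now apply (boundary_area _ _ _ _ _ _ phi w HU HV).
    - intros t. unfold pol_t. rewrite clamp_id by lra. ring.
    - intros; now apply continuous_radial_integral. }
  (* The factor [r] of [Hjac] is divided out, so the origin is left aside; the radial integrals see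
     only [0 < r < 1]. *)
  assert (Hpos : forall r t, 0 < r <= 1 -> 0 <= pol Jc r t).
  { intros r t Hr. apply Rmult_le_reg_r with r; [lra|]. rewrite Rmult_0_l.
    rewrite <- (clamp_id r) at 2 by lra. rewrite Hjac by lra.
    apply (jacobian_nonneg _ _ _ _ _ _ phi w 1 HU HV BU BV Hphi HU1 HV1 (radial_integral Jc)); auto.
    - intros; now apply continuous_radial_integral.
    - lra. }
  assert (Habs : forall r t, 0 < r <= 1 -> pol Ja r t = pol Jc r t).
  { intros r t Hr. change (pol Ja r t) with (Rabs (pol Jc r t)). apply Rabs_pos_eq. auto. }
  set (B := RInt (pol Ja 1) 0 (2 * PI)).
  set (A := RInt (radial_integral N) 0 1).
  set (J := RInt (radial_integral Ja) 0 1).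
  assert (HJ : J = PI).
  { rewrite <- EJ. apply RInt_ext. intros r Hr. rewrite Rmin_left, Rmax_right in Hr by lra.
    apply RInt_cont_ext. intros t. rewrite Habs; auto. lra. }
  assert (HA2 : 2 * J <= A).
  { unfold J. rewrite <- RInt_scal_cont by (intros; now apply continuous_radial_integral).
    apply RInt_le_cont; [lra| |intros; now apply continuous_radial_integral|].
    - intros; cont1. now apply continuous_radial_integral.
    - intros r Hr. unfold radial_integral.
      assert (CJa : forall t, continuous (pol Ja r) t) by (intros; now apply continuous_slice_r).
      assert (CN : forall t, continuous (pol N r) t) by (intros; now apply continuous_slice_r).
      rewrite <- RInt_scal_cont by (intros; cont1; auto).
      apply RInt_le_cont; [lra|intros; cont1; auto|intros; cont1; auto|].
      intros t _. rewrite Habs, clamp_id by lra. rewrite <- Rmult_assoc.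
      apply Rmult_le_compat_r; [lra|].
      (* The difference of the two sides is [(ux - vy) ^ 2 + (uy + vx) ^ 2]. *)
      change (2 * (pol ux r t * pol vy r t - pol uy r t * pol vx r t) <=
        pol ux r t ^ 2 + pol uy r t ^ 2 + pol vx r t ^ 2 + pol vy r t ^ 2).
      generalize (pow2_ge_0 (pol ux r t - pol vy r t)) (pow2_ge_0 (pol uy r t + pol vx r t)). lra. }
  assert (EA : A = RInt (fun t => pol u 1 t * pol_r ux uy 1 t) 0 (2 * PI)
      + RInt (fun t => pol v 1 t * pol_r vx vy 1 t) 0 (2 * PI)).
  { rewrite <- EU, <- EV, <- RInt_plus_cont by (intros; now apply continuous_radial_integral).
    apply RInt_cont_ext. intros r. unfold radial_integral.
    rewrite <- RInt_plus_cont.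
    - apply RInt_cont_ext. intros t.
      change ((pol ux r t ^ 2 + pol uy r t ^ 2 + pol vx r t ^ 2 + pol vy r t ^ 2) * clamp r =
       (pol ux r t ^ 2 + pol uy r t ^ 2) * clamp r + (pol vx r t ^ 2 + pol vy r t ^ 2) * clamp r).
      ring.
    - intros; cont1. now apply continuous_slice_r.
    - intros; cont1. now apply continuous_slice_r. }
  assert (EB : B = RInt (boundary_jacobian (pol_r ux uy) (pol_t ux uy) (pol_r vx vy) (pol_t vx vy))
      0 (2 * PI)).
  { apply RInt_cont_ext. intros t. rewrite Habs by lra. unfold boundary_jacobian.
    rewrite <- Hjac, clamp_id by lra. ring. }
  assert (Hgap := boundary_gap _ _ _ _ _ _ phi w 1 HU HV BU BV Hphi HU1 HV1).
  rewrite <- EA, <- EB in Hgap.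
  assert (HD : 0 <= RInt (lift_defect phi) (- PI) PI).
  { apply RInt_ge_0; [lra| |].
    - apply ex_RInt_cont. intros; now apply continuous_lift_defect with w.
    - intros; now apply lift_defect_ge_0 with w. }
  assert (HD' : 0 <= RInt (lift_defect phi) (- PI) PI / (16 * PI)) by (apply Rdiv_le_0_compat; lra).
  exists B, A, J. split; [|split; [|split; [|split; [|split; [|split]]]]].
  - now apply circle_integral_pol with (G := Ja).
  - now apply disk_integral_radial.
  - now apply disk_integral_radial with (G := Ja).
  - lra.
  - lra.
  - lra.
  - intros HBA.
    assert (HD0 : RInt (lift_defect phi) (- PI) PI <= 0).
    { replace (RInt (lift_defect phi) (- PI) PI)
        with (RInt (lift_defect phi) (- PI) PI / (16 * PI) * (16 * PI)) by (field; lra).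
      nra. }
    (* On the circle [f] is the rotation by [k], hence also in the disk, both maps being
       harmonic. *)
    assert (Ht := lift_translation phi w Hphi HD0). set (k := phi PI - PI) in Ht.
    assert (Bc : forall k r t, Rabs (clamp r * cos (t + k)) <= 1).
    { intros k' r t. rewrite Rabs_mult.
      generalize (cos_bound_abs (t + k')) (clamp_bound r). intros.
      rewrite (Rabs_pos_eq (clamp r)) by lra. generalize (Rabs_pos (cos (t + k'))). nra. }
    assert (Eu : forall r t, 0 <= r <= 1 -> pol u r t = clamp r * cos (t + k)).
    { intros r t Hr.
      apply (polar_harmonic_unique _ _ _ _ _ _ 1 r t HU (polar_harmonic_cos k)); auto.
      intros s. rewrite HU1, clamp_id, Rmult_1_l, Ht by lra. reflexivity. }
    assert (Ev : forall r t, 0 <= r <= 1 -> pol v r t = clamp r * cos (t + (k - PI / 2))).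
    { intros r t Hr.
      apply (polar_harmonic_unique _ _ _ _ _ _ 1 r t HV (polar_harmonic_cos (k - PI / 2))); auto.
      intros s. rewrite HV1, clamp_id, Rmult_1_l, Ht by lra.
      rewrite <- cos_shift, <- cos_neg. f_equal. ring. }
    assert (Hlin : forall x y, closed_disk x y ->
       u x y = x * cos k - y * sin k /\ v x y = x * sin k + y * cos k).
    { intros x y Hxy. destruct (polar_coordinates x y) as (r & t & Hr & Hx & Hy).
      unfold closed_disk in Hxy. rewrite Hx, Hy, polar_norm in Hxy.
      assert (Hr1 : 0 <= r <= 1) by nra.
      rewrite Hx, Hy, <- !pol_inside, Eu, Ev, clamp_id by auto.
      split.
      - rewrite cos_plus. ring.
      - replace (t + (k - PI / 2)) with (- (PI / 2 - (t + k))) by ring.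
        rewrite cos_neg, cos_shift, sin_plus. ring. }
    intros x y x' y' H H'.
    destruct (Hlin x y H) as [-> ->]. destruct (Hlin x' y' H') as [-> ->].
    replace ((x * cos k - y * sin k - (x' * cos k - y' * sin k)) ^ 2 +
      (x * sin k + y * cos k - (x' * sin k + y' * cos k)) ^ 2)
      with (((x - x') ^ 2 + (y - y') ^ 2) * (sin k ^ 2 + cos k ^ 2)) by ring.
    rewrite Hsc. ring.
Qed.

Lemma cont_on_opp (S : R -> R -> Prop) (F : R -> R -> R) :
  cont_on S F -> cont_on S (fun x y => - F x y).
Proof.
  intros H x y Hxy eps He. destruct (H x y Hxy eps He) as (d & Hd & HH).
  exists d. split; auto. intros x' y' Hs Hl.
  replace (- F x' y' - - F x y) with (- (F x' y' - F x y)) by ring. rewrite Rabs_Ropp. auto.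
Qed.

Lemma harmonic_opp (F : R -> R -> R) :
  harmonic_in_disk F -> harmonic_in_disk (fun x y => - F x y).
Proof.
  intros (Gx & Gy & Gxx & Gxy & Gyx & Gyy & HG & C).
  exists (fun x y => - Gx x y), (fun x y => - Gy x y), (fun x y => - Gxx x y),
    (fun x y => - Gxy x y), (fun x y => - Gyx x y), (fun x y => - Gyy x y).
  split.
  - intros x y Hxy. destruct (HG x y Hxy) as (A1 & A2 & A3 & A4 & A5 & A6 & E).
    repeat split; try (apply derivable_pt_lim_opp; assumption). lra.
  - repeat split; apply cont_on_opp, C.
Qed.

Lemma C1_opp (F Fx Fy : R -> R -> R) :
  C1_closed_disk F Fx Fy ->
  C1_closed_disk (fun x y => - F x y) (fun x y => - Fx x y) (fun x y => - Fy x y).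
Proof.
  intros (HF & Cx & Cy). split; [|split; now apply cont_on_opp].
  intros x y Hxy. destruct (HF x y Hxy). split; now apply derivable_pt_lim_opp.
Qed.

(** Complex conjugation leaves [HS2], the absolute value of the Jacobian and all distances
    unchanged; this covers boundary maps that reverse orientation. *)
Lemma energy_bounds_reflect (u v ux uy vx vy : R -> R -> R) :
  energy_bounds u (fun x y => - v x y) ux uy (fun x y => - vx x y) (fun x y => - vy x y) ->
  energy_bounds u v ux uy vx vy.
Proof.
  intros (B & A & J & HB & HA & HJ & H1 & H2 & H3 & H4).
  (* The integral predicates take the integrand as a function, so the equality is stated between
     functions and not pointwise. *)
  assert (EJ : (fun x y => Rabs (jac ux uy (fun x y => - vx x y) (fun x y => - vy x y) x y)) =
     (fun x y => Rabs (jac ux uy vx vy x y))).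
  { apply functional_extensionality. intros x. apply functional_extensionality. intros y.
    rewrite <- Rabs_Ropp. f_equal. unfold jac. ring. }
  assert (EH : HS2 ux uy (fun x y => - vx x y) (fun x y => - vy x y) = HS2 ux uy vx vy).
  { apply functional_extensionality. intros x. apply functional_extensionality. intros y.
    unfold HS2. ring. }
  rewrite EJ in HB, HJ. rewrite EH in HA.
  exists B, A, J. repeat (split; [assumption|]).
  intros E x y x' y' Hx Hx'. rewrite <- (H4 E x y x' y' Hx Hx'). ring.
Qed.

Theorem theorem1p6 (u v ux uy vx vy : R -> R -> R) :
  homeo_closed_disk u v ->
  harmonic_in_disk u -> harmonic_in_disk v ->
  C1_closed_disk u ux uy -> C1_closed_disk v vx vy ->
  exists B A J : R,
    circle_integral (fun x y => Rabs (jac ux uy vx vy x y)) B /\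
    disk_integral (HS2 ux uy vx vy) A /\
    disk_integral (fun x y => Rabs (jac ux uy vx vy x y)) J /\
    B >= A /\ A >= 2 * J /\ 2 * J = 2 * PI /\
    (B = A -> isometry_closed_disk u v).
Proof.
  intros Hh Hu Hv C1u C1v.
  change (energy_bounds u v ux uy vx vy).
  assert (Cu := proj1 Hh). assert (Cv := proj1 (proj2 Hh)).
  destruct (polar_harmonic_pol u ux uy Cu Hu C1u) as [HU _].
  destruct (polar_harmonic_pol v vx vy Cv Hv C1v) as [HV _].
  destruct (homeo_boundary u v _ _ _ _ Hh HU HV) as (Hb & Hinj & H1).
  destruct (circle_lift_exists (pol u 1) (pol v 1) (pol_t ux uy 1) (pol_t vx vy 1))
    as (phi & w & Hphi & HU1 & [HV1|HV1]); auto;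
    try (intros; solve [apply HU | apply HV
      | apply continuous_slice_r, HU | apply continuous_slice_r, HV]).
  - intros t. now apply is_derive_boundary with (pol_r ux uy).
  - intros t. now apply is_derive_boundary with (pol_r vx vy).
  - now apply energy_bounds_of_lift with phi w.
  - apply energy_bounds_reflect. apply energy_bounds_of_lift with phi w; auto using cont_on_opp, harmonic_opp, C1_opp.
    + intros r t. generalize (Hb r t). unfold pol. nra.
    + intros t. unfold pol in *. rewrite HV1. ring.
Qed.
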